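(* Let $n\geq 1$ and consider a $\mathcal C^1$ contractive invertible IFS $(\Phi,M)$, $\Phi=(\phi_0,\phi_1,\ldots,\phi_n)$, whose strict attractive basin $M$ is diffeomorphic to a $d$-dimensional ball. Then the group $\mathfrak{diff}^1_M(C_\Phi)$ contains (a subgroup isomorphic to) the Thompson group $F_{n+1}$ when $d=1$, and the Thompson group $V_{n+1}$ when $d\geq 2$.
   Context: Let $U$ be an orientable manifold (possibly non-compact), endowed with a distance, and let $\phi_j:U\to U$, $j=0,\ldots,n$, be orientation preserving homeomorphisms onto their images. $\Phi=(\phi_0,\ldots,\phi_n)$ has strict attractive basin $M$ if $M\subset U$ is a compact orientable submanifold such that (1) $\phi_j(M)\subset \mathrm{int}(M)$ for all $j$; (2) $\phi_i(M)\cap\phi_j(M)=\emptyset$ for all $i\neq j$. The pair $(\Phi,M)$ is then called an invertible IFS (iterated function system). It is of class $\mathcal C^1$ if the $\phi_j$ are $\mathcal C^1$-diffeomorphisms onto their images, and contractive if every $\phi_j$ has Lipschitz constant strictly smaller than $1$, i.e. $\sup_{x\ne y} d(\phi_j(x),\phi_j(y))/d(x,y)<1$. $C_\Phi\subset M$ is the unique non-empty compact set with $C_\Phi=\bigcup_{i=0}^n\phi_i(C_\Phi)$. $\mathfrak{diff}^1_M(C_\Phi)$ is the group of transformations of $C_\Phi$ that arise as restrictions of $\mathcal C^1$-diffeomorphisms of $M$ sending $C_\Phi$ to itself. Thompson groups: for $m\geq2$ let $X_m=\{0,\ldots,m-1\}^{\mathbb N}$ (the boundary of the rooted $m$-ary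 tree). $V_m$ is the group of homeomorphisms $h$ of $X_m$ for which there are two finite families of finite words $w_1,\ldots,w_N$ and $w_1',\ldots,w_N'$ (the leaves of two finite rooted $m$-ary subtrees) such that $X_m=\bigsqcup_i w_iX_m=\bigsqcup_i w_i'X_m$ and $h(w_is)=w_i's$ for all $i$ and all $s\in X_m$. $F_m\subset V_m$ is the subgroup of those $h$ preserving the lexicographic order. Equivalently, $F_m$ is the group of piecewise affine homeomorphisms of $[0,1]$ with finitely many breakpoints, in $\mathbb Z[1/m]$, and slopes that are powers of $m$. *)

(* Defs.v *)
From HB Require Import structures.
From mathcomp Require Import all_boot all_order all_algebra.
From mathcomp Require Import all_classical all_reals all_analysis.
Import Order.TTheory GRing.Theory Num.Theory.
Import numFieldNormedType.Exports.

Set Implicit Arguments.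
Unset Strict Implicit.
Unset Printing Implicit Defensive.

Local Open Scope classical_set_scope.
Local Open Scope ring_scope.

(** * C^1 manifolds *)

(* The maps are total functions; they are only meaningful on [cdom] and on its
   image respectively. *)
Record chart (R : realType) (T : topologicalType) (d : nat) := Chart {
  cdom : set T ;
  cmap : T -> 'rV[R]_d ;
  cinv : 'rV[R]_d -> T }.

Definition is_chart (R : realType) (T : topologicalType) (d : nat)
    (c : chart R T d) : Prop :=
  [/\ open (cdom c),
      open (cmap c @` cdom c),
      forall p, cdom c p -> cinv c (cmap c p) = p,
      {within cdom c, continuous (cmap c)} &
      {within cmap c @` cdom c, continuous (cinv c)}].

(* f is of class C^1 on a neighbourhood of x. *)
Definition C1_near (R : realType) (p q : nat) (f : 'rV[R]_p -> 'rV[R]_q)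
    (x : 'rV[R]_p) : Prop :=
  \forall y \near x, differentiable f y /\ {for y, continuous (jacobian f)}.

Definition covering (R : realType) (T : topologicalType) (d : nat)
    (A : set (chart R T d)) (M : set T) : Prop :=
  forall p, M p -> exists2 c, A c & cdom c p.

Definition C1_atlas (R : realType) (T : topologicalType) (d : nat)
    (A : set (chart R T d)) : Prop :=
  [/\ forall c, A c -> is_chart c,
      covering A setT &
      forall c1 c2, A c1 -> A c2 -> forall p, cdom c1 p -> cdom c2 p ->
        C1_near (cmap c2 \o cinv c1) (cmap c1 p)].

Definition euclidean_atlas (R : realType) (d : nat)
    : set (chart R 'rV[R]_d d) :=
  [set Chart setT id id].
Arguments euclidean_atlas : clear implicits.

(* f is of class C^1 on a neighbourhood of p (in all pairs of charts). *)
Definition C1_at (R : realType) (T1 T2 : topologicalType) (d1 d2 : nat)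
    (A1 : set (chart R T1 d1)) (A2 : set (chart R T2 d2))
    (f : T1 -> T2) (p : T1) : Prop :=
  {for p, continuous f} /\
  forall c1 c2, A1 c1 -> A2 c2 -> cdom c1 p -> cdom c2 (f p) ->
    C1_near (cmap c2 \o f \o cinv c1) (cmap c1 p).

(* On an arbitrary subset S (e.g. a submanifold with boundary), a map is C^1
   when it extends, locally around each point of S, to a C^1 map defined on a
   neighbourhood in the ambient manifold. *)
Definition C1_on (R : realType) (T1 T2 : topologicalType) (d1 d2 : nat)
    (A1 : set (chart R T1 d1)) (A2 : set (chart R T2 d2))
    (S : set T1) (f : T1 -> T2) : Prop :=
  forall p, S p -> exists2 g : T1 -> T2,
    C1_at A1 A2 g p & \forall q \near p, S q -> f q = g q.

(* f restricts to a C^1-diffeomorphism from S1 onto S2, with inverse g. *)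
Definition C1_diffeo (R : realType) (T1 T2 : topologicalType) (d1 d2 : nat)
    (A1 : set (chart R T1 d1)) (A2 : set (chart R T2 d2))
    (S1 : set T1) (S2 : set T2) (f : T1 -> T2) (g : T2 -> T1) : Prop :=
  [/\ f @` S1 = S2,
      forall p, S1 p -> g (f p) = p,
      C1_on A1 A2 S1 f &
      C1_on A2 A1 S2 g].

Definition closed_unit_ball (R : realType) (d : nat) : set 'rV[R]_d :=
  [set x | \sum_i x 0 i ^+ 2 <= 1].
Arguments closed_unit_ball : clear implicits.

Definition diffeomorphic_to_ball (R : realType) (U : topologicalType)
    (D : nat) (A : set (chart R U D)) (d : nat) (M : set U) : Prop :=
  exists f g,
    C1_diffeo A (euclidean_atlas R d) M (closed_unit_ball R d) f g.

(** * Orientations and submanifolds *)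

(* Transition maps of the family O between charts of M have positive Jacobian
   determinant.  When M has a boundary, only interior points of the overlaps
   are tested: there the transition maps are differentiable in the ordinary
   sense, and the sign extends to the boundary by continuity. *)
Definition positive_transitions (R : realType) (T : topologicalType) (d : nat)
    (O : set (chart R T d)) (M : set T) : Prop :=
  forall c1 c2, O c1 -> O c2 ->
  forall x, (cmap c1 @` (M `&` cdom c1 `&` cdom c2))° x ->
    0 < \det ('J (cmap c2 \o cinv c1) x).

(* O is an oriented atlas of U defining the same C^1 structure as A. *)
Definition orientation (R : realType) (U : topologicalType) (D : nat)
    (A O : set (chart R U D)) : Prop :=
  [/\ C1_atlas (A `|` O), covering O setT & positive_transitions O setT].

(* For C^1-diffeomorphisms onto their images. *)
Definition orientation_preserving (R : realType) (U : topologicalType)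
    (D : nat) (O : set (chart R U D)) (f : U -> U) : Prop :=
  forall c1 c2, O c1 -> O c2 ->
  forall p, cdom c1 p -> cdom c2 (f p) ->
    0 < \det ('J (cmap c2 \o f \o cinv c1) (cmap c1 p)).

(* For k = 0 this is the one-point space.  Both half-spaces are needed as
   models: with a single one, a closed interval would admit no oriented
   atlas. *)
Definition half_space (R : realType) (k : nat) (b : bool) : set 'rV[R]_k :=
  [set x | forall i : 'I_k, i = 0%N :> nat -> 0 <= (-1) ^+ b * x 0 i].
Arguments half_space : clear implicits.

Definition submanifold_chart (R : realType) (U : topologicalType) (D : nat)
    (A : set (chart R U D)) (M : set U) (k : nat) (c : chart R U k) : Prop :=
  open (cdom c) /\
  exists (b : bool) (W : set 'rV[R]_k), open W /\
    C1_diffeo A (euclidean_atlas R k)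
      (M `&` cdom c) (half_space R k b `&` W) (cmap c) (cinv c).

(* M is an orientable k-dimensional C^1 submanifold, possibly with boundary. *)
Definition orientable_submanifold (R : realType) (U : topologicalType)
    (D : nat) (A : set (chart R U D)) (k : nat) (M : set U) : Prop :=
  exists O : set (chart R U k),
    [/\ forall c, O c -> submanifold_chart A M c,
        covering O M &
        positive_transitions O M].

(** * Iterated function systems *)

(* [M°] is the interior of M as a subset of U. *)
Definition strict_attractive_basin (R : realType) (U : topologicalType)
    (D : nat) (A : set (chart R U D)) (n : nat) (phi : 'I_n.+1 -> U -> U)
    (M : set U) : Prop :=
  [/\ compact M,
      exists k, orientable_submanifold A k M,
      forall j, phi j @` M `<=` M° &
      forall i j, i != j -> phi i @` M `&` phi j @` M = set0].

(* Being a homeomorphism onto the image is part of being a C^1-diffeomorphism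
   onto the image. *)
Definition C1_invertible_IFS (R : realType) (U : topologicalType)
    (D : nat) (A : set (chart R U D)) (n : nat) (phi : 'I_n.+1 -> U -> U)
    (M : set U) : Prop :=
  [/\ exists2 O, orientation A O & forall j, orientation_preserving O (phi j),
      forall j, exists g, C1_diffeo A A setT (range (phi j)) (phi j) g &
      strict_attractive_basin A phi M].

Definition lipschitz_constant (R : realType) (U : metricType R) (f : U -> U)
    : \bar R :=
  ereal_sup [set (mdist (f x.1) (f x.2) / mdist x.1 x.2)%:E
            | x in [set x : U * U | x.1 != x.2]].

Definition contractive (R : realType) (U : metricType R) (n : nat)
    (phi : 'I_n.+1 -> U -> U) : Prop :=
  forall j, (lipschitz_constant (phi j) < 1)%E.

Definition attractor (U : topologicalType) (n : nat)
    (phi : 'I_n.+1 -> U -> U) (M C : set U) : Prop :=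
  [/\ C !=set0, compact C, C `<=` M & C = \bigcup_i (phi i @` C)].

(** * Groups *)

Definition diff1 (R : realType) (U : topologicalType) (D : nat)
    (A : set (chart R U D)) (M C : set U) : set (C -> C) :=
  [set g | exists f f' : U -> U,
    [/\ C1_diffeo A A M M f f', f @` C = C &
        forall x : C, f (val x) = val (g x)]].
Arguments diff1 {R U D} A M C.

(* Infinite words [s] over {0, ..., m-1}; [prepend w s] is the word w s. *)
Definition prepend (m : nat) (w : seq 'I_m) (s : nat -> 'I_m) : nat -> 'I_m :=
  fun i => nth (s (i - size w)%N) w i.

Definition cylinder (m : nat) (w : seq 'I_m) : set (nat -> 'I_m) :=
  range (prepend w).

Definition cylinder_partition (m N : nat) (w : 'I_N -> seq 'I_m) : Prop :=
  forall x : nat -> 'I_m, exists! i, cylinder (w i) x.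

(* Such an h is automatically a homeomorphism for the product topology. *)
Definition thompson_V (m : nat) : set ((nat -> 'I_m) -> (nat -> 'I_m)) :=
  [set h | exists (N : nat) (w w' : 'I_N -> seq 'I_m),
    [/\ cylinder_partition w, cylinder_partition w' &
        forall i s, h (prepend (w i) s) = prepend (w' i) s]].

Definition lex_lt (m : nat) (s t : nat -> 'I_m) : Prop :=
  exists2 k : nat, (forall i : nat, (i < k)%N -> s i = t i) & (s k < t k)%N.

Definition thompson_F (m : nat) : set ((nat -> 'I_m) -> (nat -> 'I_m)) :=
  [set h | thompson_V h /\ forall s t, lex_lt s t -> lex_lt (h s) (h t)].

Arguments thompson_V : clear implicits.
Arguments thompson_F : clear implicits.

(* G and H are groups of transformations of S and T, with composition as group
   law; H contains a subgroup isomorphic to G. *)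
Definition contains_copy_of (T S : Type) (H : set (T -> T)) (G : set (S -> S))
    : Prop :=
  exists iota : (S -> S) -> (T -> T),
    [/\ forall g, G g -> H (iota g),
        forall g h, G g -> G h -> iota (g \o h) = iota g \o iota h &
        forall g h, G g -> G h -> iota g = iota h -> g = h].

(* Main.v *)
Require Import Defs.
From HB Require Import structures.
From mathcomp Require Import all_boot all_order all_algebra.
From mathcomp Require Import all_classical all_reals all_analysis.
From mathcomp Require Import ring lra.
Import Order.TTheory GRing.Theory Num.Theory.
Import numFieldNormedType.Exports.

(** Itineraries identify the attractor C with the space of infinite words, so
    every element h of the Thompson group acts on C; the action is faithful
    and what has to be shown is that it is induced by C^1-diffeomorphisms of M.
    If h exchanges the prefixes w i and w' i, the diffeomorphism must send
    phi_(w i) y to phi_(w' i) y for all y in C: it exchanges two finite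
    families of disjoint embedded balls.

    Through the diffeomorphism F from M to the closed unit ball, with inverse
    G, everything happens in the open unit ball of R^d: the maps F phi_j G are
    C^1-embeddings of it into itself (the dimensions agree, interior
    corresponds to interior, lemmas ballchart_dim, ballchart_F_in and
    ballchart_G_in_int), and they have positive determinant whatever G does to
    the orientation (oriented_ball_map).  A diffeomorphism of R^d with compact
    support in the open ball goes back to M, extended by the identity
    (ballchart_diff1).

    Given two families e, e' of disjoint oriented balls in the ball, a compactly
    supported diffeomorphism sending e i x to e' i x for x in a compact K is
    obtained as S'^-1 T S (match_balls).  Here S squeezes the image of K inside
    each ball e i into a tiny neighbourhood of the centre, by the conjugate
    of one and the same diffeomorphism s of the unit ball, and S' does the same
    in the balls e' i.  So T only has to match the germs of e i and e' i at 0.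
    It is a motion of the centres (move_points), followed by corrections near
    each of them (oriented_germ), where determinants must be positive because
    GL_d^+ is generated by matrices close to the identity
    (pos_det_generated).  All these diffeomorphisms are composites of small
    perturbations of the identity (bump_perturbation), which are bijective by
    the fixed point theorem of Banach.

    The dimension only matters for the motion of the centres.  If d >= 2, any
    configuration of distinct points can be moved to any other
    (move_points_dim2).  If d = 1, this requires that the centres come in the
    same order; after renaming the letters so that the images of the phi_j come
    in increasing order, the order on C is the lexicographic order of words
    (lex_word_map), which the elements of the Thompson group F preserve.

    Class C^1 is handled through strict differentiability, see strict_deriv. *)

Set Implicit Arguments.
Unset Strict Implicit.
Unset Printing Implicit Defensive.

Local Open Scope classical_set_scope.
Local Open Scope ring_scope.

(** * Strict differentiability *)

Lemma nearP (R : realType) (V : normedModType R) (p : V) (P : set V) :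
  (\forall x \near p, P x) <->
  exists2 r : R, 0 < r & forall x, `|x - p| < r -> P x.
Proof.
split=> [/nbhs_ballP[r /= r0 rP]|[r r0 rP]].
  by exists r => // x xr; apply: rP; rewrite -ball_normE /= distrC.
apply/nbhs_ballP; exists r => //= x; rewrite -ball_normE /= distrC.
exact: rP.
Qed.

Lemma open_nearP (R : realType) (V : normedModType R) (W : set V) :
  open W <-> forall x, W x ->
    exists2 r : R, 0 < r & forall y, `|y - x| < r -> W y.
Proof.
by rewrite openE; split=> oW x /oW; [move/nearP|move=> h; apply/nearP].
Qed.

Lemma continuous_atP (R : realType) (V W : normedModType R) (f : V -> W) a :
  {for a, continuous f} <->
  forall e : R, 0 < e -> exists2 r : R, 0 < r &
    forall x, `|x - a| < r -> `|f x - f a| < e.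
Proof.
split=> [/cvgrPdist_lt fa e e0|fa].
  have /nearP[r r0 rP] := fa e e0.
  by exists r => // x /rP; rewrite distrC.
apply/cvgrPdist_lt => e e0; apply/nearP; have [r r0 rP] := fa e e0.
by exists r => // x /rP; rewrite distrC.
Qed.

Lemma mx_entry_le (R : realType) (p q : nat) (A : 'M[R]_(p, q)) i j :
  `|A i j| <= `|A|.
Proof.
rewrite {2}/Num.norm /= mx_normrE.
exact: (le_bigmax _ (fun ij => `|A ij.1 ij.2|) (i, j)).
Qed.

Lemma rV_entry_le (R : realType) (d : nat) (x : 'rV[R]_d) i : `|x 0 i| <= `|x|.
Proof. exact: mx_entry_le. Qed.

Lemma mx_norm_le (R : realType) (p q : nat) (A : 'M[R]_(p, q)) c :
  0 <= c -> (forall i j, `|A i j| <= c) -> `|A| <= c.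
Proof.
move=> c0 Ac; rewrite {1}/Num.norm /= mx_normrE.
by apply: bigmax_le => // -[i j] _ /=.
Qed.

Lemma rV_norm_le (R : realType) (d : nat) (x : 'rV[R]_d) c :
  0 <= c -> (forall i, `|x 0 i| <= c) -> `|x| <= c.
Proof. by move=> c0 xc; apply: mx_norm_le => // i j; rewrite ord1. Qed.

Lemma mulmx_norm_le (R : realType) (p q : nat) (A : 'M[R]_(p, q))
  (x : 'rV_p) : `|x *m A| <= p%:R * `|A| * `|x|.
Proof.
apply: rV_norm_le => [|j]; first by rewrite !mulr_ge0.
rewrite mxE (le_trans (ler_norm_sum _ _ _)) //.
apply: (@le_trans _ _ (\sum_(i < p) `|A| * `|x|)).
  apply: ler_sum => i _; rewrite normrM mulrC.
  by rewrite ler_pM // ?rV_entry_le ?mx_entry_le.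
by rewrite sumr_const card_ord -[leLHS]mulr_natl mulrA.
Qed.

Lemma mulmx_bounded (R : realType) (p q : nat) (A : 'M[R]_(p, q)) :
  exists2 c : R, 0 < c & forall x : 'rV_p, `|x *m A| <= c * `|x|.
Proof.
have A0 : 0 <= p%:R * `|A| by rewrite mulr_ge0.
exists (1 + p%:R * `|A|) => [|x]; first lra.
by apply: le_trans (mulmx_norm_le A x) _; rewrite ler_wpM2r //; lra.
Qed.

(** The estimate is uniform in both x and y.  Holding at all points of an open
    set, it amounts to class C^1 (C1_nearP); in this form, composition and
    inversion of maps are immediate. *)
Definition strict_deriv (R : realType) (p q : nat) (f : 'rV[R]_p -> 'rV[R]_q)
    (a : 'rV[R]_p) (A : 'M[R]_(p, q)) : Prop :=
  forall e : R, 0 < e -> exists2 r : R, 0 < r & forall x y,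
    `|x - a| < r -> `|y - a| < r -> `|f x - f y - (x - y) *m A| <= e * `|x - y|.

Definition strict_diff (R : realType) (p q : nat) (f : 'rV[R]_p -> 'rV[R]_q)
    (a : 'rV[R]_p) : Prop := exists A, strict_deriv f a A.

Lemma strict_deriv_lipschitz (R : realType) (p q : nat)
    (f : 'rV[R]_p -> 'rV[R]_q) a A : strict_deriv f a A ->
  exists c r : R, [/\ 0 < c, 0 < r & forall x y, `|x - a| < r ->
    `|y - a| < r -> `|f x - f y| <= c * `|x - y|].
Proof.
move=> /(_ 1 ltr01)[r r0 fA]; have [c c0 cA] := mulmx_bounded A.
exists (1 + c), r; split=> [|//|x y xr yr]; first by lra.
have := fA _ _ xr yr; have := cA (x - y).
have := ler_normD (f x - f y - (x - y) *m A) ((x - y) *m A).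
by rewrite subrK; lra.
Qed.

Lemma strict_deriv_continuous (R : realType) (p q : nat)
    (f : 'rV[R]_p -> 'rV[R]_q) a A :
  strict_deriv f a A -> {for a, continuous f}.
Proof.
move=> /strict_deriv_lipschitz[c [r [c0 r0 fc]]].
apply/continuous_atP => e e0.
exists (Num.min r (e / c)) => [|x]; first by rewrite lt_min r0 divr_gt0.
rewrite lt_min => /andP[xr xe].
apply: le_lt_trans (fc _ _ xr _) _; first by rewrite subrr normr0.
by rewrite mulrC -ltr_pdivlMr.
Qed.

Lemma near_strict_deriv (R : realType) (p q : nat)
    (f g : 'rV[R]_p -> 'rV[R]_q) a A :
  (\forall x \near a, f x = g x) -> strict_deriv f a A -> strict_deriv g a A.
Proof.
move=> /nearP[s s0 fg] fA e e0; have [r r0 rA] := fA e e0.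
exists (Num.min r s) => [|x y]; first by rewrite lt_min r0 s0.
rewrite !lt_min => /andP[xr xs] /andP[yr ys].
by rewrite -!fg //; exact: rA.
Qed.

Lemma strict_deriv_id (R : realType) (p : nat) (a : 'rV[R]_p) :
  strict_deriv id a 1%:M.
Proof.
move=> e e0; exists 1 => // x y _ _.
by rewrite mulmx1 subrr normr0 mulr_ge0 // ltW.
Qed.

Lemma strict_deriv_cst (R : realType) (p q : nat) (b : 'rV[R]_q)
  (a : 'rV[R]_p) : strict_deriv (cst b) a 0.
Proof.
move=> e e0; exists 1 => // x y _ _.
by rewrite mulmx0 subrr subr0 normr0 mulr_ge0 // ltW.
Qed.

Lemma strict_deriv_mulmx (R : realType) (p q : nat) (A : 'M[R]_(p, q)) a :
  strict_deriv (mulmx^~ A) a A.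
Proof.
move=> e e0; exists 1 => // x y _ _.
by rewrite mulmxBl subrr normr0 mulr_ge0 // ltW.
Qed.

Lemma strict_derivD (R : realType) (p q : nat) (f g : 'rV[R]_p -> 'rV[R]_q)
    a A B : strict_deriv f a A -> strict_deriv g a B ->
  strict_deriv (fun x => f x + g x) a (A + B).
Proof.
move=> fA gB e e0; have e20 : 0 < e / 2 by lra.
have [r r0 rA] := fA _ e20; have [s s0 sB] := gB _ e20.
exists (Num.min r s) => [|x y]; first by rewrite lt_min r0 s0.
rewrite !lt_min => /andP[xr xs] /andP[yr ys].
have -> : f x + g x - (f y + g y) - (x - y) *m (A + B) =
    (f x - f y - (x - y) *m A) + (g x - g y - (x - y) *m B).
  rewrite mulmxDr; apply/rowP => i; rewrite !mxE; ring.
rewrite (le_trans (ler_normD _ _)) //.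
have := rA _ _ xr yr; have := sB _ _ xs ys; lra.
Qed.

Lemma strict_deriv_comp (R : realType) (p q s : nat)
    (f : 'rV[R]_p -> 'rV[R]_q) (g : 'rV[R]_q -> 'rV[R]_s) a A B :
  strict_deriv f a A -> strict_deriv g (f a) B ->
  strict_deriv (g \o f) a (A *m B).
Proof.
move=> fA gB e e0.
have [c [r1 [c0 r10 fc]]] := strict_deriv_lipschitz fA.
have [b b0 bB] := mulmx_bounded B.
have [r2 r20 r2B] := gB (e / 2 / c) ltac:(by rewrite !divr_gt0).
have [r3 r30 r3A] := fA (e / 2 / b) ltac:(by rewrite !divr_gt0).
exists (Num.min r1 (Num.min (r2 / c) r3)) => [|x y].
  by rewrite !lt_min r10 r30 divr_gt0.
rewrite !lt_min => /and3P[x1 x2 x3] /and3P[y1 y2 y3].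
have near_fa z : `|z - a| < r1 -> `|z - a| < r2 / c -> `|f z - f a| < r2.
  move=> z1 z2; apply: le_lt_trans (fc _ _ z1 _) _.
    by rewrite subrr normr0.
  by rewrite mulrC -ltr_pdivlMr.
have -> : (g \o f) x - (g \o f) y - (x - y) *m (A *m B) =
    (g (f x) - g (f y) - (f x - f y) *m B) +
    (f x - f y - (x - y) *m A) *m B.
  rewrite /=; move: (f x - f y) (x - y) => v w.
  by rewrite mulmxBl mulmxA addrA subrK.
rewrite (le_trans (ler_normD _ _)) //.
have h1 := r2B _ _ (near_fa _ x1 x2) (near_fa _ y1 y2).
have h2 := bB (f x - f y - (x - y) *m A).
have h3 := r3A _ _ x3 y3; have h4 := fc _ _ x1 y1.
have h5 : e / 2 / c * `|f x - f y| <= e / 2 * `|x - y|.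
  rewrite -mulrA ler_wpM2l //; first lra.
  by rewrite mulrC ler_pdivrMr // mulrC.
have h6 : b * `|f x - f y - (x - y) *m A| <= e / 2 * `|x - y|.
  rewrite mulrC -ler_pdivlMr //; apply: le_trans h3 _.
  by rewrite mulrAC.
lra.
Qed.

(** Scalar functions are taken with values in 1 x 1 matrices, so that the
    product is a matrix product and both factors have matrix derivatives. *)
Lemma strict_derivM (R : realType) (p q : nat) (f : 'rV[R]_p -> 'rV[R]_1)
    (g : 'rV[R]_p -> 'rV[R]_q) a A B :
  strict_deriv f a A -> strict_deriv g a B ->
  strict_deriv (fun x => f x *m g x) a (A *m g a + (f a 0 0) *: B).
Proof.
have scal (t : 'rV[R]_1) (v : 'rV[R]_q) : t *m v = t 0 0 *: v.
  by rewrite {1}(mx11_scalar t) mul_scalar_mx.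
have nscal (t : 'rV[R]_1) (v : 'rV[R]_q) : `|t *m v| <= `|t| * `|v|.
  by rewrite scal normrZ ler_wpM2r // rV_entry_le.
move=> fA gB e e0.
have [c [r1 [c0 r10 fc]]] := strict_deriv_lipschitz fA.
have [k [r2 [k0 r20 gk]]] := strict_deriv_lipschitz gB.
pose m := 1 + `|f a|; pose n := 1 + `|g a|.
have m0 : 0 < m by rewrite /m; have := normr_ge0 (f a); lra.
have n0 : 0 < n by rewrite /n; have := normr_ge0 (g a); lra.
have [r3 r30 r3A] := fA (e / 4 / n) ltac:(by rewrite !divr_gt0).
have [r4 r40 r4B] := gB (e / 4 / m) ltac:(by rewrite !divr_gt0).
pose r5 := e / 4 / (c * k).
have r50 : 0 < r5 by rewrite /r5 divr_gt0 ?mulr_gt0 // divr_gt0.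
exists (Num.min (Num.min r1 r2) (Num.min (Num.min r3 r4) r5)) => [|x y].
  by rewrite !lt_min r10 r20 r30 r40.
rewrite !lt_min -!andbA => /and5P[x1 x2 x3 x4 x5] /and5P[y1 y2 y3 y4 y5].
have -> : f x *m g x - f y *m g y - (x - y) *m (A *m g a + f a 0 0 *: B) =
    (f x - f y - (x - y) *m A) *m g a + (f x - f y) *m (g x - g a) +
    (f a *m (g x - g y - (x - y) *m B) + (f y - f a) *m (g x - g y)).
  rewrite mulmxDr -scalemxAr -(scal (f a)) mulmxA !mulmxBl !mulmxBr.
  move: (f x *m _) (f y *m _) (f a *m _) => /=.
  by move=> *; apply/rowP => i; rewrite !mxE; ring.
rewrite (le_trans (ler_normD _ _)) //.
have h1 := ler_normD ((f x - f y - (x - y) *m A) *m g a)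
  ((f x - f y) *m (g x - g a)).
have h2 := ler_normD (f a *m (g x - g y - (x - y) *m B))
  ((f y - f a) *m (g x - g y)).
have ca : `|a - a| < r1 by rewrite subrr normr0.
have ka : `|a - a| < r2 by rewrite subrr normr0.
have k1 : `|(f x - f y - (x - y) *m A) *m g a| <= e / 4 * `|x - y|.
  apply: le_trans (nscal _ _) _.
  apply: le_trans (ler_wpM2r _ (r3A _ _ x3 y3)) _ => //.
  rewrite mulrAC ler_wpM2r // mulrAC ler_pdivrMr //.
  by rewrite ler_wpM2l /n; lra.
have k2 : `|f a *m (g x - g y - (x - y) *m B)| <= e / 4 * `|x - y|.
  apply: le_trans (nscal _ _) _.
  apply: le_trans (ler_wpM2l _ (r4B _ _ x4 y4)) _ => //.
  rewrite mulrA ler_wpM2r // mulrA ler_pdivrMr // mulrC.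
  by rewrite ler_wpM2l /m; lra.
have ck0 : 0 < c * k by rewrite mulr_gt0.
have k3 : `|(f x - f y) *m (g x - g a)| <= e / 4 * `|x - y|.
  apply: le_trans (nscal _ _) _.
  apply: le_trans (ler_pM _ _ (fc _ _ x1 y1) (gk _ _ x2 ka)) _ => //.
  rewrite mulrACA (mulrC `|x - y|) mulrA ler_wpM2r // mulrC.
  by rewrite -ler_pdivlMr // ltW.
have k4 : `|(f y - f a) *m (g x - g y)| <= e / 4 * `|x - y|.
  apply: le_trans (nscal _ _) _.
  apply: le_trans (ler_pM _ _ (fc _ _ y1 ca) (gk _ _ x2 y2)) _ => //.
  by rewrite mulrACA mulrA ler_wpM2r // mulrC -ler_pdivlMr // ltW.
lra.
Qed.

(** * Strict differentiability and class C^1 *)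

Lemma strict_deriv_ray (R : realType) (p q : nat) (f : 'rV[R]_p -> 'rV[R]_q)
    a A e : strict_deriv f a A -> 0 < e ->
  exists2 r : R, 0 < r & forall x, `|x - a| < r ->
    `|f x - f a - (x - a) *m A| <= e * `|x - a|.
Proof.
move=> fA e0; have [r r0 rP] := fA e e0; exists r => // x xr.
by apply: rP; rewrite // subrr normr0.
Qed.

(** Linear estimates are homogeneous, hence can be checked near 0. *)
Lemma small_mulmx_le (R : realType) (p q : nat) (A : 'M[R]_(p, q)) c r :
  0 < r -> (forall v : 'rV_p, `|v| < r -> `|v *m A| <= c * `|v|) ->
  forall v : 'rV_p, `|v *m A| <= c * `|v|.
Proof.
move=> r0 rP v; have m0 : 0 < 1 + `|v| by have := normr_ge0 v; lra.
have [t t0] : exists2 t : R, 0 < t & `|t *: v| < r.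
  have t0 : 0 < r / 2 / (1 + `|v|) by rewrite !divr_gt0.
  exists (r / 2 / (1 + `|v|)) => //.
  rewrite normrZ (gtr0_norm t0) mulrAC ltr_pdivrMr //.
  have : 0 <= r * `|v| by rewrite mulr_ge0 // ltW.
  lra.
by move=> /rP; rewrite -scalemxAl !normrZ gtr0_norm // mulrCA ler_pM2l.
Qed.

Lemma mulmx_le_entries (R : realType) (p q : nat) (A : 'M[R]_(p, q)) c :
  0 <= c -> (forall v : 'rV_p, `|v *m A| <= c * `|v|) -> `|A| <= c.
Proof.
move=> c0 Ac; apply: mx_norm_le => // i j.
have -> : A i j = ((delta_mx 0 i : 'rV_p) *m A) 0 j by rewrite -(rowE i A) mxE.
apply: le_trans (rV_entry_le _ _) (le_trans (Ac _) _).
rewrite -[leRHS]mulr1 ler_wpM2l //; apply: rV_norm_le => // k.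
by rewrite mxE /= ger0_norm ?ler0n // lern1 leq_b1.
Qed.

(** This is what makes derivatives unique. *)
Lemma small_mulmx0 (R : realType) (p q : nat) (A : 'M[R]_(p, q)) :
  (forall e, 0 < e -> exists2 r : R, 0 < r & forall v : 'rV_p, `|v| < r ->
    `|v *m A| <= e * `|v|) -> A = 0.
Proof.
move=> small; apply/eqP; rewrite -normr_le0.
apply/ler_addgt0Pl => e e0; rewrite addr0.
have [r r0 rP] := small e e0.
by apply: mulmx_le_entries; [exact: ltW|exact: small_mulmx_le rP].
Qed.

Lemma strict_deriv_unique (R : realType) (p q : nat)
    (f : 'rV[R]_p -> 'rV[R]_q) a A B :
  strict_deriv f a A -> strict_deriv f a B -> A = B.
Proof.
move=> fA fB; apply/subr0_eq/small_mulmx0 => e e0.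
have e20 : 0 < e / 2 by lra.
have [r r0 rA] := strict_deriv_ray fA e20.
have [s s0 sB] := strict_deriv_ray fB e20.
exists (Num.min r s) => [|v]; first by rewrite lt_min r0 s0.
rewrite lt_min => /andP[vr vs].
have /rA : `|v + a - a| < r by rewrite addrK.
have /sB : `|v + a - a| < s by rewrite addrK.
rewrite addrK mulmxBr => h1 h2.
have -> : v *m A - v *m B =
    (f (v + a) - f a - v *m B) - (f (v + a) - f a - v *m A).
  by apply/rowP => i; rewrite !mxE; ring.
by rewrite (le_trans (ler_normB _ _)) //; lra.
Qed.

Lemma differentiable_ray (R : realType) (p q : nat) (f : 'rV[R]_p -> 'rV[R]_q)
    a e : differentiable f a -> 0 < e ->
  exists2 r : R, 0 < r & forall x, `|x - a| < r ->
    `|f x - f a - (x - a) *m 'J f a| <= e * `|x - a|.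
Proof.
move=> /diff_locallyP[_ /eqaddoP fa] e0.
have /nearP[r r0 rP] := fa e e0; exists r => // x xr.
have /rP : `|x - a - 0| < r by rewrite subr0.
rewrite /jacobian mul_rV_lin1 /= !fctE /= subrK.
by rewrite opprD addrA.
Qed.

Lemma diff_eps (R : realType) (V W : normedModType R) (f : V -> W) (a : V)
    (L : {linear V -> W}) : continuous L ->
  (forall e : R, 0 < e -> exists2 r : R, 0 < r & forall x, `|x - a| < r ->
    `|f x - f a - L (x - a)| <= e * `|x - a|) ->
  differentiable f a /\ 'd f a = L :> (V -> W).
Proof.
move=> cL fL.
have fo : f \o shift a = cst (f a) + L +o_ 0 id.
  apply/eqaddoP => e e0; apply/nearP.
  have [r r0 rP] := fL e e0; exists r => // v; rewrite subr0 => vr.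
  have /rP : `|v + a - a| < r by rewrite addrK.
  by rewrite addrK /= !fctE /= opprD addrA.
have dE := diff_unique cL fo.
by split=> //; apply/diff_locallyP; rewrite dE.
Qed.

Lemma differentiableP_ray (R : realType) (p q : nat)
    (f : 'rV[R]_p -> 'rV[R]_q) a A :
  (forall e, 0 < e -> exists2 r : R, 0 < r & forall x, `|x - a| < r ->
    `|f x - f a - (x - a) *m A| <= e * `|x - a|) ->
  differentiable f a /\ 'J f a = A.
Proof.
move=> fA.
have cA : continuous (mulmxr A : 'rV[R]_p -> 'rV[R]_q).
  by move=> x; apply: strict_deriv_continuous (strict_deriv_mulmx A x).
have [fd dE] := diff_eps cA fA.
split=> //; apply/row_matrixP => i; rewrite !rowE /jacobian mul_rV_lin1 dE.
by [].
Qed.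

(** The bridge from epsilon estimates to the one-variable mean value
    theorem. *)
Lemma is_derive_eps (R : realType) (f : R -> R) (t c : R) :
  (forall e, 0 < e -> exists2 r : R, 0 < r & forall h, `|h| < r ->
    `|f (h + t) - f t - h * c| <= e * `|h|) ->
  is_derive t 1 f c.
Proof.
move=> fc.
have cvg_c : (fun h : R => h^-1 *: ((f \o shift t) (h *: 1) - f t)) @ 0^' --> c.
  apply/cvgrPdist_le => e e0; rewrite near_withinE; apply/(@nearP R R).
  have [r r0 rP] := fc e e0; exists r => // h; rewrite subr0 => hr h0.
  have := rP _ hr; have nh0 : 0 < `|h| by rewrite normr_gt0.
  rewrite -ler_pdivrMr // => /(le_trans _); apply.
  rewrite -normfV -normrM.
  suff -> : c - h^-1 *: ((f \o shift t) (h *: 1) - f t) =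
      - ((f (h + t) - f t - h * c) / h) by rewrite normrN.
  by rewrite /GRing.scale /= mulr1; field.
apply: DeriveDef; first by apply/cvg_ex; exists c.
exact: (cvg_lim _ cvg_c).
Qed.

Lemma entryB (R : realType) (p q : nat) (A B : 'M[R]_(p, q)) i j :
  (A - B) i j = A i j - B i j.
Proof. by rewrite !mxE. Qed.

Lemma entryD (R : realType) (p q : nat) (A B : 'M[R]_(p, q)) i j :
  (A + B) i j = A i j + B i j.
Proof. by rewrite !mxE. Qed.

Lemma entryZ (R : realType) (p q : nat) c (A : 'M[R]_(p, q)) i j :
  (c *: A) i j = c * A i j.
Proof. by rewrite mxE. Qed.

Lemma chord_entry (R : realType) (q : nat) (a1 a2 a3 a4 : 'rV[R]_q) z t j :
  a1 0 j - (z + t) * a4 0 j - (a2 0 j - t * a4 0 j) - z * (a3 - a4) 0 j =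
  (a1 - a2 - z *: a3) 0 j.
Proof. by rewrite !entryB !entryZ; ring. Qed.

(** The mean value theorem, coordinate by coordinate, for the restriction to a
    segment of f minus its derivative at a. *)
Lemma C1_near_strict_deriv (R : realType) (p q : nat)
    (f : 'rV[R]_p -> 'rV[R]_q) a : C1_near f a -> strict_deriv f a ('J f a).
Proof.
move=> fa e e0.
have [fd /continuous_atP Jc] := nbhs_singleton fa.
have /nearP[r r0 rP] := fa.
pose k : R := 1 + p%:R; have k0 : 0 < k.
  by rewrite /k; have : (0 : R) <= p%:R by []; lra.
have [s s0 sP] := Jc (e / k) ltac:(by rewrite divr_gt0).
exists (Num.min r s) => [|x y]; first by rewrite lt_min r0 s0.
move=> xa ya; set v := x - y.
have [g gE] : exists g : R -> 'rV[R]_p, forall t, g t = y + t *: v.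
  by exists (fun t => y + t *: v).
have ga (t : R) : 0 <= t <= 1 -> `|g t - a| < Num.min r s.
  move=> /andP[t0 t1].
  have -> : g t - a = t *: (x - a) + (1 - t) *: (y - a).
    by rewrite gE /v; apply/rowP => i; rewrite !mxE; ring.
  apply: le_lt_trans (ler_normD _ _) _; rewrite !normrZ !ger0_norm //; last lra.
  have [->|tn0] := eqVneq t 0; first by rewrite mul0r subr0 add0r mul1r.
  have h1 : t * `|x - a| < t * Num.min r s by rewrite ltr_pM2l // lt0r tn0.
  have h2 : (1 - t) * `|y - a| <= (1 - t) * Num.min r s.
    by rewrite ler_wpM2l //; lra.
  lra.
apply: rV_norm_le => [|j]; first by rewrite mulr_ge0 // ltW.
pose h t := f (g t) 0 j - t * (v *m 'J f a) 0 j.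
have dh (t : R) : 0 <= t <= 1 -> is_derive t 1 h ((v *m ('J f (g t) - 'J f a)) 0 j).
  move=> t01; apply: is_derive_eps => d d0.
  have /rP[fgt _] : `|g t - a| < r.
    by have := ga t t01; rewrite lt_min => /andP[].
  pose m := 1 + `|v|; have m0 : 0 < m by rewrite /m; have := normr_ge0 v; lra.
  have [u u0 uP] := differentiable_ray fgt (ltac:(by rewrite divr_gt0) : 0 < d / m).
  exists (u / m) => [|z zu]; first by rewrite divr_gt0.
  have gz : g (z + t) - g t = z *: v.
    by rewrite !gE opprD addrACA subrr add0r -scalerBl addrK.
  have zv : `|z *: v| < u.
    rewrite normrZ; have : `|z| * m < u by rewrite -ltr_pdivlMr.
    by rewrite /m; have := normr_ge0 z; lra.
  have := uP (g (z + t)); rewrite gz => /(_ zv) hz.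
  have -> : h (z + t) - h t - z * (v *m ('J f (g t) - 'J f a)) 0 j =
      (f (g (z + t)) - f (g t) - (z *: v) *m 'J f (g t)) 0 j.
    rewrite /h mulmxBr -scalemxAl.
    exact: chord_entry.
  apply: le_trans (rV_entry_le _ _) (le_trans hz _).
  rewrite normrZ mulrCA mulrC ler_wpM2r //.
  by rewrite mulrAC ler_pdivrMr // ler_wpM2l ?ltW // /m; lra.
have [c c01] : exists2 c, c \in `[0, 1] &
    h 1 - h 0 = (v *m ('J f (g c) - 'J f a)) 0 j * (1 - 0).
  apply: MVT_segment => //.
    by move=> t; rewrite in_itv /= => /andP[t0 t1]; apply: dh; rewrite !ltW.
  apply: derivable_within_continuous => t; rewrite in_itv /= => t01.
  by have [] := dh t t01.
rewrite subr0 mulr1.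
have -> : h 1 - h 0 = (f x - f y - (x - y) *m 'J f a) 0 j.
  have g1 : g 1 = x by rewrite gE scale1r addrC subrK.
  have g0 : g 0 = y by rewrite gE scale0r addr0.
  by rewrite /h g1 g0 -/v mul1r mul0r subr0 !entryB [LHS]addrAC.
move=> ->.
have /sP : `|g c - a| < s.
  have := ga c; rewrite lt_min => H; move: c01; rewrite in_itv /= => /H.
  by case/andP.
move: ('J f (g c) - 'J f a) => B /ltW; rewrite ler_pdivlMr // => Bk.
apply: le_trans (rV_entry_le _ _) (le_trans (mulmx_norm_le _ _) _).
rewrite ler_wpM2r // (le_trans _ Bk) // mulrC ler_wpM2l // /k; lra.
Qed.

(** Conversely, the derivative of a map that is strictly differentiable at all
    points near a is continuous at a: letting the two points of the strict
    estimate at a tend to a third one compares the two derivatives. *)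
Lemma strict_diff_C1_near (R : realType) (p q : nat)
    (f : 'rV[R]_p -> 'rV[R]_q) a :
  (\forall x \near a, strict_diff f x) -> C1_near f a.
Proof.
have J_E x A : strict_deriv f x A -> differentiable f x /\ 'J f x = A.
  move=> fA; apply: differentiableP_ray => e e0.
  exact: strict_deriv_ray fA e0.
move=> /nearP[s s0 sP]; apply/nearP; exists s => // b bs.
have [A fA] := sP b bs; have [fd JA] := J_E _ _ fA.
split=> //; apply/continuous_atP => e e0; have e20 : 0 < e / 2 by lra.
have [r r0 rP] := fA _ e20.
exists (Num.min r (s - `|b - a|)) => [|x]; first by rewrite lt_min r0 subr_gt0.
rewrite lt_min => /andP[xr xs].
have /sP[B fB] : `|x - a| < s.
  by have := ler_distD b x a; lra.
have [_ JB] := J_E _ _ fB; rewrite JA JB.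
suff BA : `|B - A| <= e / 2 by lra.
apply/ler_addgt0Pr => d d0.
have [u u0 uP] := strict_deriv_ray fB d0.
pose t := Num.min u (r - `|x - b|).
have t0 : 0 < t by rewrite lt_min u0 subr_gt0.
apply: mulmx_le_entries; first lra.
apply: (small_mulmx_le t0) => v; rewrite lt_min => /andP[vu vr].
have h1 := uP (v + x); have h2 := rP (v + x) x.
rewrite addrK in h1 h2; have := h1 vu.
have := h2 _ xr; rewrite (_ : `|v + x - b| < r); last first.
  by rewrite -addrA; have := ler_normD v (x - b); lra.
move=> /(_ isT) {}h2 {}h1.
have -> : v *m (B - A) =
    (f (v + x) - f x - v *m A) - (f (v + x) - f x - v *m B).
  rewrite mulmxBr; move: (f _ - f _) => w.
  by rewrite opprB [RHS]addrC addrA subrK.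
by rewrite (le_trans (ler_normB _ _)) //; lra.
Qed.

Lemma C1_nearP (R : realType) (p q : nat) (f : 'rV[R]_p -> 'rV[R]_q) a :
  C1_near f a <-> \forall x \near a, strict_diff f x.
Proof.
split=> [|/strict_diff_C1_near//] fa.
have /nearP[r r0 rP] := fa; apply/nearP; exists r => // x xr.
exists ('J f x); apply: C1_near_strict_deriv; apply/nearP.
exists (r - `|x - a|) => [|y yx]; first by rewrite subr_gt0.
by apply: rP; have := ler_distD x y a; lra.
Qed.

(** * Inverses, and perturbations of the identity *)

(** The lower Lipschitz bound gives local injectivity, and the continuity of
    inverses. *)
Lemma strict_deriv_expand (R : realType) (d : nat) (f : 'rV[R]_d -> 'rV[R]_d)
    a A : strict_deriv f a A -> A \in unitmx ->
  exists c r : R, [/\ 0 < c, 0 < r & forall x y, `|x - a| < r ->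
    `|y - a| < r -> `|x - y| <= c * `|f x - f y|].
Proof.
move=> fA uA; have [k k0 kA] := mulmx_bounded (invmx A).
have [r r0 rP] := fA ((2 * k)^-1) ltac:(by rewrite invr_gt0 mulr_gt0).
exists (2 * k), r; split=> [|//|x y xr yr]; first by rewrite mulr_gt0.
have := kA ((x - y) *m A); rewrite mulmxK // => h1.
have h2 := rP _ _ xr yr.
have h3 : `|(x - y) *m A| <= `|f x - f y| + (2 * k)^-1 * `|x - y|.
  have -> : (x - y) *m A = (f x - f y) - (f x - f y - (x - y) *m A).
    by rewrite subKr.
  by apply: le_trans (ler_normB _ _) _; rewrite lerD2l.
have h4 : k * ((2 * k)^-1 * `|x - y|) = `|x - y| / 2.
  by field; rewrite ?gt_eqF.
have h5 : k * `|(x - y) *m A| <= k * (`|f x - f y| + (2 * k)^-1 * `|x - y|).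
  by rewrite ler_pM2l.
rewrite mulrDr h4 in h5; lra.
Qed.

(** The strict estimate for the inverse is the strict estimate for the map,
    read backwards. *)
Lemma strict_deriv_inverse (R : realType) (d : nat)
    (f g : 'rV[R]_d -> 'rV[R]_d) a A :
  strict_deriv f a A -> A \in unitmx -> g (f a) = a ->
  {for f a, continuous g} -> (\forall y \near f a, f (g y) = y) ->
  strict_deriv g (f a) (invmx A).
Proof.
move=> fA uA ga /continuous_atP gc /nearP[s s0 sP] e e0.
have [c [r1 [c0 r10 fc]]] := strict_deriv_expand fA uA.
have [k k0 kA] := mulmx_bounded (invmx A).
have [r2 r20 r2P] := fA (e / (k * c)) ltac:(by rewrite divr_gt0 ?mulr_gt0).
have [t t0 tP] := gc (Num.min r1 r2) ltac:(by rewrite lt_min r10 r20).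
exists (Num.min s t) => [|x y]; first by rewrite lt_min s0 t0.
rewrite !lt_min => /andP[xs /tP xt] /andP[ys /tP yt].
move: xt yt; rewrite ga !lt_min => /andP[x1 x2] /andP[y1 y2].
have h1 := r2P _ _ x2 y2; have h2 := fc _ _ x1 y1.
rewrite !sP // in h1 h2.
have -> : g x - g y - (x - y) *m invmx A =
    - ((x - y - (g x - g y) *m A) *m invmx A).
  move: (x - y) (g x - g y) => v w.
  by rewrite mulmxBl mulmxK // opprB.
rewrite normrN; apply: le_trans (kA _) _.
apply: le_trans (ler_wpM2l (ltW k0) h1) _.
apply: le_trans (_ : k * (e / (k * c) * (c * `|x - y|)) <= _).
  by rewrite !ler_wpM2l // ltW // divr_gt0 ?mulr_gt0.
by rewrite le_eqVlt; apply/orP; left; apply/eqP; field; rewrite !gt_eqF.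
Qed.

(** Joins the complete and the normed structures of row vectors, as the fixed
    point theorem of Banach requires. *)
HB.instance Definition _ (R : realType) (d : nat) := Complete.on 'rV[R]_d.

Definition half_lipschitz (R : realType) (d : nat) (u : 'rV[R]_d -> 'rV[R]_d) :=
  forall x y, `|u x - u y| <= 2^-1 * `|x - y|.

(** A solution is a fixed point of the contraction x |-> y - u x. *)
Lemma half_lipschitz_solve (R : realType) (d : nat) (u : 'rV[R]_d -> 'rV[R]_d)
  y : half_lipschitz u -> exists x, x + u x = y.
Proof.
move=> ul.
pose F : {fun [set: 'rV[R]_d] >-> [set: 'rV[R]_d]} :=
  totalfun (fun x => y - u x).
have [||x _ xE] := @banach_fixed_point R 'rV[R]_d setT F _ closedT.
- exists (2^-1)%:nng; split=> /=; first by rewrite invf_lt1 // ltr1n.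
  move=> [a b] _ /=; rewrite opprB addrC addrA subrK distrC.
  exact: ul.
- by exists 0.
by exists x; rewrite {1}xE /= subrK.
Qed.

(** C^1-diffeomorphisms of R^d with compact support in V. *)
Definition cdiffeo (R : realType) (d : nat) (V : set 'rV[R]_d)
    (T : 'rV[R]_d -> 'rV[R]_d) : Prop :=
  exists T', [/\ cancel T T', cancel T' T,
    forall x, strict_diff T x, forall x, strict_diff T' x &
    exists K, [/\ compact K, K `<=` V & forall x, ~ K x -> T x = x]].

(** A kernel vector of the derivative would be a direction along which f moves
    infinitely less than its argument. *)
Lemma expand_unitmx (R : realType) (d : nat) (f : 'rV[R]_d -> 'rV[R]_d)
    a A c r : strict_deriv f a A -> 0 < c -> 0 < r ->
  (forall x, `|x - a| < r -> `|x - a| <= c * `|f x - f a|) -> A \in unitmx.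
Proof.
move=> fA c0 r0 fc; rewrite -row_free_unit -kermx_eq0.
apply/rowV0P => v /sub_kermxP vA; apply/eqP; rewrite -normr_eq0.
have [s s0 sP] := strict_deriv_ray fA (ltac:(by rewrite invr_gt0 mulr_gt0) :
  0 < (2 * c)^-1).
apply: contraT => v0; rewrite normr_eq0 in v0.
have nv : 0 < `|v| by rewrite normr_gt0.
pose t := Num.min r s / 2 / `|v|.
have m0 : 0 < Num.min r s by rewrite lt_min r0 s0.
have tv : `|t *: v| < Num.min r s.
  by rewrite normrZ gtr0_norm ?divr_gt0 // divfK ?gt_eqF //; lra.
have tv0 : 0 < `|t *: v|.
  by rewrite normrZ mulr_gt0 // normr_gt0 gt_eqF // !divr_gt0.
move: tv; rewrite lt_min => /andP[tr ts].
have := fc (t *: v + a); have := sP (t *: v + a).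
rewrite addrK -scalemxAl vA scaler0 subr0 => /(_ ts) h1 /(_ tr).
move: h1; rewrite -(ler_pM2l c0) mulrA.
have -> : c * (2 * c)^-1 = 2^-1 by field; rewrite gt_eqF.
lra.
Qed.

(** The source of all diffeomorphisms below: the identity plus a contraction
    is bijective by the fixed point theorem, and its inverse is Lipschitz,
    which makes its derivative invertible. *)
Lemma cdiffeo_perturbation (R : realType) (d : nat) (V K : set 'rV[R]_d)
    (u : 'rV[R]_d -> 'rV[R]_d) :
  (forall x, strict_diff u x) -> half_lipschitz u -> compact K -> K `<=` V ->
  (forall x, ~ K x -> u x = 0) -> cdiffeo V (fun x => x + u x).
Proof.
move=> ud ul cK KV u0; pose T x := x + u x.
have [T' T'K] := choice (fun y => half_lipschitz_solve y ul).
have expand x y : `|x - y| <= 2 * `|T x - T y|.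
  have -> : x - y = (T x - T y) - (u x - u y).
    by rewrite /T opprD addrACA addrK.
  have h1 := ler_normB (T x - T y) (u x - u y); have h2 := ul x y.
  have h3 : `|x - y| <= `|T x - T y| + `|u x - u y|.
    by move: h1; rewrite {1}/T opprD addrACA addrK.
  by move: h3; rewrite {2}/T opprD addrACA addrK; lra.
have Tinj x y : T x = T y -> x = y.
  move=> e; apply/subr0_eq/eqP; rewrite -normr_le0.
  by have := expand x y; rewrite e subrr normr0 mulr0.
have TK : cancel T T' by move=> x; apply: Tinj; exact: T'K.
have Td x : strict_diff T x.
  have [A uA] := ud x; exists (1%:M + A).
  exact: strict_derivD (strict_deriv_id _) uA.
have T'c y : {for y, continuous T'}.
  apply/continuous_atP => e e0; exists (e / 2) => [|z]; first by rewrite divr_gt0.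
  by move=> zy; have := expand (T' z) (T' y); rewrite /T !T'K; lra.
exists T'; split=> //.
- move=> y; rewrite -(T'K y); have [A TA] := Td (T' y).
  exists (invmx A); apply: (strict_deriv_inverse TA) => //.
  + apply: (expand_unitmx TA (_ : 0 < 2) ltr01) => //.
  + by apply/nearP; exists 1 => // z _; exact: T'K.
- by exists K; split=> // x /u0 ->; rewrite addr0.
Qed.

(** By compactness, the local Lipschitz constants are uniform for points at
    distance less than some e; for points further apart the bound on the
    values of f is enough. *)
Lemma compact_support_lipschitz (R : realType) (p q : nat)
    (f : 'rV[R]_p -> 'rV[R]_q) K :
  (forall x, strict_diff f x) -> compact K -> (forall x, ~ K x -> f x = 0) ->
  exists2 c, 0 < c & forall x y, `|f x - f y| <= c * `|x - y|.
Proof.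
move=> fd cK f0.
pose P (e : R) x := `|f x| <= e^-1 /\
  forall y, `|x - y| < e -> `|f x - f y| <= e^-1 * `|x - y|.
have He : \forall e \near 0^'+, K `<=` P e.
  move/compact_near_coveringP: cK; apply => x _.
  have [A fA] := fd x.
  have [c [r [c0 r0 fc]]] := strict_deriv_lipschitz fA.
  exists (ball x (r / 2), [set e : R | 0 < e /\ e < Num.min (r / 2)
     (c + c * r + `|f x|)^-1]) => /=.
    split; first by apply: nbhsx_ballx; rewrite divr_gt0.
    have m0 : 0 < Num.min (r / 2) (c + c * r + `|f x|)^-1.
      rewrite lt_min divr_gt0 //= invr_gt0 -addrA.
      by rewrite ltr_wpDr // addr_ge0 // mulr_ge0 // ltW.
    near=> e; split; near: e; [exact: nbhs_right_gt|exact: nbhs_right_lt].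
  move=> [y e] /= [yx [e0]]; rewrite lt_min => /andP[er ec].
  have cr0 : 0 < c * r by rewrite mulr_gt0.
  have {}ec : c + c * r + `|f x| < e^-1.
    rewrite -[ltLHS]invrK ltf_pV2 // posrE invr_gt0.
    by rewrite -addrA ltr_wpDr // addr_ge0 // ltW.
  have {}yx : `|y - x| < r / 2 by move: yx; rewrite -ball_normE /= distrC.
  have yr : `|y - x| < r by lra.
  have xx : `|x - x| < r by rewrite subrr normr0.
  split.
    have := fc _ _ yr xx; have := ler_distD 0 (f y) (f x).
    have : c * `|y - x| <= c * r by rewrite ler_pM2l // ltW.
    have := ler_normD (f y - f x) (f x); rewrite subrK; lra.
  move=> z yz; have zr : `|z - x| < r.
    by have := ler_distD y z x; rewrite (distrC z y); lra.
  apply: le_trans (fc _ _ yr zr) _; rewrite ler_wpM2r //.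
  by have := normr_ge0 (f x); lra.
have [e [KP e0]] := @filter_ex _ _ (at_right_proper_filter (0 : R)) _
  (filterI He (nbhs_right_gt 0)).
rewrite /= in e0.
have ei0 : 0 < e^-1 by rewrite invr_gt0.
have eie0 : 0 < 2 * e^-1 * e^-1 by rewrite !mulr_gt0.
exists (e^-1 + 2 * e^-1 * e^-1) => [|x y]; first by rewrite addr_gt0.
have fe z : `|f z| <= e^-1.
  have [/KP[]//|nKz] := pselect (K z).
  by rewrite f0 // normr0 ltW.
have main a b : K a -> `|f a - f b| <= (e^-1 + 2 * e^-1 * e^-1) * `|a - b|.
  move=> /KP[_ loc]; have h0 : 0 <= 2 * e^-1 * e^-1 * `|a - b|.
    by rewrite mulr_ge0 // ltW.
  have h1 : 0 <= e^-1 * `|a - b| by rewrite mulr_ge0 // ltW.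
  rewrite mulrDl; have [/loc|ab] := ltP `|a - b| e; first by lra.
  have h2 : 1 <= e^-1 * `|a - b| by rewrite mulrC ler_pdivlMr // mul1r.
  have h3 : 2 * e^-1 * 1 <= 2 * e^-1 * (e^-1 * `|a - b|).
    by rewrite ler_pM2l // mulr_gt0.
  rewrite mulr1 mulrA in h3.
  by have := ler_normB (f a) (f b); have := fe a; have := fe b; lra.
have [/main//|nKx] := pselect (K x).
have [Ky|nKy] := pselect (K y); first by rewrite distrC (distrC x); exact: main.
by rewrite !f0 // subrr normr0 mulr_ge0 // addr_ge0 // ltW.
Unshelve. all: by end_near. Qed.

(** * Bump functions *)

Definition sqnorm (R : realType) (d : nat) (x : 'rV[R]_d) : R :=
  \sum_i x 0 i ^+ 2.

Lemma norm_rV1 (R : realType) (x : 'rV[R]_1) : `|x| = `|x 0 0|.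
Proof.
apply: le_anti; rewrite rV_entry_le andbT rV_norm_le // => i.
by rewrite ord1.
Qed.

(** The square of the positive part: of class C^1, and flat at 0. *)
Definition sqpos (R : realType) (t : R) : R := (Num.max 0 t) ^+ 2.

Lemma strict_deriv_scalar (R : realType) (d : nat) (g : 'rV[R]_d -> R) a A :
  (forall e, 0 < e -> exists2 r : R, 0 < r & forall x y,
    `|x - a| < r -> `|y - a| < r ->
    `|g x - g y - ((x - y) *m A) 0 0| <= e * `|x - y|) ->
  strict_deriv (fun x => (g x)%:M : 'rV_1) a A.
Proof.
move=> gA e e0; have [r r0 rP] := gA e e0; exists r => // x y xr yr.
apply: rV_norm_le => [|i]; first by rewrite mulr_ge0 // ltW.
have := rP _ _ xr yr; rewrite ord1 => /(le_trans _); apply.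
by move: (_ *m A) => B; rewrite !mxE.
Qed.

Lemma sqpos_estimate (R : realType) (p e : R) : 0 < e ->
  exists2 r : R, 0 < r & forall s t, `|s - p| < r -> `|t - p| < r ->
    `|sqpos s - sqpos t - (s - t) * (2 * Num.max 0 p)| <= e * `|s - t|.
Proof.
move=> e0; have [p0|p0] := ltP 0 p.
  exists (Num.min p (e / 2)) => [|s t]; first by rewrite lt_min p0 divr_gt0.
  rewrite !lt_min => /andP[/ltr_normlP[s1 s2] /ltr_normlP[s3 s4]].
  move=> /andP[/ltr_normlP[t1 t2] /ltr_normlP[t3 t4]].
  rewrite /sqpos !max_r; [|lra..].
  have -> : s ^+ 2 - t ^+ 2 - (s - t) * (2 * p) = (s + t - 2 * p) * (s - t).
    by ring.
  by rewrite normrM ler_wpM2r // ler_norml; lra.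
exists (e / 2) => [|s t /ltr_normlP[s1 s2] /ltr_normlP[t1 t2]].
  by rewrite divr_gt0.
rewrite !mulr0 subr0 /sqpos subr_sqr mulrC normrM ler_pM //.
  rewrite ler_norml; have [?|?] := leP 0 s; have [?|?] := leP 0 t; lra.
have [?|?] := leP 0 s; have [?|?] := leP 0 t => //.
- by rewrite subr0 !ger0_norm //; lra.
- by rewrite sub0r normrN (ler0_norm (_ : s - t <= 0)) ?ger0_norm //; lra.
- by rewrite subrr normr0.
Qed.

Lemma strict_diff_sqpos (R : realType) (a : 'rV[R]_1) :
  strict_diff (fun x : 'rV_1 => (sqpos (x 0 0))%:M) a.
Proof.
exists (2 * Num.max 0 (a 0 0))%:M; apply: strict_deriv_scalar => e e0.
have [r r0 rP] := sqpos_estimate (a 0 0) e0.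
exists r => // x y xr yr.
have [x1 y1] : `|x 0 0 - a 0 0| < r /\ `|y 0 0 - a 0 0| < r.
  rewrite -!entryB; split; [apply: le_lt_trans xr|apply: le_lt_trans yr];
  exact: rV_entry_le.
have := rP _ _ x1 y1; rewrite mul_mx_scalar entryZ entryB mulrC.
move=> /le_trans; apply; rewrite -entryB ler_pM2l //.
exact: rV_entry_le.
Qed.

Lemma sqpos_le0 (R : realType) (t : R) : t <= 0 -> sqpos t = 0.
Proof. by move=> t0; rewrite /sqpos max_l // expr0n. Qed.

Lemma sqpos_ge0 (R : realType) (t : R) : 0 <= sqpos t.
Proof. exact: sqr_ge0. Qed.

Lemma sqpos_ge (R : realType) (t : R) : 0 <= t -> sqpos t = t ^+ 2.
Proof. by move=> t0; rewrite /sqpos max_r. Qed.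

Lemma strict_deriv_sqnorm (R : realType) (d : nat) (a : 'rV[R]_d) :
  strict_deriv (fun x : 'rV_d => (sqnorm x)%:M : 'rV_1) a (2 *: a^T).
Proof.
have E (x y : 'rV[R]_d) : sqnorm x - sqnorm y - ((x - y) *m (2 *: a^T)) 0 0 =
    ((x - y) *m ((x - a) + (y - a))^T) 0 0.
  rewrite !mxE /sqnorm -!sumrB.
  by apply: eq_bigr => j _; rewrite !mxE; ring.
apply: strict_deriv_scalar => e e0; pose c : R := 2 * (1 + d%:R).
have c0 : 0 < c by rewrite mulr_gt0 // ltr_wpDr.
exists (e / c) => [|x y xa ya]; first by rewrite divr_gt0.
rewrite E; apply: le_trans (rV_entry_le _ _) _.
apply: le_trans (mulmx_norm_le _ _) _; rewrite ler_wpM2r //.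
apply: (@le_trans _ _ (d%:R * (2 * (e / c)))).
  rewrite ler_wpM2l //; apply: mx_norm_le => [|i j].
    by rewrite mulr_ge0 // ltW // divr_gt0.
  rewrite mxE; apply: le_trans (mx_entry_le _ _ _) _.
  by have := ler_normD (x - a) (y - a); lra.
rewrite mulrCA mulrA mulrA ler_pdivrMr // [e * _]mulrC ler_wpM2r ?ltW //.
by rewrite /c; lra.
Qed.

(** The composite t |-> sqpos (1 - sqpos t) is 1 for t <= 0 and 0 for t >= 1;
    it is applied to an affine function of the square of the Euclidean norm. *)
Lemma sqnorm_cutoff (R : realType) (d : nat) (a b : R) : a < b ->
  exists chi : 'rV[R]_d -> R,
    [/\ forall x, strict_diff (fun x => (chi x)%:M : 'rV_1) x,
        forall x, 0 <= chi x <= 1,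
        forall x, sqnorm x <= a -> chi x = 1 &
        forall x, b <= sqnorm x -> chi x = 0].
Proof.
move=> ab; have ba : 0 < b - a by lra.
exists (fun x => sqpos (1 - sqpos ((sqnorm x - a) / (b - a)))); split=> [x|x|x xa|x xb].
- pose f1 (x : 'rV[R]_d) : 'rV[R]_1 := (sqnorm x)%:M *m ((b - a)^-1)%:M +
    cst ((- a / (b - a))%:M) x.
  have d1 z : strict_diff f1 z.
    eexists; apply: strict_derivD; last exact: strict_deriv_cst.
    exact: strict_deriv_comp (strict_deriv_sqnorm z) (strict_deriv_mulmx _ _).
  have d2 z : strict_diff (fun y => (sqpos (f1 y 0 0))%:M : 'rV_1) z.
    have [A fA] := d1 z; have [B sB] := strict_diff_sqpos (f1 z).
    by exists (A *m B); exact: strict_deriv_comp fA sB.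
  pose f3 (x : 'rV[R]_d) : 'rV[R]_1 := (sqpos (f1 x 0 0))%:M *m (- 1)%:M +
    cst (1%:M) x.
  have d3 z : strict_diff f3 z.
    have [A fA] := d2 z.
    eexists; apply: strict_derivD; last exact: strict_deriv_cst.
    exact: strict_deriv_comp fA (strict_deriv_mulmx _ _).
  have [A fA] := d3 x; have [B sB] := strict_diff_sqpos (f3 x).
  exists (A *m B); have := strict_deriv_comp fA sB.
  apply: near_strict_deriv; apply/nearP; exists 1 => // y _ /=.
  congr (sqpos _)%:M; rewrite /f3 /f1 /cst -!scalar_mxM -!raddfD /= !mxE /= !mulr1n.
  rewrite mulrN1 addrC; congr (_ - sqpos _); by rewrite mulrBl mulNr.
- rewrite sqr_ge0 /=; set t := sqpos (_ / _).
  have t0 : 0 <= t by exact: sqpos_ge0.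
  have [t1|t1] := leP t 1; last by rewrite sqpos_le0 //; lra.
  by rewrite sqpos_ge ?exprn_ile1 //; lra.
- rewrite (@sqpos_le0 _ (_ / _)) ?pmulr_lle0 ?invr_gt0 //; last by lra.
  by rewrite subr0 sqpos_ge // expr1n.
- rewrite sqpos_le0 // subr_le0 sqpos_ge; last by rewrite divr_ge0; lra.
  by rewrite exprn_ege1 // ler_pdivlMr // mul1r; lra.
Qed.

Lemma sqnorm_ge (R : realType) (d : nat) (x : 'rV[R]_d) : `|x| ^+ 2 <= sqnorm x.
Proof.
have s0 : 0 <= sqnorm x by apply: sumr_ge0 => i _; exact: sqr_ge0.
have : `|x| <= Num.sqrt (sqnorm x).
  apply: rV_norm_le => [|i]; first exact: sqrtr_ge0.
  rewrite -sqrtr_sqr ler_sqrt // /sqnorm (bigD1 i) //= lerDl.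
  by apply: sumr_ge0 => j _; exact: sqr_ge0.
move=> h; rewrite -(sqr_sqrtr s0) !expr2 ler_pM //.
Qed.

Lemma sqnorm_le (R : realType) (d : nat) (x : 'rV[R]_d) :
  sqnorm x <= d%:R * `|x| ^+ 2.
Proof.
rewrite /sqnorm; apply: (@le_trans _ _ (\sum_(i < d) `|x| ^+ 2)).
  apply: ler_sum => i _; rewrite -real_normK ?num_real // !expr2.
  by rewrite ler_pM // rV_entry_le.
by rewrite sumr_const card_ord mulr_natl.
Qed.

Lemma closed_cube_compact (R : realType) (d : nat) (p : 'rV[R]_d) r :
  compact [set x | `|x - p| <= r].
Proof.
rewrite (_ : [set x | _] = closed_ball_ Num.norm p r); last first.
  by apply/seteqP; split=> x; rewrite /closed_ball_ /= distrC.
apply: bounded_closed_compact; last exact: closed_closed_ball_.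
exists (`|p| + r); split=> [|s ps x]; first exact: num_real.
rewrite /closed_ball_ /= => px.
by have := ler_normB p (p - x); rewrite subKr; lra.
Qed.

(** The basic move: a small field w near p can be added to the identity on a
    neighbourhood of p, by a diffeomorphism supported in a given cube.  The
    constants do not depend on the size rho of the cube, and only the ratio of
    the size of w to rho matters; so the move serves both for translations
    and, at a tiny scale, for germs with derivative close to the identity. *)
Lemma bump_perturbation (R : realType) (d : nat) :
  exists L kappa : R, [/\ 0 < L, 0 < kappa &
  forall (p : 'rV[R]_d) (rho s lambda : R) (w : 'rV[R]_d -> 'rV[R]_d),
    0 < rho -> 0 <= s -> 0 <= lambda ->
    (forall x, `|x - p| < rho -> strict_diff w x) ->
    (forall x, `|x - p| < rho -> `|w x| <= s) ->
    (forall x y, `|x - p| < rho -> `|y - p| < rho ->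
      `|w x - w y| <= lambda * `|x - y|) ->
    lambda + L * (s / rho) <= 2^-1 ->
    exists2 T, cdiffeo [set x | `|x - p| < rho] T &
      forall x, `|x - p| < kappa * rho -> T x = x + w x].
Proof.
have [chi [chid chi01 chi1 chi0]] := @sqnorm_cutoff R d 2^-1 1 ltac:(lra).
pose K := [set x : 'rV[R]_d | `|x - 0| <= 1].
have chiK x : ~ K x -> chi x = 0.
  rewrite /K /= subr0 => /negP; rewrite -ltNge => x1; apply: chi0.
  apply: le_trans (sqnorm_ge x); by rewrite exprn_ege1 // ltW.
have [L0 L00 chiL] : exists2 c, 0 < c &
    forall x y, `|chi x - chi y| <= c * `|x - y|.
  have chiK' x : ~ K x -> (chi x)%:M = 0 :> 'rV_1.
    by move=> /chiK ->; rewrite raddf0.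
  have [c c0 cP] := compact_support_lipschitz chid
    (@closed_cube_compact R d 0 1) chiK'.
  exists c => // x y; apply: le_trans (cP x y).
  by rewrite norm_rV1 !mxE.
pose dd : R := 1 + d%:R; have dd0 : 0 < dd by rewrite ltr_wpDr.
exists (2 * L0), (4 * dd)^-1; split; rewrite ?invr_gt0 ?mulr_gt0 //.
move=> p rho s lambda w rho0 s0 l0 wd ws wl small.
pose r := rho / 2; have r0 : 0 < r by rewrite divr_gt0.
pose z x := r^-1 *: (x - p).
pose f x := chi (z x); pose u x := f x *: w x.
pose K' := [set x : 'rV[R]_d | `|x - p| <= r].
have nz x : `|z x| = `|x - p| / r.
  by rewrite normrZ normfV gtr0_norm // mulrC.
have f0 x : ~ K' x -> f x = 0.
  move=> nK; apply: chiK; rewrite /K /= subr0 nz => h; apply: nK.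
  by rewrite /K' /= -[r]mul1r -ler_pdivrMr.
have f1 x : `|x - p| < (4 * dd)^-1 * rho -> f x = 1.
  move=> xp; apply: chi1; apply: le_trans (sqnorm_le _) _.
  have zd : `|z x| <= (2 * dd)^-1.
    rewrite nz ler_pdivrMr // (le_trans (ltW xp)) // le_eqVlt.
    by apply/orP; left; apply/eqP; rewrite /r; field; rewrite gt_eqF.
  have : `|z x| ^+ 2 <= (2 * dd)^-1 ^+ 2.
    by rewrite lerXn2r // nnegrE // invr_ge0 mulr_ge0 // ltW.
  move=> /(ler_wpM2l (ler0n R d)) /le_trans; apply.
  have d20 : 0 < (2 * dd) ^+ 2 by rewrite exprn_gt0 // mulr_gt0.
  rewrite exprVn ler_pdivrMr // /dd.
  have : 0 <= (d%:R : R) by []; move: (d%:R : R) => D; nra.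
have r_rho : r < rho by rewrite /r; lra.
have fl x y : `|f x - f y| <= L0 / r * `|x - y|.
  apply: le_trans (chiL _ _) _; rewrite -scalerBr normrZ normfV (gtr0_norm r0).
  by rewrite opprB addrA subrK mulrA.
have f01 x : `|f x| <= 1 by rewrite ger0_norm; case/andP: (chi01 (z x)).
have fd x : strict_diff (fun x => (f x)%:M : 'rV_1) x.
  have zd a : strict_deriv z a (r^-1%:M + 0).
    have := strict_derivD (strict_deriv_mulmx (r^-1%:M) a)
      (strict_deriv_cst (- (r^-1 *: p)) a).
    apply: near_strict_deriv; apply/nearP; exists 1 => // y _.
    by rewrite /z /cst mul_mx_scalar scalerBr.
  have [A fA] := chid (z x); exists ((r^-1%:M + 0) *m A).
  exact: strict_deriv_comp (zd x) fA.
have K'rho x : K' x -> `|x - p| < rho by rewrite /K' /= => h; lra.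
have u0 x : ~ K' x -> u x = 0 by move=> /f0 fx; rewrite /u fx scale0r.
have ud x : strict_diff u x.
  have [xr|xr] := ltP `|x - p| rho.
    have [A fA] := fd x; have [B wB] := wd x xr.
    eexists; apply: near_strict_deriv (strict_derivM fA wB).
    by apply/nearP; exists 1 => // y _; rewrite mul_scalar_mx.
  exists 0; apply: near_strict_deriv (strict_deriv_cst 0 x).
  apply/nearP; exists (rho - r) => [|y yx]; first by rewrite subr_gt0.
  rewrite u0 //; rewrite /K' /= => yr.
  by have := ler_distD y x p; rewrite (distrC x y); lra.
have far x y : K' x -> ~ K' y -> `|u x - u y| <= 2^-1 * `|x - y|.
  move=> Kx nKy; rewrite (u0 y) // subr0 normrZ.
  have -> : `|f x| = `|f x - f y| by rewrite (f0 y) // subr0.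
  have h1 := ws _ (K'rho _ Kx).
  have h2 : L0 / r * `|x - y| * s = 2 * L0 * (s / rho) * `|x - y|.
    by rewrite /r; field; rewrite gt_eqF.
  apply: le_trans (ler_pM _ _ (fl x y) h1) _ => //; rewrite h2 ler_wpM2r //.
  lra.
have ul : half_lipschitz u.
  move=> x y; have [Kx|nKx] := pselect (K' x); last first.
    have [Ky|nKy] := pselect (K' y); first by rewrite distrC (distrC x); exact: far.
    by rewrite !u0 // subrr normr0 mulr_ge0.
  have [Ky|] := pselect (K' y); last exact: far.
  have -> : u x - u y = f x *: (w x - w y) + (f x - f y) *: w y.
    by rewrite /u scalerBr scalerBl addrA subrK.
  apply: le_trans (ler_normD _ _) _; rewrite !normrZ.
  have h1 := ws _ (K'rho _ Ky).
  have h2 : L0 / r * `|x - y| * s = 2 * L0 * (s / rho) * `|x - y|.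
    by rewrite /r; field; rewrite gt_eqF.
  have h3 : `|f x - f y| * `|w y| <= L0 / r * `|x - y| * s.
    exact: ler_pM (fl x y) h1.
  have h4 : `|f x| * `|w x - w y| <= 1 * (lambda * `|x - y|).
    by apply: ler_pM (f01 x) (wl _ _ (K'rho _ Kx) (K'rho _ Ky)).
  have h5 : (lambda + 2 * L0 * (s / rho)) * `|x - y| <= 2^-1 * `|x - y|.
    by rewrite ler_wpM2r.
  by rewrite h2 in h3; lra.
exists (fun x => x + u x).
  apply: (cdiffeo_perturbation ud ul (@closed_cube_compact R d p r)) => //.
by move=> x /f1 fx; rewrite /u fx scale1r.
Qed.

(** * Small germs and the inverse function theorem *)

Lemma cdiffeo_sub (R : realType) (d : nat) (V W : set 'rV[R]_d) T :
  V `<=` W -> cdiffeo V T -> cdiffeo W T.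
Proof.
move=> VW [T' [TK T'K Td T'd [K [cK KV KT]]]]; exists T'; split=> //.
by exists K; split=> //; exact: subset_trans VW.
Qed.

Lemma cdiffeo_id (R : realType) (d : nat) (V : set 'rV[R]_d) : cdiffeo V id.
Proof.
have sid x : strict_diff id x by exists 1%:M; exact: strict_deriv_id.
by exists id; split=> //; exists set0; split=> //; exact: compact0.
Qed.

Lemma cdiffeo_comp (R : realType) (d : nat) (V : set 'rV[R]_d) S T :
  cdiffeo V S -> cdiffeo V T -> cdiffeo V (S \o T).
Proof.
have comp (f g : 'rV[R]_d -> 'rV[R]_d) : (forall x, strict_diff f x) ->
    (forall x, strict_diff g x) -> forall x, strict_diff (f \o g) x.
  move=> fd gd x; have [A gA] := gd x; have [B fB] := fd (g x).
  by exists (A *m B); exact: strict_deriv_comp.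
move=> [S' [SK S'K Sd S'd [K [cK KV KS]]]] [T' [TK T'K Td T'd [L [cL LV LT]]]].
exists (T' \o S'); split; [exact: can_comp|exact: can_comp|exact: comp..|].
exists (K `|` L); split; [exact: compactU|by rewrite subUset|].
move=> x /not_orP[nK nL]; by rewrite /= LT // KS.
Qed.

Lemma cdiffeo_inverse (R : realType) (d : nat) (V : set 'rV[R]_d) T :
  cdiffeo V T -> exists T', [/\ cancel T T', cancel T' T & cdiffeo V T'].
Proof.
move=> [T' [TK T'K Td T'd [K [cK KV KT]]]]; exists T'; split=> //.
exists T; split=> //; exists K; split=> // x nK.
by rewrite -{1}(KT x nK) TK.
Qed.

Lemma cdiffeo_out (R : realType) (d : nat) (V : set 'rV[R]_d) T x :
  cdiffeo V T -> ~ V x -> T x = x.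
Proof. by move=> [T' [_ _ _ _ [K [_ KV KT]]]] nV; apply: KT => /KV. Qed.

(** A point sent out of V would be sent to a fixed point. *)
Lemma cdiffeo_in (R : realType) (d : nat) (V : set 'rV[R]_d) T x :
  cdiffeo V T -> V x -> V (T x).
Proof.
move=> Td Vx; apply: contrapT => nV; apply: (nV).
have [T' [TK _ _]] := cdiffeo_inverse Td.
by rewrite (_ : T x = x) //; apply: (can_inj TK); exact: cdiffeo_out Td nV.
Qed.

Lemma cdiffeo_strict_diff (R : realType) (d : nat) (V : set 'rV[R]_d) T x :
  cdiffeo V T -> strict_diff T x.
Proof. by move=> [T' [_ _ Td _ _]]. Qed.

Lemma small_translation (R : realType) (d : nat) (p : 'rV[R]_d) (rho : R) :
  0 < rho -> exists2 eta : R, 0 < eta & forall v : 'rV_d, `|v| < eta ->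
  exists2 T, cdiffeo [set x | `|x - p| < rho] T &
    \forall x \near p, T x = x + v.
Proof.
have [L [kappa [L0 k0 move_]]] := bump_perturbation R d.
move=> rho0; exists (rho / (2 * L)) => [|v vs].
  by rewrite divr_gt0 // mulr_gt0.
have [||||||T Td TE] := move_ p rho `|v| 0 (cst v) rho0 => //.
- by move=> x _; exists 0; exact: strict_deriv_cst.
- by move=> x y _ _; rewrite subrr normr0 mul0r.
- rewrite add0r mulrA ler_pdivrMr // mulrC -ler_pdivlMr //.
  by apply: le_trans (ltW vs) _; rewrite invfM mulrA [_ * rho]mulrC.
exists T => //; apply/nearP; exists (kappa * rho) => //.
by rewrite mulr_gt0.
Qed.

(** If k fixes p with derivative close to the identity, then on a cube of size
    r around p the displacement k - id is small compared to r. *)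
Lemma small_germ (R : realType) (d : nat) : exists2 eta : R, 0 < eta &
  forall (p : 'rV[R]_d) (rho : R) (k : 'rV[R]_d -> 'rV[R]_d) (A : 'M[R]_d),
    0 < rho -> (\forall x \near p, strict_diff k x) -> k p = p ->
    strict_deriv k p A -> (forall v : 'rV_d, `|v *m (A - 1%:M)| <= eta * `|v|) ->
  exists2 T, cdiffeo [set x | `|x - p| < rho] T & \forall x \near p, T x = k x.
Proof.
have [L [kappa [L0 k0 move_]]] := bump_perturbation R d.
pose eta : R := (4 * (1 + L))^-1.
have eta0 : 0 < eta by rewrite invr_gt0 mulr_gt0 // addr_gt0.
exists eta => // p rho k A rho0 /nearP[r1 r10 kd] kp kA Asmall.
have [r2 r20 kest] := kA eta eta0.
pose w x := k x - x; pose r := Num.min rho (Num.min r1 r2).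
have r0 : 0 < r by rewrite !lt_min rho0 r10.
have rP x : `|x - p| < r -> [/\ `|x - p| < rho, `|x - p| < r1 & `|x - p| < r2].
  by rewrite !lt_min => /and3P[].
have wl x y : `|x - p| < r -> `|y - p| < r ->
    `|w x - w y| <= 2 * eta * `|x - y|.
  move=> /rP[_ _ xr] /rP[_ _ yr].
  have -> : w x - w y = (k x - k y - (x - y) *m A) + (x - y) *m (A - 1%:M).
    rewrite mulmxBr mulmx1 addrA subrK /w.
    by rewrite !opprB addrACA [RHS]addrACA [- x + _]addrC.
  apply: le_trans (ler_normD _ _) _.
  by have := kest _ _ xr yr; have := Asmall (x - y); lra.
have [||||||T Td TE] := move_ p r (2 * eta * r) (2 * eta) w r0.
- by rewrite ltW // !mulr_gt0.
- by rewrite ltW // mulr_gt0.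
- move=> x /rP[_ /kd[B kB] _]; exists (B + (- 1%:M)).
  have := strict_derivD kB (strict_deriv_mulmx (- 1%:M) x).
  apply: near_strict_deriv; apply/nearP; exists 1 => // y _.
  by rewrite /w mulmxN mulmx1.
- move=> x xr; have := wl x p xr; rewrite subrr normr0 => /(_ r0).
  rewrite /w kp subrr subr0 => /le_trans; apply.
  by rewrite ler_wpM2l ?ltW // mulr_gt0.
- exact: wl.
- rewrite mulfK ?gt_eqF // /eta.
  rewrite le_eqVlt; apply/orP; left; apply/eqP; field.
  by rewrite gt_eqF // addr_gt0.
exists T.
  by apply: cdiffeo_sub Td => x /rP[].
apply/nearP; exists (kappa * r) => [|x /TE ->]; first by rewrite mulr_gt0.
by rewrite /w addrC subrK.
Qed.

(** The surjectivity part of the inverse function theorem: f followed by the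
    inverse of its derivative has a germ close to the identity, hence agrees
    near p with a homeomorphism of the whole space. *)
Lemma local_surjectivity (R : realType) (d : nat) (f : 'rV[R]_d -> 'rV[R]_d)
    p A : (\forall x \near p, strict_diff f x) -> strict_deriv f p A ->
  A \in unitmx -> forall r : R, 0 < r -> exists2 s : R, 0 < s &
    forall y, `|y - f p| < s -> exists2 x, `|x - p| < r & f x = y.
Proof.
move=> /nearP[r1 r10 fd] fA uA r r0.
pose k x := p + (f x - f p) *m invmx A.
have kder x B : strict_deriv f x B -> strict_deriv k x (B *m invmx A).
  move=> fB; have := strict_derivD
    (strict_deriv_comp fB (strict_deriv_mulmx (invmx A) _))
    (strict_deriv_cst (p - f p *m invmx A) x).
  rewrite addr0; apply: near_strict_deriv; apply/nearP; exists 1 => // y _.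
  by rewrite /k /cst /= mulmxBl addrCA.
have [eta eta0 germ] := small_germ R d.
have [||||T Td TE] := germ p 1 k 1%:M ltr01.
- by apply/nearP; exists r1 => // x /fd[B /kder kB]; eexists; exact: kB.
- by rewrite /k subrr mul0mx addr0.
- by have := kder _ _ fA; rewrite mulmxV.
- by move=> v; rewrite subrr mulmx0 normr0 mulr_ge0 // ltW.
have /nearP[t t0 {}TE] := TE.
have [T' [TK T'K T'd]] := cdiffeo_inverse Td.
have Tp : T p = p by rewrite TE ?subrr ?normr0 // /k subrr mul0mx addr0.
have [B /strict_deriv_continuous/continuous_atP T'c] :=
  cdiffeo_strict_diff p T'd.
have m0 : 0 < Num.min r t by rewrite lt_min r0.
have [s s0 sP] := T'c _ m0; have [c c0 cP] := mulmx_bounded (invmx A).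
exists (s / c) => [|y ys]; first by rewrite divr_gt0.
pose q := p + (y - f p) *m invmx A.
have /sP : `|q - p| < s.
  rewrite /q addrAC subrr add0r; apply: le_lt_trans (cP _) _.
  by rewrite mulrC -ltr_pdivlMr.
have T'p : T' p = p by rewrite -{1}Tp TK.
rewrite T'p lt_min => /andP[xr xt]; exists (T' q) => //.
have := TE _ xt; rewrite T'K /q /k => /addrI /(congr1 (mulmx^~ A)).
rewrite /= !mulmxKV // => /addIr.
by [].
Qed.

Lemma near_open (R : realType) (d : nat) (V : set 'rV[R]_d) p (P : 'rV[R]_d -> Prop) :
  open V -> V p -> (forall x, V x -> P x) -> \forall x \near p, P x.
Proof. by move=> oV Vp VP; apply: filterS VP _; exact: open_nbhs_nbhs. Qed.

(** By the inverse function theorem, this is a C^1-diffeomorphism from the open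
    set V onto an open set. *)
Definition C1_embedding (R : realType) (d : nat) (V : set 'rV[R]_d)
    (f : 'rV[R]_d -> 'rV[R]_d) : Prop :=
  (forall x y, V x -> V y -> f x = f y -> x = y) /\
  forall x, V x -> exists2 A, strict_deriv f x A & A \in unitmx.

Lemma embedding_open (R : realType) (d : nat) (V W : set 'rV[R]_d) f :
  open V -> C1_embedding V f -> open W -> W `<=` V -> open (f @` W).
Proof.
move=> oV [_ fd] oW WV; apply/open_nearP => _ [x Wx <-].
have [A fA uA] := fd x (WV x Wx).
have /nearP[r r0 rW] : \forall z \near x, W z by exact: open_nbhs_nbhs.
have fnear : \forall z \near x, strict_diff f z.
  by apply: (near_open oV (WV x Wx)) => z /fd[B fB _]; exists B.
have [s s0 sP] := local_surjectivity fnear fA uA r0.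
by exists s => // y /sP[z /rW Wz <-]; exists z.
Qed.

(** Continuity of the inverse is local surjectivity; the derivative follows
    from the strict estimate. *)
Lemma embedding_inverse (R : realType) (d : nat) (V : set 'rV[R]_d) f g x A :
  open V -> C1_embedding V f -> (forall y, V y -> g (f y) = y) -> V x ->
  strict_deriv f x A -> strict_deriv g (f x) (invmx A).
Proof.
move=> oV fe gf Vx fA.
have [B fB uB] := fe.2 x Vx; have AB := strict_deriv_unique fA fB.
have near_img (W : set 'rV[R]_d) : open W -> W x -> W `<=` V ->
    \forall y \near f x, (f @` W) y.
  move=> oW Wx WV; apply: open_nbhs_nbhs; split; last by exists x.
  exact: embedding_open fe oW WV.
apply: strict_deriv_inverse => //; first by rewrite AB.
- exact: gf.
- apply/continuous_atP => e e0.
  pose W := V `&` [set z | `|z - x| < e].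
  have oW : open W.
    apply: openI => //; apply/open_nearP => z /= ze.
    exists (e - `|z - x|) => [|y yz /=]; first by rewrite subr_gt0.
    by have := ler_distD z y x; lra.
  have /nearP[s s0 sP] : \forall y \near f x, (f @` W) y.
    by apply: near_img => // [|z []//]; split=> //=; rewrite subrr normr0.
  by exists s => // y /sP[z [Vz ze] <-]; rewrite !gf.
- by apply: filterS (near_img V oV Vx (@subset_refl _ _)) => _ [z Vz <-]; rewrite gf.
Qed.

(** * Connectedness of segments and of GL_d^+ *)

(** Connectedness of the segment, in the form used below to go from small
    moves to large ones. *)
Lemma segment_chain (R : realType) (e : R -> R -> Prop) :
  (forall s t, e s t -> e t s) -> (forall s t u, e s t -> e t u -> e s u) ->
  (forall t, 0 <= t <= 1 -> exists2 r, 0 < r &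
    forall s, 0 <= s <= 1 -> `|s - t| < r -> e t s) ->
  e 0 1.
Proof.
move=> sym trans loc.
have e00 : e 0 0.
  have [|r r0 rP] := loc 0; first by rewrite lexx ler01.
  by apply: rP; rewrite ?subrr ?normr0 // lexx ler01.
pose N (Q : R -> Prop) : set R := [set s | exists t r, [/\ 0 <= t <= 1, Q t,
  `|s - t| < r & forall s', 0 <= s' <= 1 -> `|s' - t| < r -> e t s']].
have oN Q : open (N Q).
  apply/(@open_nearP R R) => s [t [r [t01 Qt st rP]]].
  exists (r - `|s - t|) => [|y ys]; first by rewrite subr_gt0.
  by exists t, r; split=> //; have := ler_distD s y t; lra.
have self Q t : 0 <= t <= 1 -> Q t -> N Q t.
  move=> t01 Qt; have [r r0 rP] := loc t t01.
  by exists t, r; split; rewrite // subrr normr0.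
have seg t : `[0, 1]%classic t = (0 <= t <= 1) :> Prop by rewrite /= in_itv.
pose B := [set t : R | 0 <= t <= 1 /\ e 0 t].
have BE : B = `[0, 1]%classic.
  apply: segment_connected.
  - by exists 0; split=> //; rewrite lexx ler01.
  - exists (N (e 0)); first exact: oN.
    apply/seteqP; split=> t; rewrite /setI /= in_itv /=.
      by move=> [t01 et]; split=> //; exact: self.
    move=> [t01 [u [r [u01 eu tu rP]]]]; split=> //.
    by apply: trans eu _; exact: rP.
  - exists (~` N (fun t => ~ e 0 t)); first by apply: open_closedC; exact: oN.
    apply/seteqP; split=> t; rewrite /setI /= in_itv /=.
      move=> [t01 et]; split=> // -[u [r [u01 eu tu rP]]]; apply: eu.
      by apply: trans et _; apply: sym; exact: rP.
    move=> [t01 nN]; split=> //; apply: contrapT => net; apply: nN.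
    exact: self.
have : B 1 by rewrite BE /= in_itv /= lexx ler01.
by case.
Qed.

Definition segment_unit (R : realFieldType) (d : nat) (A : 'M[R]_d) : Prop :=
  forall t : R, 0 <= t <= 1 -> (1 - t)%:M + t *: A \in unitmx.

(** GL_d^+ is path connected, in an algebraic form: by Gaussian elimination,
    every matrix of positive determinant is a product of matrices that can be
    joined to the identity by a segment of invertible matrices. *)
Lemma pos_det_generated (R : realFieldType) (d : nat) (P : 'M[R]_d -> Prop) :
  (forall A B, P A -> P B -> P (A *m B)) ->
  (forall A, segment_unit A -> P A) ->
  forall A, 0 < \det A -> P A.
Proof.
elim: d P => [|d IH] P PM Pseg A dA.
  by apply: Pseg => t _; rewrite unitmxE det_mx00 unitr1.
rewrite -[d.+1]/(1 + d)%N in P PM Pseg A dA *.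
have scal_block s : (s%:M : 'M[R]_(1 + d)) = block_mx s%:M 0 0 s%:M.
  exact: scalar_mx_block.
have PL w : P (block_mx 1%:M 0 w 1%:M).
  apply: Pseg => t t01; rewrite scal_block scale_block_mx add_block_mx.
  rewrite scaler0 !addr0 add0r !scalemx1 -!raddfD /= subrK.
  by rewrite unitmxE det_lblock !det1 mulr1 unitr1.
have PU r : P (block_mx 1%:M r 0 1%:M).
  apply: Pseg => t t01; rewrite scal_block scale_block_mx add_block_mx.
  rewrite scaler0 !addr0 add0r !scalemx1 -!raddfD /= subrK.
  by rewrite unitmxE det_ublock !det1 mulr1 unitr1.
have PD (a : R) : 0 < a -> P (block_mx a%:M 0 0 1%:M).
  move=> a0; apply: Pseg => t t01; rewrite scal_block scale_block_mx.
  rewrite add_block_mx !scaler0 !addr0 !scale_scalar_mx mulr1 -!raddfD /= subrK.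
  rewrite unitmxE det_lblock det1 mulr1 det_scalar1 unitfE gt_eqF //.
  have [->|t0] := eqVneq t 0; first by rewrite mul0r; lra.
  have : 0 < t * a by rewrite mulr_gt0 // lt0r t0; case/andP: t01.
  by lra.
have PS S : 0 < \det S -> P (block_mx 1%:M 0 0 S).
  apply: (IH (fun S => P (block_mx 1%:M 0 0 S))) => [S1 S2 P1 P2|S1 seg].
    have := PM _ _ P1 P2; rewrite mulmx_block.
    by rewrite !(mulmx0, mul0mx, addr0, add0r, mulmx1).
  apply: Pseg => t t01; rewrite scal_block scale_block_mx add_block_mx.
  rewrite !scaler0 !addr0 !scalemx1 -!raddfD /= subrK.
  by rewrite unitmxE det_lblock det1 mul1r -unitmxE; exact: seg.
have step1 (A1 : 'M[R]_(1 + d)) : 0 < \det A1 -> 0 < ulsubmx A1 0 0 -> P A1.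
  move=> dA1; set a := ulsubmx A1 0 0 => a0.
  have an0 : a != 0 by rewrite gt_eqF.
  pose c := dlsubmx A1; pose r := ursubmx A1; pose B := drsubmx A1.
  pose S := B - a^-1 *: (c *m r).
  have A1E : A1 = block_mx 1%:M 0 (a^-1 *: c) 1%:M *m block_mx a%:M 0 0 1%:M *m
      block_mx 1%:M 0 0 S *m block_mx 1%:M (a^-1 *: r) 0 1%:M.
    rewrite !mulmx_block !(mulmx0, mul0mx, addr0, add0r, mulmx1, mul1mx).
    rewrite -[LHS]submxK; congr block_mx.
    - by rewrite [LHS]mx11_scalar.
    - by rewrite mul_scalar_mx scalerA mulfV // scale1r.
    - by rewrite mul_mx_scalar scalerA mulfV // scale1r.
    - rewrite mul_mx_scalar scalerA mulfV // scale1r -scalemxAr.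
      by rewrite /S addrC subrK.
  have dS : 0 < \det S.
    move: dA1; rewrite {1}A1E !det_mulmx !det_lblock det_ublock !det1 det_scalar1.
    by rewrite !mulr1 !mul1r pmulr_rgt0.
  by rewrite A1E; apply: (PM) => //; apply: (PM); [apply: PM => //; exact: PD|exact: PS].
have step2 (A1 : 'M[R]_(1 + d)) : 0 < \det A1 -> dlsubmx A1 != 0 -> P A1.
  move=> dA1 c0; set c := dlsubmx A1 in c0 *.
  have [i ci] : exists i, c i ord0 != 0.
    apply/existsP; apply: contraT => /existsPn c00; case/eqP: c0.
    by apply/matrixP => i j; rewrite ord1 [RHS]mxE; apply/eqP/negPn/(c00 i).
  pose x : R := (1 - ulsubmx A1 0 0) / c i 0.
  pose v : 'rV[R]_d := x *: delta_mx 0 i.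
  pose A2 := block_mx 1%:M v 0 1%:M *m A1.
  have A1E : A1 = block_mx 1%:M (- v) 0 1%:M *m A2.
    rewrite /A2 mulmxA mulmx_block !(mulmx0, mul0mx, addr0, add0r, mulmx1, mul1mx).
    by rewrite subrr -scalar_mx_block mul1mx.
  rewrite A1E; apply: PM => //; apply: step1.
    by rewrite /A2 det_mulmx det_ublock !det1 !mul1r.
  have -> : ulsubmx A2 0 0 = ulsubmx A1 0 0 + x * c i ord0.
    rewrite /A2 -{1}[A1]submxK mulmx_block block_mxKul mul1mx /v -scalemxAl.
    by rewrite -rowE -/c; move: (ulsubmx A1) (c) => u b; rewrite !mxE.
  by rewrite /x divfK // addrC subrK.
have [a0|a0] := ltP 0 (ulsubmx A 0 0); first exact: step1.
have [c0|c0] := eqVneq (dlsubmx A) 0; last exact: step2.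
have dE : \det A = ulsubmx A 0 0 * \det (drsubmx A).
  by rewrite -{1}[A]submxK c0 det_ublock det_mx11.
have {}a0 : ulsubmx A 0 0 < 0.
  rewrite lt_neqAle a0 andbT; apply/eqP => a00.
  by move: dA; rewrite dE a00 mul0r ltxx.
have [i _] : exists i : 'I_d, True.
  clear -dE dA a0; case: d => [|d] in A dE dA a0 *; last by exists ord0.
  by move: dA; rewrite dE det_mx00 mulr1 => /lt_trans/(_ a0); rewrite ltxx.
pose w : 'cV[R]_d := delta_mx i 0.
have AE : A = block_mx 1%:M 0 (- w) 1%:M *m (block_mx 1%:M 0 w 1%:M *m A).
  rewrite mulmxA mulmx_block !(mulmx0, mul0mx, addr0, add0r, mulmx1, mul1mx).
  by rewrite addNr -scalar_mx_block mul1mx.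
rewrite AE; apply: PM => //; apply: step2.
  by rewrite det_mulmx det_lblock !det1 !mul1r.
rewrite -[X in _ *m X]submxK mulmx_block block_mxKdl c0 mulmx0 addr0.
apply/eqP => /matrixP/(_ i 0); rewrite [ulsubmx A]mx11_scalar mul_mx_scalar.
move: a0; move: (ulsubmx A 0 0) => y y0; rewrite !mxE !eqxx mulr1 => y00.
by move: y0; rewrite y00 ltxx.
Qed.

(** * Oriented germs and simultaneous moves *)

Lemma strict_deriv_affine (R : realType) (d : nat) (p q x : 'rV[R]_d) A :
  strict_deriv (fun x => q + (x - p) *m A) x A.
Proof.
have := strict_derivD (strict_deriv_mulmx A x) (strict_deriv_cst (q - p *m A) x).
rewrite addr0; apply: near_strict_deriv; apply/nearP; exists 1 => // y _.
by rewrite /cst mulmxBl addrCA.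
Qed.

(** Every orientation preserving germ fixing p extends to a diffeomorphism
    supported near p.  The germs with derivative close to the identity do by
    small_germ; the linear ones by subdividing segments of invertible
    matrices, which generate by pos_det_generated; and the general ones by
    factoring out the derivative. *)
Lemma oriented_germ (R : realType) (d : nat) (p : 'rV[R]_d) (rho : R)
    (k : 'rV[R]_d -> 'rV[R]_d) (A : 'M[R]_d) :
  0 < rho -> (\forall x \near p, strict_diff k x) -> k p = p ->
  strict_deriv k p A -> 0 < \det A ->
  exists2 T, cdiffeo [set x | `|x - p| < rho] T & \forall x \near p, T x = k x.
Proof.
move=> rho0 kd kp kA dA.
have [eta eta0 germ] := small_germ R d.
pose P (B : 'M[R]_d) := exists2 T, cdiffeo [set x | `|x - p| < rho] T &
  \forall x \near p, T x = p + (x - p) *m B.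
have fixp B T : (\forall x \near p, T x = p + (x - p) *m B) -> T p = p.
  by move=> /nbhs_singleton ->; rewrite subrr mul0mx addr0.
have cont T : cdiffeo [set x | `|x - p| < rho] T -> {for p, continuous T}.
  by move=> /(cdiffeo_strict_diff p)[B /strict_deriv_continuous].
have PM B C : P B -> P C -> P (B *m C).
  move=> [S Sd SB] [T Td TC]; exists (T \o S); first exact: cdiffeo_comp.
  have := cont _ Sd _; rewrite /prop_for /continuous_at (fixp _ _ SB) => Sp.
  have {}TC := Sp _ TC.
  near=> x; rewrite /=.
  have -> : T (S x) = p + (S x - p) *m C by near: x.
  have -> : S x = p + (x - p) *m B by near: x.
  by rewrite [p + _ *m B]addrC addrK mulmxA.
have PV B : B \in unitmx -> P B -> P (invmx B).
  move=> uB [T Td TB]; have [T' [TK T'K T'd]] := cdiffeo_inverse Td.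
  exists T' => //; have T'p : T' p = p by rewrite -{1}(fixp _ _ TB) TK.
  have := cont _ T'd; rewrite /prop_for /continuous_at T'p => /(_ _ TB) T'B.
  near=> x; have : T (T' x) = p + (T' x - p) *m B by near: x.
  rewrite T'K => {2}->; rewrite [p + _ *m B]addrC addrK mulmxK //.
  by rewrite addrC subrK.
have Psmall B : (forall v : 'rV_d, `|v *m (B - 1%:M)| <= eta * `|v|) -> P B.
  move=> Bs; apply: (germ p rho (fun x => p + (x - p) *m B) B) => //.
  - by apply/nearP; exists 1 => // x _; exists B; exact: strict_deriv_affine.
  - by rewrite subrr mul0mx addr0.
  - exact: strict_deriv_affine.
have Pseg B : segment_unit B -> P B.
  move=> uB; pose M t : 'M[R]_d := (1 - t)%:M + t *: B.
  pose e s t := [/\ 0 <= s <= 1, 0 <= t <= 1 & P (invmx (M s) *m M t)].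
  have [_ _] : e 0 1.
    apply: segment_chain => [s t [s01 t01 st]|s t u [s01 t01 st] [_ u01 tu]|t t01].
    - split=> //; have := PV _ _ st; rewrite unitmx_mul unitmx_inv !uB //.
      rewrite (_ : invmx (invmx (M s) *m M t) = invmx (M t) *m M s); first exact.
      apply: (@row_free_inj _ _ _ _ (invmx (M s) *m M t)).
        by rewrite row_free_unit unitmx_mul unitmx_inv !uB.
      rewrite mulVmx ?unitmx_mul ?unitmx_inv ?uB //.
      by rewrite mulmxA mulmxK ?uB // mulVmx ?uB.
    - split=> //; have := PM _ _ st tu.
      by rewrite mulmxA mulmxK ?uB //.
    - have [c c0 cP] := mulmx_bounded (invmx (M t) *m (B - 1%:M)).
      exists (eta / c) => [|s s01 st]; first by rewrite divr_gt0.
      split=> //; apply: Psmall => v.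
      have -> : invmx (M t) *m M s - 1%:M =
          (s - t) *: (invmx (M t) *m (B - 1%:M)).
        rewrite -{1}(mulVmx (uB t t01)) -mulmxBr scalemxAr; congr (_ *m _).
        apply/matrixP => i j; rewrite /M !mxE.
        by case: (i == j); rewrite ?mulr1n ?mulr0n; ring.
      rewrite -scalemxAr normrZ.
      apply: le_trans (ler_wpM2l (normr_ge0 _) (cP v)) _.
      by rewrite mulrA ler_wpM2r // -ler_pdivlMr // ltW.
  rewrite /M subr0 scale0r addr0 invmx1 mul1mx subrr raddf0 add0r scale1r.
  exact.
have [S Sd SA] := pos_det_generated PM Pseg dA.
have uA : A \in unitmx by rewrite unitmxE unitfE gt_eqF.
have kder x B : strict_deriv k x B ->
    strict_deriv (fun x => p + (k x - p) *m invmx A) x (B *m invmx A).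
  by move=> kB; exact: (strict_deriv_comp kB (strict_deriv_affine p p _ _)).
have [||||T Td TE] := germ p rho (fun x => p + (k x - p) *m invmx A) 1%:M rho0.
- by apply: filterS kd => x [B /kder kB]; eexists; exact: kB.
- by rewrite kp subrr mul0mx addr0.
- by have := kder _ _ kA; rewrite mulmxV.
- by move=> v; rewrite subrr mulmx0 normr0 mulr_ge0 // ltW.
exists (S \o T); first exact: cdiffeo_comp.
have Tp : T p = p by rewrite (nbhs_singleton TE) kp subrr mul0mx addr0.
have := cont _ Td; rewrite /prop_for /continuous_at Tp => /(_ _ SA) STA.
near=> x; rewrite /=.
have -> : S (T x) = p + (T x - p) *m A by near: x.
have -> : T x = p + (k x - p) *m invmx A by near: x.
by rewrite [p + _ *m invmx A]addrC addrK mulmxKV // addrC subrK.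
Unshelve. all: end_near. Qed.

(** Each T_ i preserves Z i and is the identity on the other regions, so their
    composite acts on each Z i as T_ i alone. *)
Lemma cdiffeo_glue (R : realType) (d N : nat) (V : set 'rV[R]_d)
    (Z : 'I_N -> set 'rV[R]_d) (T_ : 'I_N -> 'rV[R]_d -> 'rV[R]_d) :
  (forall i, Z i `<=` V) -> (forall i j x, Z i x -> Z j x -> i = j) ->
  (forall i, cdiffeo (Z i) (T_ i)) ->
  exists2 T, cdiffeo V T & forall i x, Z i x -> T x = T_ i x.
Proof.
move=> ZV disj Td.
have [T [TV TE _]] : exists T, [/\ cdiffeo V T,
    forall i x, i \in enum 'I_N -> Z i x -> T x = T_ i x &
    forall x, (forall i, i \in enum 'I_N -> ~ Z i x) -> T x = x].
  elim: (enum _) (enum_uniq 'I_N) => [_|i s IH /= /andP[nis us]].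
    by exists id; split=> //; exact: cdiffeo_id.
  have [T [TV TE Tout]] := IH us; exists (T \o T_ i); split.
  - by apply: cdiffeo_comp => //; apply: cdiffeo_sub (Td i); exact: ZV.
  - move=> j x; rewrite inE => /orP[/eqP->|js] Zx /=.
      apply: Tout => k ks Zk; move: nis; rewrite (_ : i = k) ?ks //.
      by apply: (disj _ _ _ _ Zk); exact: cdiffeo_in (Td i) Zx.
    rewrite (cdiffeo_out (Td i)) ?(TE j) // => Zi.
    by move: nis; rewrite (disj _ _ _ Zi Zx) js.
  - move=> x out /=; rewrite (cdiffeo_out (Td i)); last first.
      by apply: out; rewrite inE eqxx.
    by apply: Tout => k ks; apply: out; rewrite inE ks orbT.
by exists T => // i x; apply: TE; rewrite mem_enum.
Qed.

Lemma uniform_radius (R : realType) (N : nat) (Q : 'I_N -> R -> Prop) :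
  (forall i r s, 0 < s -> s <= r -> Q i r -> Q i s) ->
  (forall i, exists2 r, 0 < r & Q i r) -> exists2 r, 0 < r & forall i, Q i r.
Proof.
move=> mono ex.
have [f fP] := choice (fun i => let: ex_intro2 r r0 Qr := ex i in
  ex_intro (fun r => 0 < r /\ Q i r) r (conj r0 Qr)).
exists (\big[Num.min/1]_i f i) => [|i].
  by apply/bigmin_gtP; split=> // i _; case: (fP i).
apply: mono (fP i).2; last exact: bigmin_le_cond.
by apply/bigmin_gtP; split=> // j _; case: (fP j).
Qed.

(** * Moving finitely many points *)

(** Germs are prescribed, not only images of points, so that the relation can
    be followed by corrections of the derivatives. *)
Definition translates (R : realType) (d N : nat) (T : 'rV[R]_d -> 'rV[R]_d)
    (p q : 'I_N -> 'rV[R]_d) : Prop :=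
  forall i, \forall x \near p i, T x = x + (q i - p i).

Lemma separated_cubes (R : realType) (d N : nat) (V : set 'rV[R]_d)
    (p : 'I_N -> 'rV[R]_d) : open V -> (forall i, V (p i)) -> injective p ->
  exists2 r : R, 0 < r & (forall i, [set x | `|x - p i| < r] `<=` V) /\
    forall i j x, `|x - p i| < r -> `|x - p j| < r -> i = j.
Proof.
move=> /open_nearP oV Vp pinj.
have [r r0 rV] := @uniform_radius R N
  (fun i r => [set x | `|x - p i| < r] `<=` V)
  (fun i r s _ sr rV x xs => rV x (lt_le_trans xs sr)) (fun i => oV _ (Vp i)).
have [s s0 sP] := @uniform_radius R N
  (fun i r => forall j, i != j -> r <= `|p i - p j|)
  (fun i r s _ sr rP j ij => le_trans sr (rP j ij)) ltac:(
  move=> i; apply: (@uniform_radius R N (fun j r => i != j -> r <= `|p i - p j|)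
    (fun j r s _ sr rP ij => le_trans sr (rP ij))) => j;
  have [->|ij] := eqVneq i j; [by exists 1; rewrite ?eqxx|
  exists `|p i - p j| => //; rewrite normr_gt0 subr_eq0;
    by apply: contra_neq ij => /pinj]).
exists (Num.min r (s / 2)); first by rewrite lt_min r0 divr_gt0.
split=> [i x /=|i j x]; first by rewrite lt_min => /andP[/rV].
rewrite !lt_min => /andP[_ xi] /andP[_ xj]; apply: contrapT => /eqP/sP.
by have := ler_distD x (p i) (p j); rewrite (distrC _ x); lra.
Qed.

Lemma translates_inverse (R : realType) (d N : nat) (V : set 'rV[R]_d) T
    (p q : 'I_N -> 'rV[R]_d) : cdiffeo V T -> translates T p q ->
  exists2 T', cdiffeo V T' & translates T' q p.
Proof.
move=> Td Tpq; have [T' [TK T'K T'd]] := cdiffeo_inverse Td.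
exists T' => // i.
have T'q : T' (q i) = p i.
  by rewrite -[RHS]TK (nbhs_singleton (Tpq i)) addrC subrK.
have [B /strict_deriv_continuous] := cdiffeo_strict_diff (q i) T'd.
rewrite /prop_for /continuous_at T'q => /(_ _ (Tpq i)) near_q.
near=> x; have : T (T' x) = T' x + (q i - p i) by near: x.
by rewrite T'K => {2}->; rewrite -[p i - q i]opprB addrK.
Unshelve. all: end_near. Qed.

Lemma translates_comp (R : realType) (d N : nat) (V : set 'rV[R]_d) S T
    (p q r : 'I_N -> 'rV[R]_d) : cdiffeo V T ->
  translates T p q -> translates S q r -> translates (S \o T) p r.
Proof.
move=> Td Tpq Sqr i.
have Tp : T (p i) = q i by rewrite (nbhs_singleton (Tpq i)) addrC subrK.
have [B /strict_deriv_continuous] := cdiffeo_strict_diff (p i) Td.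
rewrite /prop_for /continuous_at Tp => /(_ _ (Sqr i)) near_p.
near=> x; rewrite /=.
have -> : S (T x) = T x + (r i - q i) by near: x.
have -> : T x = x + (q i - p i) by near: x; exact: (Tpq i).
by rewrite -addrA; congr (_ + _); rewrite addrC addrA subrK.
Unshelve. all: end_near. Qed.

(** Points that move along segments without meeting can be carried along: small
    translations of the points at time t are realized in disjoint cubes, and
    the segment of times is connected. *)
Lemma move_points (R : realType) (d N : nat) (V : set 'rV[R]_d)
    (p q : 'I_N -> 'rV[R]_d) : open V ->
  (forall t i, 0 <= t <= 1 -> V ((1 - t) *: p i + t *: q i)) ->
  (forall t, 0 <= t <= 1 -> injective (fun i => (1 - t) *: p i + t *: q i)) ->
  exists2 T, cdiffeo V T & translates T p q.
Proof.
move=> oV pqV pqinj; pose c t i := (1 - t) *: p i + t *: q i.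
pose e s t := exists2 T, cdiffeo V T & translates T (c s) (c t).
have : e 0 1.
  apply: segment_chain => [s t [T Td Tst]|s t u [T Td Tst] [S Sd Stu]|t t01].
  - exact: translates_inverse Td Tst.
  - exists (S \o T); first exact: cdiffeo_comp.
    exact: translates_comp Td Tst Stu.
  have [r r0 [rV rdisj]] := separated_cubes oV (fun i => pqV t i t01) (pqinj t t01).
  have [eta eta0 etaP] := @uniform_radius R N (fun i eta => forall v : 'rV_d,
      `|v| < eta -> exists2 T, cdiffeo [set x | `|x - c t i| < r] T &
      \forall x \near c t i, T x = x + v)
    (fun i r s _ sr rP v vs => rP v (lt_le_trans vs sr))
    (fun i => small_translation (c t i) r0).
  have c_cont i : exists2 m, 0 < m &
      forall s, `|s - t| < m -> `|c s i - c t i| < eta.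
    have n0 : 0 < 1 + `|q i - p i| by rewrite ltr_wpDr.
    exists (eta / (1 + `|q i - p i|)) => [|s]; first by rewrite divr_gt0.
    rewrite ltr_pdivlMr // => sm.
    have -> : c s i - c t i = (s - t) *: (q i - p i).
      by rewrite /c; apply/rowP => j; rewrite !mxE; ring.
    rewrite normrZ; apply: le_lt_trans sm; by rewrite ler_wpM2l // lerDr.
  have [m m0 mP] := @uniform_radius R N (fun i m =>
      forall s, `|s - t| < m -> `|c s i - c t i| < eta)
    (fun i r s _ sr rP v vs => rP v (lt_le_trans vs sr)) c_cont.
  exists m => // s s01 st.
  have [T_ T_P] := choice (fun i =>
    let: ex_intro2 T Td TE := etaP i _ (mP i s st) in
    ex_intro (fun T => cdiffeo [set x | `|x - c t i| < r] T /\
      \forall x \near c t i, T x = x + (c s i - c t i)) T (conj Td TE)).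
  have [T Td TE] := cdiffeo_glue rV rdisj (fun i => (T_P i).1).
  exists T => // i.
  have near_r : \forall x \near c t i, `|x - c t i| < r.
    by apply/nearP; exists r.
  by apply: filterS2 near_r (T_P i).2 => x Zx Tx; rewrite (TE i x Zx).
rewrite /e => -[T Td Tpq]; exists T => // i; have := Tpq i.
by rewrite /c subr0 subrr !scale0r !scale1r addr0 add0r.
Qed.

(** * The unit ball *)

Definition unit_ball (R : realType) (d : nat) : set 'rV[R]_d :=
  [set x | sqnorm x < 1].
Arguments unit_ball : clear implicits.

Lemma sqnorm_continuous (R : realType) (d : nat) :
  continuous (@sqnorm R d : 'rV[R]_d -> R).
Proof.
move=> x; apply/(@continuous_atP R 'rV[R]_d R) => e e0.
have /strict_deriv_continuous/continuous_atP/(_ e e0)[r r0 rP] :=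
  strict_deriv_sqnorm x.
exists r => // y /rP; apply: le_lt_trans.
by apply: le_trans (mx_entry_le _ 0 0); rewrite !mxE.
Qed.

Lemma unit_ball_open (R : realType) (d : nat) : open (unit_ball R d).
Proof.
apply: (@open_comp _ _ (@sqnorm R d) [set t | t < 1]); last exact: open_lt.
by move=> x _; exact: sqnorm_continuous.
Qed.

Lemma sqnormZ (R : realType) (d : nat) (t : R) (x : 'rV[R]_d) :
  sqnorm (t *: x) = t ^+ 2 * sqnorm x.
Proof.
by rewrite /sqnorm mulr_sumr; apply: eq_bigr => i _; rewrite mxE exprMn.
Qed.

Lemma sqnorm_ge0 (R : realType) (d : nat) (x : 'rV[R]_d) : 0 <= sqnorm x.
Proof. by apply: sumr_ge0 => i _; exact: sqr_ge0. Qed.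

Lemma unit_ball0 (R : realType) (d : nat) : unit_ball R d 0.
Proof. by rewrite /unit_ball /= -(scale0r 0) sqnormZ expr0n mul0r. Qed.

Lemma unit_ball_convex (R : realType) (d : nat) (x y : 'rV[R]_d) (t : R) :
  0 <= t <= 1 -> unit_ball R d x -> unit_ball R d y ->
  unit_ball R d ((1 - t) *: x + t *: y).
Proof.
move=> /andP[t0 t1]; rewrite /unit_ball /= => x1 y1.
have : sqnorm ((1 - t) *: x + t *: y) <= (1 - t) * sqnorm x + t * sqnorm y.
  rewrite /sqnorm !mulr_sumr -big_split /=; apply: ler_sum => i _.
  rewrite !mxE; move: (x 0 i) (y 0 i) => a b.
  have : 0 <= t * (1 - t) * (a - b) ^+ 2.
    by apply: mulr_ge0 (sqr_ge0 _); apply: mulr_ge0; lra.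
  by nra.
have := sqnorm_ge0 x; have := sqnorm_ge0 y.
have [->|tn0] := eqVneq t 0; first by rewrite subr0 mul0r addr0 mul1r; lra.
have : t * sqnorm y < t * 1 by rewrite ltr_pM2l // lt0r tn0.
have : (1 - t) * sqnorm x <= (1 - t) * 1 by apply: ler_wpM2l; lra.
lra.
Qed.

Lemma unit_ball_norm (R : realType) (d : nat) (x : 'rV[R]_d) :
  sqnorm x <= 1 -> `|x| <= 1.
Proof.
move=> x1; have := le_trans (sqnorm_ge x) x1.
by rewrite -[X in _ <= X](expr1n R 2) ler_sqr ?nnegrE.
Qed.

(** A compact part of the ball can be squeezed into any neighbourhood of the
    centre, by iterating a homothety cut off near the boundary. *)
Lemma squeeze (R : realType) (d : nat) (K : set 'rV[R]_d) (e : R) :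
  compact K -> K `<=` unit_ball R d -> 0 < e ->
  exists2 s, cdiffeo (unit_ball R d) s & forall x, K x -> `|s x| < e.
Proof.
move=> cK KB e0; have [->|/set0P K0] := eqVneq K set0.
  by exists id => //; exact: cdiffeo_id.
have [c /set_mem Kc cmax] : exists2 c, c \in K &
    forall x, x \in K -> sqnorm x <= sqnorm c.
  apply: EVT_max_rV => //; apply: continuous_subspaceT; exact: sqnorm_continuous.
pose k := sqnorm c; have k1 : k < 1 by exact: KB.
have Kk x : K x -> sqnorm x <= k by move=> Kx; apply: cmax; exact/mem_set.
have [chi [chid chi01 chi1 chi0]] := @sqnorm_cutoff R d k ((k + 1) / 2) ltac:(lra).
pose L := [set x : 'rV[R]_d | sqnorm x <= (k + 1) / 2].
have cL : compact L.
  apply: bounded_closed_compact.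
    exists 1; split=> [|s s1 x]; first exact: num_real.
    rewrite /L /= => xk; apply: le_trans (ltW s1); apply: unit_ball_norm; lra.
  apply: (preimage_closed (f := @sqnorm R d) _ (@closed_le _ _)) => x _.
  exact: sqnorm_continuous.
pose w x := (chi x)%:M *m x.
have wE x : w x = chi x *: x by rewrite /w mul_scalar_mx.
have wd x : strict_diff w x.
  have [A cA] := chid x; eexists.
  exact: strict_derivM cA (strict_deriv_id x).
have w0 x : ~ L x -> w x = 0.
  move=> /negP; rewrite -ltNge => xL.
  by rewrite wE chi0 ?scale0r // ltW.
have [l l0 wl] := compact_support_lipschitz wd cL w0.
pose h : R := (2 * (1 + l))^-1.
have h0 : 0 < h by rewrite invr_gt0 mulr_gt0 // addr_gt0.
have hl : h * l <= 2^-1.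
  by rewrite /h mulrC ler_pdivrMr ?mulr_gt0 ?addr_gt0 //; lra.
have h1 : h <= 2^-1.
  by rewrite /h lef_pV2 ?posrE ?mulr_gt0 ?addr_gt0 //; lra.
pose u x := w x *m (- h)%:M.
have uE x : u x = - h *: w x by rewrite /u mul_mx_scalar.
pose S x := x + u x.
have Sd : cdiffeo (unit_ball R d) S.
  apply: (@cdiffeo_perturbation _ _ _ L) => //.
  - move=> x; have [A wA] := wd x; eexists.
    exact: strict_deriv_comp wA (strict_deriv_mulmx _ _).
  - move=> x y; rewrite !uE -scalerBr normrZ normrN (gtr0_norm h0).
    apply: le_trans (ler_wpM2l (ltW h0) (wl x y)) _.
    by rewrite mulrA ler_wpM2r.
  - by move=> x; rewrite /L /unit_ball /=; lra.
  - by move=> x /w0 wx; rewrite uE wx scaler0.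
have SE x : sqnorm x <= k -> S x = (1 - h) *: x.
  by move=> xk; rewrite /S uE wE chi1 // scale1r scalerBl scale1r scaleNr.
have hm : 0 <= 1 - h < 1 by lra.
have iterS m x : sqnorm x <= k -> iter m S x = (1 - h) ^+ m *: x.
  move=> xk; elim: m => [|m IH]; first by rewrite expr0 scale1r.
  rewrite iterS IH SE ?scalerA -?exprS // sqnormZ.
  rewrite -[leRHS]mul1r ler_pM ?sqnorm_ge0 ?sqr_ge0 //.
  by rewrite -exprM exprn_ile1 //; lra.
have [m mP] : exists m, (1 - h) ^+ m < e.
  have hm1 : `|1 - h| < 1 by rewrite ger0_norm; lra.
  have /cvgrPdist_lt/(_ e e0) := cvg_expr hm1.
  move=> [m _ mP]; exists m; have := mP m (leqnn m); rewrite /= sub0r normrN.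
  by apply: le_lt_trans; exact: ler_norm.
exists (iter m S).
  elim: m {mP} => [|m IH]; first exact: cdiffeo_id.
  exact: cdiffeo_comp Sd IH.
move=> x Kx; rewrite iterS ?Kk // normrZ normrX ger0_norm; last lra.
apply: le_lt_trans mP; rewrite -[leRHS]mulr1 ler_wpM2l //.
  by rewrite exprn_ge0; lra.
by apply: unit_ball_norm; have := Kk x Kx; lra.
Qed.

Lemma left_inverse_on (T U : Type) (x0 : T) (V : set T) (f : T -> U) :
  (forall x y, V x -> V y -> f x = f y -> x = y) ->
  exists g, forall x, V x -> g (f x) = x.
Proof.
move=> finj.
have /choice[g gP] y : exists x, forall x', V x' -> f x' = y -> x' = x.
  have [[x [Vx <-]]|nV] := pselect (exists x, V x /\ f x = y).
    by exists x => x' Vx' e; apply: finj.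
  by exists x0 => x' Vx' e; case: nV; exists x'.
by exists g => x Vx; rewrite -(gP (f x) x).
Qed.

(** The conjugate of s by f, extended by the identity.  It is of class C^1 also
    at the boundary of the image, because the image of the support of s is
    compact, hence closed. *)
Lemma cdiffeo_transport (R : realType) (d : nat) (V : set 'rV[R]_d) f s :
  open V -> C1_embedding V f -> cdiffeo V s ->
  exists2 S, cdiffeo (f @` V) S & forall x, V x -> S (f x) = f (s x).
Proof.
move=> oV fe sd; have [g gf] := left_inverse_on 0 fe.1.
pose tr s y := if pselect ((f @` V) y) then f (s (g y)) else y.
have trE s' x : V x -> tr s' (f x) = f (s' x).
  move=> Vx; rewrite /tr; case: pselect => [h|[]]; first by rewrite gf.
  by exists x.
have trO s' y : ~ (f @` V) y -> tr s' y = y.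
  by move=> nV; rewrite /tr; case: pselect.
have oI : open (f @` V) by exact: (embedding_open oV fe oV (@subset_refl _ V)).
have trK s1 s2 : cdiffeo V s1 -> cancel s1 s2 -> cancel (tr s1) (tr s2).
  move=> s1d sK y; have [[x Vx <-]|nV] := pselect ((f @` V) y).
    by rewrite !trE ?sK //; exact: cdiffeo_in s1d Vx.
  by rewrite !trO.
have fc : {in V, continuous f}.
  move=> x /set_mem Vx; have [A fA _] := fe.2 x Vx.
  exact: strict_deriv_continuous fA.
have tr_supp s1 : cdiffeo V s1 -> exists K, [/\ compact K, K `<=` f @` V &
    forall y, ~ K y -> tr s1 y = y].
  move=> [_ [_ _ _ _ [K [cK KV Ks]]]]; exists (f @` K); split.
  - apply: continuous_compact => //; apply: continuous_in_subspaceT => x /set_mem Kx.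
    by apply: fc; apply/mem_set; exact: KV.
  - by move=> _ [x Kx <-]; exists x => //; exact: KV.
  - move=> y nK; have [[x Vx yE]|nV] := pselect ((f @` V) y); last exact: trO.
    by rewrite -yE trE // Ks // => Kx; apply: nK; exists x.
have tr_diff s1 y : cdiffeo V s1 -> strict_diff (tr s1) y.
  move=> s1d; have [[x Vx <-]|nV] := pselect ((f @` V) y).
    have [A fA uA] := fe.2 x Vx.
    have gA := embedding_inverse oV fe gf Vx fA.
    have [B sB] := cdiffeo_strict_diff x s1d.
    have [C fC _] := fe.2 (s1 x) (cdiffeo_in s1d Vx).
    exists (invmx A *m B *m C).
    have gx := gf x Vx.
    have sg : strict_deriv (s1 \o g) (f x) (invmx A *m B).
      by apply: strict_deriv_comp => //; rewrite gx.
    have fsg : strict_deriv (f \o (s1 \o g)) (f x) (invmx A *m B *m C).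
      by apply: strict_deriv_comp => //=; rewrite gx.
    apply: near_strict_deriv fsg.
    apply: (near_open oI) => [|_ [z Vz <-]]; first by exists x.
    by rewrite /= gf // trE.
  have [K [cK KV Kout]] := tr_supp s1 s1d.
  exists 1%:M; apply: near_strict_deriv (strict_deriv_id y).
  have oK : open (~` K) by apply: closed_openC; apply: compact_closed => //; exact: norm_hausdorff.
  by apply: (near_open oK) => [/KV//|z /Kout].
have [s' [sK s'K s'd]] := cdiffeo_inverse sd.
exists (tr s) => [|x Vx]; last exact: trE.
exists (tr s'); split; [exact: trK|exact: trK|by move=> x; exact: tr_diff..|].
exact: tr_supp.
Qed.

(** * Matching families of embedded balls *)

(** Each ball has the orientation of the unit ball it lies in. *)
Definition ball_family (R : realType) (d N : nat)
    (e : 'I_N -> 'rV[R]_d -> 'rV[R]_d) : Prop :=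
  [/\ forall i x y, unit_ball R d x -> unit_ball R d y -> e i x = e i y -> x = y,
      forall i x, unit_ball R d x ->
        exists2 A, strict_deriv (e i) x A & 0 < \det A,
      forall i x, unit_ball R d x -> unit_ball R d (e i x) &
      forall i j x y, unit_ball R d x -> unit_ball R d y ->
        e i x = e j y -> i = j].

Lemma ball_family_embedding (R : realType) (d N : nat)
    (e : 'I_N -> 'rV[R]_d -> 'rV[R]_d) i :
  ball_family e -> C1_embedding (unit_ball R d) (e i).
Proof.
move=> [einj ed _ _]; split=> [|x /(ed i)[A eA dA]]; first exact: einj.
by exists A => //; rewrite unitmxE unitfE gt_eqF.
Qed.

(** The translations bring the centres together, and oriented_germ corrects the
    rest near each centre. *)
Lemma match_germs (R : realType) (d N : nat)
    (e e' : 'I_N -> 'rV[R]_d -> 'rV[R]_d) T0 :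
  ball_family e -> ball_family e' -> cdiffeo (unit_ball R d) T0 ->
  translates T0 (e^~ 0) (e'^~ 0) ->
  exists2 T, cdiffeo (unit_ball R d) T &
    forall i, \forall x \near 0, T (e i x) = e' i x.
Proof.
move=> eB eB' T0d T0t; pose B := unit_ball R d.
have oB : open B := @unit_ball_open R d.
have B0 : B 0 := @unit_ball0 R d.
have [einj ed eBB edisj] := eB; have [einj' ed' eBB' edisj'] := eB'.
have c'inj : injective (fun i => e' i 0) by move=> i j /edisj'; exact.
have [r r0 [rB rdisj]] := separated_cubes oB (fun i => eBB' i 0 B0) c'inj.
(* near the new centre, the wanted germ is e' i o (e i)^-1 o translation *)
have germ i : exists T, cdiffeo [set x | `|x - e' i 0| < r] T /\
    \forall x \near 0, T (e i x + (e' i 0 - e i 0)) = e' i x.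
  have em := ball_family_embedding i eB.
  have [g ge] := left_inverse_on 0 (einj i).
  pose v := e' i 0 - e i 0.
  have shift x : strict_deriv (fun y : 'rV[R]_d => y - v) x (1%:M + 0).
    exact: strict_derivD (strict_deriv_id x) (strict_deriv_cst (- v) x).
  pose k y := e' i (g (y - v)).
  have kder x A C : B x -> strict_deriv (e i) x A -> strict_deriv (e' i) x C ->
      strict_deriv k (e i x + v) (invmx A *m C).
    move=> Bx eA e'C; rewrite -[invmx A]mul1mx.
    have xv : e i x + v - v = e i x by rewrite addrK.
    have gA := embedding_inverse oB em ge Bx eA.
    have gv : strict_deriv (g \o (fun y => y - v)) (e i x + v) (1%:M *m invmx A).
      rewrite -[1%:M]addr0; apply: strict_deriv_comp (shift _) _.
      by rewrite xv.
    by apply: strict_deriv_comp gv _; rewrite /= xv ge.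
  have ev : e i 0 + v = e' i 0 by rewrite addrC subrK.
  have [A eA dA] := ed i 0 B0; have [C eC dC] := ed' i 0 B0.
  have := @oriented_germ R d (e' i 0) r k (invmx A *m C) r0.
  case.
  - have : \forall y \near e i 0, (e i @` B) y.
      apply: open_nbhs_nbhs; split; last by exists 0.
      exact: (embedding_open oB em oB (@subset_refl _ B)).
    move=> /nearP[s s0 sP]; apply/nearP; exists s => // y ys.
    have [|x Bx xy] := sP (y - v).
      by rewrite -addrA -opprD [v + _]addrC ev.
    have [A1 eA1 _] := ed i x Bx; have [C1 eC1 _] := ed' i x Bx.
    exists (invmx A1 *m C1); rewrite -[y](subrK v) -xy.
    exact: kder.
  - by rewrite /k -ev addrK ge.
  - by rewrite -ev; exact: kder.
  - by rewrite det_mulmx det_inv mulr_gt0 // invr_gt0.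
  move=> T Td Tk; exists T; split=> //.
  have cont : {for 0, continuous (fun x => e i x + v)}.
    have := strict_derivD eA (strict_deriv_cst v 0).
    exact: strict_deriv_continuous.
  move: cont; rewrite /prop_for /continuous_at ev => cont.
  have kx : \forall x \near 0, T (e i x + v) = k (e i x + v) by exact: cont Tk.
  have Bx : \forall x \near 0, B x by exact: open_nbhs_nbhs.
  by near=> x; rewrite -/v; have -> : T (e i x + v) = k (e i x + v);
    [near: x|rewrite /k addrK ge //; near: x].
have /choice[T_ T_P] := germ.
have [T Td TE] := cdiffeo_glue rB rdisj (fun i => (T_P i).1).
exists (T \o T0); first exact: cdiffeo_comp.
move=> i; have [A eA _] := ed i 0 B0.
have ec : {for 0, continuous (e i)} := strict_deriv_continuous eA.
have ec' : {for 0, continuous (fun x => e i x + (e' i 0 - e i 0))}.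
  have := strict_derivD eA (strict_deriv_cst (e' i 0 - e i 0) 0).
  exact: strict_deriv_continuous.
have n1 := ec _ (T0t i).
have n2 : \forall x \near 0, `|e i x + (e' i 0 - e i 0) - e' i 0| < r.
  have /continuous_atP/(_ r r0)[s s0 sP] := ec'.
  apply/nearP; exists s => // x /sP.
  by rewrite [e i 0 + _]addrC subrK.
have n3 := (T_P i).2.
near=> x; rewrite /=.
have -> : T0 (e i x) = e i x + (e' i 0 - e i 0) by near: x.
rewrite (TE i); last by near: x.
by near: x.
Unshelve. all: end_near. Qed.

(** Squeezing each ball along itself leaves only germs at the centres to be
    matched.  Since the same squeezing s is used in the source and in the
    target balls, undoing it in the target restores the prescribed map: if
    S (e x) = e (s x), T (e (s x)) = e' (s x) and S' (e' x) = e' (s x), then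
    S'^-1 T S sends e x to e' x. *)
Lemma match_balls (R : realType) (d N : nat)
    (e e' : 'I_N -> 'rV[R]_d -> 'rV[R]_d) (K : set 'rV[R]_d) T0 :
  ball_family e -> ball_family e' -> compact K -> K `<=` unit_ball R d ->
  cdiffeo (unit_ball R d) T0 -> translates T0 (e^~ 0) (e'^~ 0) ->
  exists2 T, cdiffeo (unit_ball R d) T & forall i x, K x -> T (e i x) = e' i x.
Proof.
move=> eB eB' cK KB T0d T0t.
have oB := @unit_ball_open R d.
have [T Td Tgerm] := match_germs eB eB' T0d T0t.
have [r r0 rP] := @uniform_radius R N
  (fun i r => forall x, `|x| < r -> T (e i x) = e' i x)
  (fun i r s _ sr rP x xs => rP x (lt_le_trans xs sr)) ltac:(
  move=> i; have /nearP[r r0 rP] := Tgerm i; exists r => // x xr;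
  apply: rP; by rewrite subr0).
have [s sd sK] := squeeze cK KB r0.
have squeeze_balls (f : 'I_N -> 'rV[R]_d -> 'rV[R]_d) : ball_family f ->
    exists2 S, cdiffeo (unit_ball R d) S &
    forall i x, unit_ball R d x -> S (f i x) = f i (s x).
  move=> fB; have [_ _ fBB fdisj] := fB.
  have /choice[S_ S_P] i : exists S, cdiffeo (f i @` unit_ball R d) S /\
      forall x, unit_ball R d x -> S (f i x) = f i (s x).
    by have [S Sd SE] := cdiffeo_transport oB (ball_family_embedding i fB) sd;
      exists S.
  have [||S Sd SE] := cdiffeo_glue _ _ (fun i => (S_P i).1) (V := unit_ball R d).
  - by move=> i _ [x Bx <-]; exact: fBB.
  - by move=> i j _ [x Bx <-] [y By /esym]; exact: fdisj.
  by exists S => // i x Bx; rewrite (SE i) ?(S_P i).2 //; exists x.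
have [S Sd SE] := squeeze_balls e eB.
have [S' Sd' SE'] := squeeze_balls e' eB'.
have [S'' [S'K S''K Sd'']] := cdiffeo_inverse Sd'.
exists (S'' \o T \o S); first by do 2 apply: cdiffeo_comp => //.
move=> i x Kx /=; rewrite SE ?rP ?sK //; last exact: KB.
by rewrite -SE' ?S'K //; exact: KB.
Qed.

(** * Configurations of points in the ball *)

Lemma exists_not_in (R : realType) (l : seq R) : exists s, s \notin l.
Proof.
exists (1 + \sum_(x <- l) `|x|); apply/negP => sl.
have : `|1 + \sum_(x <- l) `|x| | <= \sum_(x <- l) `|x|.
  rewrite {2}(big_rem _ sl) /= lerDl; exact: sumr_ge0.
by have := ler_norm (1 + \sum_(x <- l) `|x|); lra.
Qed.

(** The points first move to distinct points of a line through the origin,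
    whose slope differs from those of the lines through two of the given
    points: then no two of them meet on the way. *)
Lemma move_points_dim2 (R : realType) (d N : nat) (p q : 'I_N -> 'rV[R]_d) :
  (2 <= d)%N -> injective p -> injective q ->
  (forall i, unit_ball R d (p i)) -> (forall i, unit_ball R d (q i)) ->
  exists2 T, cdiffeo (unit_ball R d) T & translates T p q.
Proof.
case: d p q => [|[|d]] // p q _ pinj qinj pB qB.
pose i1 : 'I_d.+2 := lift ord0 ord0.
pose slopes (f : 'I_N -> 'rV[R]_d.+2) : seq R :=
  [seq (f ij.1 0 i1 - f ij.2 0 i1) / (f ij.1 0 ord0 - f ij.2 0 ord0)
  | ij <- enum [set: 'I_N * 'I_N]].
have [s] := exists_not_in (slopes p ++ slopes q).
rewrite mem_cat negb_or => /andP[sp sq].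
pose v : 'rV[R]_d.+2 := \row_j ((j == ord0)%:R + (j == i1)%:R * s).
pose M : R := N%:R * (1 + s ^+ 2) + 1.
have s20 : 0 < 1 + s ^+ 2 by rewrite ltr_wpDr // sqr_ge0.
have M0 : 0 < M by rewrite /M ltr_wpDl // mulr_ge0 // ltW.
pose c (i : 'I_N) : R := i%:R / M.
have cinj i j : i != j -> c i != c j.
  apply: contra_neq => /(mulIf (_ : M^-1 != 0)) => /(_ (invr_neq0 (lt0r_neq0 M0))).
  by move=> /eqP; rewrite eqr_nat => /eqP/val_inj.
have vE : sqnorm v = 1 + s ^+ 2.
  rewrite /sqnorm !big_ord_recl big1 ?addr0 => [|i _]; last first.
    by rewrite mxE -!val_eqE /= mul0r addr0 expr0n.
  by rewrite !mxE -!val_eqE /= !mul0r !mul1r addr0 add0r expr1n.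
have cB i : unit_ball R d.+2 (c i *: v).
  rewrite /unit_ball /= sqnormZ vE.
  have ciM : c i * (1 + s ^+ 2) < 1.
    rewrite /c mulrAC ltr_pdivrMr // mul1r /M.
    have : i%:R * (1 + s ^+ 2) <= N%:R * (1 + s ^+ 2).
      by rewrite ler_pM2r // ler_nat ltnW.
    lra.
  have c0 : 0 <= c i by rewrite divr_ge0 // ltW.
  have s21 : 1 <= 1 + s ^+ 2 by rewrite lerDl sqr_ge0.
  have c1 : c i <= 1 by nra.
  by apply: le_lt_trans ciM; rewrite ler_pM2r // expr2 ler_piMl.
have to_line (f : 'I_N -> 'rV[R]_d.+2) : injective f ->
    (forall i, unit_ball R d.+2 (f i)) -> s \notin slopes f ->
    exists2 T, cdiffeo (unit_ball R d.+2) T & translates T f (fun i => c i *: v).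
  move=> finj fB sf; apply: move_points; first exact: unit_ball_open.
    by move=> t i t01; exact: unit_ball_convex.
  move=> t t01 i j eij; apply/eqP; apply: contraT => ij.
  pose a k := f i 0 k - f j 0 k.
  have E k : (1 - t) * a k + t * ((c i - c j) * v 0 k) = 0.
    have := congr1 (fun w : 'rV_d.+2 => w 0 k) eij.
    by rewrite !entryD !entryZ /a; lra.
  have E0 := E ord0; have E1 := E i1.
  rewrite !mxE -!val_eqE /= mul0r mul1r addr0 ?add0r ?mulr1 in E0 E1.
  have cij : c i - c j != 0 by rewrite subr_eq0; exact: cinj.
  have [a0|a0] := eqVneq (a ord0) 0.
    rewrite a0 mulr0 add0r in E0; move/eqP: E0.
    rewrite mulf_eq0 (negbTE cij) orbF => /eqP t0.
    move: eij; rewrite t0 subr0 !scale0r !addr0 !scale1r => /finj ij0.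
    by rewrite ij0 eqxx in ij.
  have a1 : a i1 - s * a ord0 != 0.
    apply: contra sf; rewrite subr_eq0 => /eqP as0; apply/mapP.
    exists (i, j); first by rewrite mem_enum inE.
    by rewrite /= -/(a i1) -/(a ord0) as0 mulfK.
  have : (1 - t) * (a i1 - s * a ord0) = 0.
    by have := congr1 ( *%R s) E0; lra.
  move=> /eqP; rewrite mulf_eq0 (negbTE a1) orbF => /eqP t1.
  move: E0; rewrite t1 mul0r add0r => /eqP; rewrite mulf_eq0 (negbTE cij) orbF.
  by move=> /eqP t0; move: t1; rewrite t0 subr0 => /eqP; rewrite oner_eq0.
have [S Sd Sp] := to_line p pinj pB sp.
have [T Td Tq] := to_line q qinj qB sq.
have [T' Td' Tq'] := translates_inverse Td Tq.
by exists (T' \o S); [exact: cdiffeo_comp|exact: translates_comp Sd Sp Tq'].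
Qed.

(** Convex combinations of two configurations in the same order are again in
    that order, so that the points do not meet. *)
Lemma move_points_dim1 (R : realType) (N : nat) (p q : 'I_N -> 'rV[R]_1) :
  injective p -> (forall i j, p i 0 0 < p j 0 0 -> q i 0 0 < q j 0 0) ->
  (forall i, unit_ball R 1 (p i)) -> (forall i, unit_ball R 1 (q i)) ->
  exists2 T, cdiffeo (unit_ball R 1) T & translates T p q.
Proof.
move=> pinj pq pB qB; apply: move_points; first exact: unit_ball_open.
  by move=> t i t01; exact: unit_ball_convex.
have main t i j : 0 <= t <= 1 -> p i 0 0 < p j 0 0 ->
    (1 - t) *: p i + t *: q i <> (1 - t) *: p j + t *: q j.
  move=> /andP[t0 t1] pij /rowP/(_ 0); rewrite !mxE => e.
  have qij := pq _ _ pij; move: e pij qij.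
  move: (p i 0 0) (p j 0 0) (q i 0 0) (q j 0 0) => a b a' b' e ab ab'.
  have h : 0 <= (1 - t) * (b - a) by apply: mulr_ge0; lra.
  have [t00|tn0] := eqVneq t 0; first by rewrite t00 in e; lra.
  have : 0 < t * (b' - a') by apply: mulr_gt0; [rewrite lt0r tn0|rewrite subr_gt0].
  lra.
move=> t t01 i j e; apply: pinj; apply/rowP => k; rewrite ord1.
have [pij|pij|//] := ltgtP (p i 0 0) (p j 0 0).
  by case: (main t i j t01 pij).
by case: (main t j i t01 pij).
Qed.

(** * Itineraries *)

Definition word_map (T : Type) (m : nat) (phi : 'I_m -> T -> T) (w : seq 'I_m)
  (x : T) : T := foldr phi x w.

Definition disjoint_system (T : Type) (m : nat) (phi : 'I_m -> T -> T)
    (M : set T) : Prop :=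
  [/\ forall i x, M x -> M (phi i x),
      forall i x y, M x -> M y -> phi i x = phi i y -> x = y &
      forall i j x y, M x -> M y -> phi i x = phi j y -> i = j].

Lemma word_map_cat (T : Type) (m : nat) (phi : 'I_m -> T -> T) w v x :
  word_map phi (w ++ v) x = word_map phi w (word_map phi v x).
Proof. by rewrite /word_map foldr_cat. Qed.

Lemma word_map_stable (T : Type) (m : nat) (phi : 'I_m -> T -> T) (M : set T) w x :
  (forall i x, M x -> M (phi i x)) -> M x -> M (word_map phi w x).
Proof. by move=> stab Mx; elim: w => //= i w; exact: stab. Qed.

Lemma word_map_inj (T : Type) (m : nat) (phi : 'I_m -> T -> T) (M : set T) w x y :
  disjoint_system phi M -> M x -> M y ->
  word_map phi w x = word_map phi w y -> x = y.
Proof.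
move=> [stab inj _] Mx My; elim: w => //= i w IH /inj e; apply: IH.
by apply: e; exact: word_map_stable.
Qed.

(** Equal first letters are peeled off, by disjointness and injectivity. *)
Lemma word_map_prefix (T : Type) (m : nat) (phi : 'I_m -> T -> T) (M : set T)
    w w' x y : disjoint_system phi M -> M x -> M y ->
  word_map phi w x = word_map phi w' y ->
  (exists v, w' = w ++ v) \/ (exists v, w = w' ++ v).
Proof.
move=> [stab inj disj] Mx My.
elim: w w' => [|i w IH] [|j w'] e; [by left; exists [::]|by left; eexists|
  by right; eexists|].
have Mw := word_map_stable w stab Mx; have Mw' := word_map_stable w' stab My.
have ij : i = j by exact: disj Mw Mw' e.
rewrite -ij in e *; have /IH[[v ->]|[v ->]] := inj _ _ _ Mw Mw' e.
  by left; exists v.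
by right; exists v.
Qed.

Lemma prepend_cat (m : nat) (w v : seq 'I_m) s :
  prepend (w ++ v) s = prepend w (prepend v s).
Proof.
apply/funext => k; rewrite /prepend nth_cat size_cat subnDA.
case: ltnP => [kw|kw]; last by rewrite [RHS]nth_default.
exact: set_nth_default.
Qed.

Lemma cylinder_partition_word_map (T : Type) (m N : nat) (phi : 'I_m -> T -> T)
    (M : set T) (w : 'I_N -> seq 'I_m) i j x y :
  (0 < m)%N -> disjoint_system phi M -> cylinder_partition w -> M x -> M y ->
  word_map phi (w i) x = word_map phi (w j) y -> i = j.
Proof.
case: m phi w => // m phi w _ phiM wpart Mx My e.
have overlap a b v : w a = w b ++ v -> a = b.
  move=> ab; pose z := prepend (w a) (fun=> ord0).
  have [k [_ kz]] := wpart z.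
  have ka : k = a by apply: kz; exists (fun=> ord0).
  have kb : k = b.
    by apply: kz; exists (prepend v (fun=> ord0)); rewrite // /z ab prepend_cat.
  by rewrite -ka.
by have [[v /overlap]|[v /overlap]] := word_map_prefix phiM Mx My e.
Qed.

Section Coding.
Context (R : realType) (U : metricType R) (n : nat) (phi : 'I_n.+1 -> U -> U)
  (M C : set U) (lambda : R).
Context (phiM : disjoint_system phi M) (l0 : 0 <= lambda) (l1 : lambda < 1)
  (contr : forall i x y, mdist (phi i x) (phi i y) <= lambda * mdist x y)
  (CphiC : attractor phi M C).

Let C0 : C !=set0. Proof. by case: CphiC. Qed.
Let cC : compact C. Proof. by case: CphiC. Qed.
Let CM : C `<=` M. Proof. by case: CphiC. Qed.

Let C_stable i x : C x -> C (phi i x).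
Proof. by case: CphiC => _ _ _ {2}-> Cx; exists i => //; exists x. Qed.

Let C_split x : C x -> exists i y, C y /\ x = phi i y.
Proof.
by case: CphiC => _ _ _ {1}-> [i _ [y Cy <-]]; exists i, y.
Qed.

(** Encoded by nested images, rather than by iterating inverses of the maps, so
    that it makes sense for every point of U. *)
Definition itinerary (s : nat -> 'I_n.+1) (x : U) : Prop :=
  forall k, (word_map phi (mkseq s k) @` C) x.

Let itinerary_C s x : itinerary s x -> C x.
Proof. by move=> /(_ 0%N)[y Cy <-]. Qed.

Lemma itinerary_ex x : C x -> exists s, itinerary s x.
Proof.
move=> Cx.
have /choice[f fP] z : exists iy : 'I_n.+1 * U, C z -> C iy.2 /\ z = phi iy.1 iy.2.
  have [Cz|nCz] := pselect (C z); last by exists (ord0, z).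
  by have [i [y [Cy zy]]] := C_split Cz; exists (i, y).
pose y k := iter k (fun z => (f z).2) x.
have Cy k : C (y k) by elim: k => //= k IH; case: (fP _ IH).
exists (fun k => (f (y k)).1) => k; exists (y k) => //.
elim: k => [//|k IH]; rewrite mkseqS /word_map foldr_rcons -[RHS]IH.
by have [_ {2}->] := fP _ (Cy k).
Qed.

Lemma itinerary_inj s t x : itinerary s x -> itinerary t x -> s = t.
Proof.
move=> sx tx; apply/funext => k.
have [y /CM My ys] := sx k.+1; have [z /CM Mz zt] := tx k.+1.
have : mkseq s k.+1 = mkseq t k.+1.
  have e : word_map phi (mkseq s k.+1) y = word_map phi (mkseq t k.+1) z.
    by rewrite ys zt.
  have [[v e']|[v e']] := word_map_prefix phiM My Mz e.
    have /eqP : size (mkseq t k.+1) = size (mkseq s k.+1 ++ v) by rewrite e'.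
    by rewrite size_cat !size_mkseq -[X in X == _]addn0 eqn_add2l eq_sym
      size_eq0 => /eqP v0; rewrite e' v0 cats0.
  have /eqP : size (mkseq s k.+1) = size (mkseq t k.+1 ++ v) by rewrite -e'.
  by rewrite size_cat !size_mkseq -[X in X == _]addn0 eqn_add2l eq_sym
    size_eq0 => /eqP v0; rewrite e' v0 cats0.
by move=> /(congr1 (fun l => nth (s k) l k)); rewrite !nth_mkseq.
Qed.

Let word_map_contr w x y :
  mdist (word_map phi w x) (word_map phi w y) <= lambda ^+ size w * mdist x y.
Proof.
elim: w => [|i w IH] /=; first by rewrite expr0 mul1r.
apply: le_trans (contr _ _ _) _.
by rewrite exprS -mulrA ler_wpM2l.
Qed.

Let C_bounded : exists2 D : R, 0 < D & forall x y, C x -> C y -> mdist x y <= D.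
Proof.
have [c Cc] := C0.
have : \forall b \near \oo, C `<=` (fun x => mdist c x < b%:R).
  move/compact_near_coveringP: cC; apply => x _.
  exists (ball x 1, [set b : nat | mdist c x + 1 < b%:R]) => /=.
    split; first exact: nbhsx_ballx.
    exact: (nbhs_infty_gtr (mdist c x + 1)).
  move=> [y b] /= [xy cx]; apply: le_lt_trans (metric_triangle c x y) _.
  apply: lt_trans cx; rewrite ltrD2l.
  by move: xy; rewrite ballEmdist.
move=> [b _ /(_ b (leqnn b)) bP].
exists (b%:R + b%:R) => [|x y /bP cx /bP cy].
  by apply: addr_gt0; apply: le_lt_trans (mdist_ge0 c c) (bP c Cc).
apply: le_trans (metric_triangle x c y) _; apply: lerD; last exact: ltW.
by rewrite metric_sym ltW.
Qed.

(** By contraction, the images of C under long words are small. *)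
Lemma itinerary_unique s x y : itinerary s x -> itinerary s y -> x = y.
Proof.
move=> sx sy; apply: mdist_positivity; apply/eqP; rewrite eq_le mdist_ge0 andbT.
have [D D0 DP] := C_bounded.
apply/ler_addgt0Pl => e e0; rewrite addr0.
have lt1 : `|lambda| < 1 by rewrite ger0_norm.
have /cvgrPdist_lt/(_ (e / D)) := cvg_expr lt1.
case; first by rewrite divr_gt0.
move=> k _ /(_ k (leqnn k)) /=; rewrite sub0r normrN => kP.
have [x' Cx' <-] := sx k; have [y' Cy' <-] := sy k.
apply: le_trans (word_map_contr _ _ _) _; rewrite size_mkseq.
have h1 : lambda ^+ k <= e / D by apply: le_trans (ler_norm _) (ltW kP).
have h2 := DP _ _ Cx' Cy'.
have h3 : 0 <= lambda ^+ k by rewrite exprn_ge0.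
apply: le_trans (ler_pM h3 (mdist_ge0 _ _) h1 h2) _.
by rewrite divfK // gt_eqF.
Qed.

Let phi_continuous i : continuous (phi i).
Proof.
move=> x; apply/cvg_ballP => e e0; near=> y.
rewrite ballEmdist /=; apply: le_lt_trans (contr _ _ _) _.
have : mdist x y < e.
  have : ball x e y by near: y; exact: nbhsx_ballx.
  by rewrite ballEmdist.
apply: le_lt_trans; rewrite -[leRHS]mul1r ler_wpM2r ?mdist_ge0 //.
exact: ltW.
Unshelve. all: end_near. Qed.

Let word_map_continuous w : continuous (word_map phi w).
Proof.
elim: w => [|i w IH] x /=; first exact: cvg_id.
by apply: (@continuous_comp _ _ _ (word_map phi w) (phi i)); [exact: IH|exact: phi_continuous].
Qed.

(** A decreasing sequence of nonempty compact sets has a common point. *)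
Lemma itinerary_point s : exists x, itinerary s x.
Proof.
have [c Cc] := C0; pose A k := word_map phi (mkseq s k) @` C.
have AC k : A k `<=` C by move=> _ [y Cy <-]; exact: word_map_stable Cy.
have Adecr j k : (k <= j)%N -> A j `<=` A k.
  move=> kj _ [y Cy <-]; rewrite -(subnKC kj) /mkseq iotaD map_cat word_map_cat.
  eexists; last reflexivity.
  exact: word_map_stable Cy.
have Acl k : closed (A k).
  apply: compact_closed; first exact: metric_hausdorff.
  apply: continuous_compact cC; apply: continuous_subspaceT.
  exact: word_map_continuous.
pose z k := word_map phi (mkseq s k) c.
have zA k : A k (z k) by exists c.
have [|x [Cx xcl]] := cC (fmap_proper_filter z _) (F := z @ \oo).
  by exists 0%N => // k _; apply: AC; exact: zA.
exists x => k; apply: Acl => B xB.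
apply: xcl => //; exists k => // j /= kj; exact: Adecr kj _ (zA j).
Qed.

Lemma itinerary_prepend w s x :
  itinerary s x -> itinerary (prepend w s) (word_map phi w x).
Proof.
move=> sx k; have [kw|wk] := leqP k (size w).
  have -> : mkseq (prepend w s) k = take k w.
    apply: (@eq_from_nth _ ord0) => [|j]; rewrite size_mkseq ?size_takel // => jk.
    rewrite nth_mkseq // nth_take // /prepend.
    by apply: set_nth_default; exact: leq_trans jk kw.
  exists (word_map phi (drop k w) x); last by rewrite -word_map_cat cat_take_drop.
  by apply: word_map_stable (itinerary_C sx).
have [y Cy yx] := sx (k - size w)%N; exists y => //.
rewrite -yx -word_map_cat; congr word_map.
rewrite -{1}(subnKC (ltnW wk)) /mkseq iotaD map_cat; congr (_ ++ _).
  apply: (@eq_from_nth _ ord0) => [|j]; rewrite size_map size_iota // => jw.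
  rewrite (nth_map 0%N) ?size_iota // nth_iota // add0n /prepend.
  exact: set_nth_default.
rewrite add0n -[size w]addn0 iotaDl -map_comp addn0; apply: eq_map => j /=.
by rewrite /prepend nth_default ?leq_addr // addKn.
Qed.

End Coding.

(** * Word exchanges on the attractor *)

Section Conjugation.
Context (R : realType) (U : metricType R) (n : nat) (phi : 'I_n.+1 -> U -> U)
  (M C : set U) (lambda : R).
Context (phiM : disjoint_system phi M) (l0 : 0 <= lambda) (l1 : lambda < 1)
  (contr : forall i x y, mdist (phi i x) (phi i y) <= lambda * mdist x y)
  (CphiC : attractor phi M C).

Let point s : exists x, itinerary phi C s x := itinerary_point l1 contr CphiC s.
Let unique s x y : itinerary phi C s x -> itinerary phi C s y -> x = y :=
  @itinerary_unique _ _ _ _ _ _ _ l0 l1 contr CphiC s x y.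
Let in_C s x : itinerary phi C s x -> C x.
Proof. by move=> /(_ 0%N)[y Cy <-]. Qed.

(** Itineraries identify C with the space of words, and the group of words acts
    on C by transport of structure. *)
Lemma contains_copy_itinerary (H : set (C -> C))
    (G : set ((nat -> 'I_n.+1) -> (nat -> 'I_n.+1))) :
  (forall h g, G h -> (forall s (x : C), itinerary phi C s (val x) ->
    itinerary phi C (h s) (val (g x))) -> H g) ->
  contains_copy_of H G.
Proof.
move=> HG; have /choice[pt ptP] := point.
have /choice[adr adrP] (x : C) : exists s, itinerary phi C s (val x).
  by apply: (itinerary_ex CphiC); exact: set_valP.
have adr_pt s (x : C) : itinerary phi C s (val x) -> adr x = s.
  by move=> sx; refine (itinerary_inj phiM CphiC (adrP x) sx).
pose mk s : C := exist _ (pt s) (mem_set (in_C (ptP s))).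
pose iota h x := mk (h (adr x)).
have iotaP h s (x : C) : itinerary phi C s (val x) ->
    itinerary phi C (h s) (val (iota h x)).
  by move=> sx; rewrite /iota (adr_pt _ _ sx); exact: ptP.
exists iota; split.
- by move=> h Gh; exact: HG Gh (iotaP h).
- move=> g h _ _; apply/funext => x; rewrite /iota /=.
  by rewrite (adr_pt (h (adr x)) (mk _)) //; exact: ptP.
- move=> g h _ _ gh; apply/funext => s.
  have ps : adr (mk s) = s by apply: adr_pt; exact: ptP.
  have := congr1 (fun f => val (f (mk s))) gh; rewrite /= ps => e.
  apply: (itinerary_inj phiM CphiC (ptP (g s))); rewrite e; exact: ptP.
Qed.

(** A map that exchanges words on C acts on itineraries as the corresponding
    element of the Thompson group. *)
Lemma word_exchange_itinerary (N : nat) (w w' : 'I_N -> seq 'I_n.+1)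
    (h : (nat -> 'I_n.+1) -> (nat -> 'I_n.+1)) (f : U -> U) :
  cylinder_partition w -> cylinder_partition w' ->
  (forall i s, h (prepend (w i) s) = prepend (w' i) s) ->
  (forall i y, C y -> f (word_map phi (w i) y) = word_map phi (w' i) y) ->
  (forall s x, itinerary phi C s x -> itinerary phi C (h s) (f x)) /\
  f @` C = C.
Proof.
move=> wpart wpart' hw fw.
have itin s x : itinerary phi C s x -> itinerary phi C (h s) (f x).
  move=> sx; have [i [[s' _ es] _]] := wpart s; rewrite -es in sx *.
  have [y s'y] := point s'.
  rewrite (unique sx (itinerary_prepend CphiC (w i) s'y)) hw fw.
    exact: (itinerary_prepend CphiC (w' i) s'y).
  exact: in_C s'y.
split=> //; apply/seteqP; split=> [_ [x Cx <-]|x Cx].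
  have [s sx] := itinerary_ex CphiC Cx; exact: in_C (itin _ _ sx).
have [t tx] := itinerary_ex CphiC Cx.
have [i [[s' _ et] _]] := wpart' t; rewrite -et in tx.
have [y s'y] := point s'.
exists (word_map phi (w i) y).
  exact: in_C (itinerary_prepend CphiC (w i) s'y).
rewrite fw; last exact: in_C s'y.
exact: unique (itinerary_prepend CphiC (w' i) s'y) tx.
Qed.

End Conjugation.

(** * C^1 maps between manifolds *)

Section Charts.
Context (R : realType) (T : topologicalType) (d : nat).
Implicit Types (c : chart R T d) (A : set (chart R T d)).

Definition charts A : Prop := forall c, A c -> is_chart c.

Lemma atlas_charts A : C1_atlas A -> charts A.
Proof. by case. Qed.

Lemma chart_continuous c p : is_chart c -> cdom c p -> {for p, continuous (cmap c)}.
Proof.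
move=> [od oi _ cc _] cp; move: cc.
by rewrite continuous_open_subspace // => /(_ p (mem_set cp)).
Qed.

Lemma chart_inv_continuous c p :
  is_chart c -> cdom c p -> {for cmap c p, continuous (cinv c)}.
Proof.
move=> [od oi _ _ cc] cp; move: cc.
rewrite continuous_open_subspace // => /(_ (cmap c p)); apply.
by apply/mem_set; exists p.
Qed.

Lemma chart_invK c p : is_chart c -> cdom c p -> cinv c (cmap c p) = p.
Proof. by case=> _ _ cK _ _; exact: cK. Qed.

(** Transfers a local property to coordinates, together with the two facts that
    make the chart invertible there. *)
Lemma near_chart c p (P : set T) : is_chart c -> cdom c p ->
  (\forall q \near p, P q) -> \forall x \near cmap c p,
    [/\ P (cinv c x), cdom c (cinv c x) & cmap c (cinv c x) = x].
Proof.
move=> cC cp Pp; have [od oi cK _ _] := cC.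
have := chart_inv_continuous cC cp.
rewrite /prop_for /continuous_at chart_invK // => /(_ _ Pp) Px.
have img : \forall x \near cmap c p, (cmap c @` cdom c) x.
  by apply: open_nbhs_nbhs; split=> //; exists p.
near=> x.
have [q cq qx] : (cmap c @` cdom c) x by near: x.
have Pc : P (cinv c x) by near: x.
by rewrite -qx cK // in Pc *.
Unshelve. all: end_near. Qed.

End Charts.

Lemma strict_diff_continuous (R : realType) (p q : nat)
  (f : 'rV[R]_p -> 'rV[R]_q) a : strict_diff f a -> {for a, continuous f}.
Proof. by move=> [A]; exact: strict_deriv_continuous. Qed.

Lemma C1_near_diff (R : realType) (p q : nat) (f : 'rV[R]_p -> 'rV[R]_q) a :
  C1_near f a -> strict_diff f a.
Proof. by move/C1_nearP; exact: nbhs_singleton. Qed.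

Lemma C1_near_near (R : realType) (p q : nat) (f g : 'rV[R]_p -> 'rV[R]_q) a :
  (\forall x \near a, f x = g x) -> C1_near f a -> C1_near g a.
Proof.
move=> fg /C1_nearP fd; apply/C1_nearP.
have {}fg : \forall y \near a, \forall x \near y, f x = g x.
  by apply/near_join; exact: filterS fg => x.
near=> x; have [A fA] : strict_diff f x by near: x.
exists A; apply: near_strict_deriv fA; near: x; exact: fg.
Unshelve. all: end_near. Qed.

Lemma C1_near_comp (R : realType) (p q s : nat) (f : 'rV[R]_p -> 'rV[R]_q)
    (g : 'rV[R]_q -> 'rV[R]_s) a :
  C1_near f a -> C1_near g (f a) -> C1_near (g \o f) a.
Proof.
move=> /[dup]/C1_near_diff/strict_diff_continuous fc /C1_nearP fd.
move=> /C1_nearP gd; apply/C1_nearP.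
have {}gd : \forall x \near a, strict_diff g (f x) by exact: fc gd.
near=> x; have [A fA] : strict_diff f x by near: x.
have [B gB] : strict_diff g (f x) by near: x.
by exists (A *m B); exact: strict_deriv_comp.
Unshelve. all: end_near. Qed.

Section C1maps.
Context (R : realType).

Lemma C1_at_near (T1 T2 : topologicalType) (d1 d2 : nat)
    (A1 : set (chart R T1 d1)) (A2 : set (chart R T2 d2)) (f g : T1 -> T2) p :
  charts A1 -> (\forall q \near p, f q = g q) -> C1_at A1 A2 f p -> C1_at A1 A2 g p.
Proof.
move=> A1C fg [fc fC1].
have fgp : f p = g p := nbhs_singleton fg.
split.
  rewrite /prop_for /continuous_at -fgp.
  by apply: cvg_trans fc; apply: near_eq_cvg; exact: fg.
move=> c1 c2 Ac1 Ac2 c1p c2p; rewrite -fgp in c2p.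
apply: C1_near_near (fC1 c1 c2 Ac1 Ac2 c1p c2p).
by apply: filterS (near_chart (A1C _ Ac1) c1p fg) => x /= [-> _ _].
Qed.

(** In a chart of the middle manifold, the composite factors near p into the
    local expressions of the two maps. *)
Lemma C1_at_comp (T1 T2 T3 : topologicalType) (d1 d2 d3 : nat)
    (A1 : set (chart R T1 d1)) (A2 : set (chart R T2 d2))
    (A3 : set (chart R T3 d3)) (f : T1 -> T2) (g : T2 -> T3) p :
  charts A1 -> charts A2 -> covering A2 setT ->
  C1_at A1 A2 f p -> C1_at A2 A3 g (f p) -> C1_at A1 A3 (g \o f) p.
Proof.
move=> A1C A2C A2cov [fc fC1] [gc gC1]; split; first exact: continuous_comp.
move=> c1 c3 Ac1 Ac3 c1p c3p.
have [//|c2 Ac2 c2p] := A2cov (f p).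
have h1 := fC1 c1 c2 Ac1 Ac2 c1p c2p.
have := gC1 c2 c3 Ac2 Ac3 c2p c3p.
have -> : cmap c2 (f p) = (cmap c2 \o f \o cinv c1) (cmap c1 p).
  by rewrite /= (chart_invK (A1C _ Ac1) c1p).
move=> h2; apply: C1_near_near (C1_near_comp h1 h2).
have fnear : \forall q \near p, cdom c2 (f q).
  apply: fc; apply: open_nbhs_nbhs; split=> //.
  by have [] := A2C _ Ac2.
apply: filterS (near_chart (A1C _ Ac1) c1p fnear) => x [c2x _ _] /=.
by rewrite (chart_invK (A2C _ Ac2) c2x).
Qed.

Lemma C1_at_id (T : topologicalType) (d : nat) (A A1 A2 : set (chart R T d)) p :
  C1_atlas A -> A1 `<=` A -> A2 `<=` A -> C1_at A1 A2 id p.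
Proof.
move=> [_ _ AA] A1A A2A; split; first exact: cvg_id.
by move=> c1 c2 /A1A Ac1 /A2A Ac2 c1p c2p; exact: AA.
Qed.

Lemma C1_atE (p q : nat) (f : 'rV[R]_p -> 'rV[R]_q) x :
  C1_at (euclidean_atlas R p) (euclidean_atlas R q) f x <->
  \forall y \near x, strict_diff f y.
Proof.
split=> [[_ /(_ _ _ erefl erefl I I)/C1_nearP]//|fd].
split; first exact: strict_diff_continuous (nbhs_singleton fd).
by move=> _ _ -> -> _ _; apply/C1_nearP.
Qed.

Lemma euclidean_charts d : charts (euclidean_atlas R d).
Proof.
move=> _ ->; split=> //=; first exact: openT.
- by rewrite image_id; exact: openT.
- by apply: continuous_subspaceT => x; exact: cvg_id.
- by apply: continuous_subspaceT => x; exact: cvg_id.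
Qed.

Lemma euclidean_covering d : covering (euclidean_atlas R d) setT.
Proof. by move=> x _; exists (Chart setT id id). Qed.

End C1maps.

(** * The interior of M and the open ball *)

Lemma unit_ball_closed_ball (R : realType) (d : nat) :
  unit_ball R d `<=` closed_unit_ball R d.
Proof. by move=> x /ltW. Qed.

(** At an interior point, a C^1 extension agrees with the map itself. *)
Lemma C1_on_open (R : realType) (T1 T2 : topologicalType) (d1 d2 : nat)
    (A1 : set (chart R T1 d1)) (A2 : set (chart R T2 d2)) S f p :
  charts A1 -> (\forall q \near p, S q) -> C1_on A1 A2 S f -> C1_at A1 A2 f p.
Proof.
move=> A1C Sp fC1; have [g gC1 fg] := fC1 p (nbhs_singleton Sp).
apply: C1_at_near gC1 => //.
by apply: filterS2 Sp fg => q Sq /(_ Sq).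
Qed.

(** The chain rule in a chart at p.  The charts live in dimension D and the
    Euclidean space in dimension d, whence rectangular matrices. *)
Lemma left_inverse_derivatives (R : realType) (T : topologicalType) (D d : nat)
    (A : set (chart R T D)) (f : T -> 'rV[R]_d) (g : 'rV[R]_d -> T) p c :
  charts A -> A c -> cdom c p ->
  C1_at A (euclidean_atlas R d) f p -> C1_at (euclidean_atlas R d) A g (f p) ->
  (\forall q \near p, g (f q) = q) ->
  exists (J : 'M[R]_(D, d)) (J' : 'M[R]_(d, D)),
    [/\ strict_deriv (f \o cinv c) (cmap c p) J,
        strict_deriv (cmap c \o g) (f p) J' & J *m J' = 1%:M].
Proof.
move=> AC Ac cp [_ /(_ c _ Ac erefl cp I) /C1_near_diff[J fJ]] [_ gC1] gf.
have gfp : g (f p) = p := nbhs_singleton gf.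
have cgp : cdom c (g (f p)) by rewrite gfp.
have /C1_near_diff[J' gJ'] := gC1 _ c erefl Ac I cgp.
exists J, J'; split; [exact: fJ|exact: gJ'|].
have e : f p = (f \o cinv c) (cmap c p) by rewrite /= (chart_invK (AC _ Ac) cp).
have gJ'' : strict_deriv (cmap c \o g) ((f \o cinv c) (cmap c p)) J' by rewrite -e.
have comp := strict_deriv_comp fJ gJ''.
apply: (strict_deriv_unique comp).
apply: near_strict_deriv (strict_deriv_id _).
by apply: filterS (near_chart (AC _ Ac) cp gf) => x /= [-> _ ->].
Qed.

(** The same for a composition to the identity of R^d. *)
Lemma right_inverse_derivatives (R : realType) (T : topologicalType) (D d : nat)
    (A : set (chart R T D)) (f : T -> 'rV[R]_d) (g : 'rV[R]_d -> T) x c :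
  charts A -> A c -> cdom c (g x) ->
  C1_at A (euclidean_atlas R d) f (g x) -> C1_at (euclidean_atlas R d) A g x ->
  (\forall y \near x, f (g y) = y) ->
  exists (J : 'M[R]_(D, d)) (J' : 'M[R]_(d, D)),
    [/\ strict_deriv (f \o cinv c) (cmap c (g x)) J,
        strict_deriv (cmap c \o g) x J' & J' *m J = 1%:M].
Proof.
move=> AC Ac cp [_ /(_ c _ Ac erefl cp I) /C1_near_diff[J fJ]] [gc gC1] fg.
have /C1_near_diff[J' gJ'] := gC1 _ c erefl Ac I cp.
exists J, J'; split; [exact: fJ|exact: gJ'|].
have comp := strict_deriv_comp gJ' fJ.
apply: (strict_deriv_unique comp).
apply: near_strict_deriv (strict_deriv_id _).
have cg : \forall y \near x, cdom c (g y).
  apply: gc; apply: open_nbhs_nbhs; split=> //.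
  by have [] := AC _ Ac.
by near=> y; rewrite /= (chart_invK (AC _ Ac)); [rewrite (near fg y)|near: y].
Unshelve. all: end_near. Qed.

Lemma near_unit_ball (R : realType) (d : nat) (x : 'rV[R]_d) :
  unit_ball R d x -> \forall y \near x, unit_ball R d y.
Proof. by move=> Bx; apply: open_nbhs_nbhs; split=> //; exact: unit_ball_open. Qed.

Lemma near_interior (T : topologicalType) (M : set T) p : M° p -> \forall q \near p, M° q.
Proof. by move=> Mp; apply: open_nbhs_nbhs; split=> //; exact: open_interior. Qed.

Section BallChart.
Context (R : realType) (U : metricType R) (D d : nat) (A : set (chart R U D))
  (M : set U) (F : U -> 'rV[R]_d) (G : 'rV[R]_d -> U).
Local Notation E := (euclidean_atlas R d).
Local Notation B := (unit_ball R d).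
Context (HA : C1_atlas A) (HF : C1_diffeo A E M (closed_unit_ball R d) F G).

Let AC : charts A := atlas_charts HA.
Let EC : charts E := @euclidean_charts R d.

Lemma ballchart_F_le1 p : M p -> sqnorm (F p) <= 1.
Proof.
by case: HF => FM _ _ _ Mp; have : (F @` M) (F p) by [exists p]; rewrite FM.
Qed.

Lemma ballchart_GK p : M p -> G (F p) = p.
Proof. by case: HF => _ GF _ _; exact: GF. Qed.

Lemma ballchart_G_in x : sqnorm x <= 1 -> M (G x).
Proof.
case: HF => FM GF _ _ x1; have : (F @` M) x by rewrite FM.
by move=> [p Mp <-]; rewrite GF.
Qed.

Lemma ballchart_FK x : sqnorm x <= 1 -> F (G x) = x.
Proof.
case: HF => FM GF _ _ x1; have : (F @` M) x by rewrite FM.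
by move=> [p Mp <-]; rewrite GF.
Qed.

Lemma ballchart_F_C1 p : M° p -> C1_at A E F p.
Proof.
move=> Mp; case: HF => _ _ FC1 _.
exact: (C1_on_open AC Mp FC1).
Qed.

Lemma ballchart_G_C1 x : B x -> C1_at E A G x.
Proof.
move=> Bx; case: HF => _ _ _ GC1; apply: (C1_on_open EC _ GC1).
by apply: filterS (near_unit_ball Bx); exact: unit_ball_closed_ball.
Qed.

(** F p may a priori lie on the boundary sphere, where G itself is not
    differentiable in the ordinary sense. *)
Lemma ballchart_extension p : M° p -> exists g, [/\ C1_at E A g (F p), g (F p) = p,
  \forall x \near F p, closed_unit_ball R d x -> G x = g x &
  \forall q \near p, g (F q) = q].
Proof.
move=> Mp; have Mp' := interior_subset Mp.
case: HF => _ _ _ /(_ (F p) (ballchart_F_le1 Mp'))[g gC1 Gg].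
exists g; split=> //.
  by rewrite -(nbhs_singleton Gg) ?ballchart_GK //; exact: ballchart_F_le1.
have [Fc _] := ballchart_F_C1 Mp.
have Gg' : \forall q \near p, closed_unit_ball R d (F q) ->
  G (F q) = g (F q) by exact: Fc Gg.
near=> q; have Mq : M q by apply: interior_subset; near: q; exact: near_interior.
rewrite -(near Gg' q) ?ballchart_GK //; exact: ballchart_F_le1.
Unshelve. all: end_near. Qed.

Let dim_le p : M° p -> (D <= d)%N.
Proof.
move=> Mp; have [g [gC1 _ _ gF]] := ballchart_extension Mp.
have [_ Acov _] := HA; have [//|c Ac cp] := Acov p.
have [J [J' [_ _ /mulmx1_min]]] :=
  left_inverse_derivatives AC Ac cp (ballchart_F_C1 Mp) gC1 gF.
exact.
Qed.

(** Points of the open ball close to F p are sent into the interior of M, as the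
    extension of G is continuous. *)
Let interior_ball p : M° p -> exists2 x, B x & M° (G x).
Proof.
move=> Mp; have [g [[gc _] gFp Gg _]] := ballchart_extension Mp.
have gM : \forall x \near F p, M° (g x).
  by apply: gc; rewrite gFp; exact: near_interior.
have /nearP[r r0 rP] : \forall x \near F p,
    (closed_unit_ball R d x -> G x = g x) /\ M° (g x) by exact: filterI.
have Fp1 := ballchart_F_le1 (interior_subset Mp).
pose t : R := Num.min (2^-1) (r / 2).
have t0 : 0 < t by rewrite lt_min; apply/andP; split; lra.
have t1 : t <= 2^-1 by rewrite ge_min lexx.
have tr : t <= r / 2 by rewrite ge_min lexx orbT.
have Bx : B ((1 - t) *: F p).
  rewrite /unit_ball /= sqnormZ.
  apply: (@le_lt_trans _ _ ((1 - t) ^+ 2 * 1)).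
    by rewrite ler_wpM2l // sqr_ge0.
  by rewrite mulr1 expr_lt1 //; lra.
exists ((1 - t) *: F p) => //.
have [] := rP ((1 - t) *: F p).
  rewrite scalerBl scale1r addrAC subrr add0r normrN normrZ gtr0_norm //.
  have Fp1' := unit_ball_norm Fp1.
  have : t * `|F p| <= t * 1 by rewrite ler_pM2l.
  by lra.
by move=> -> //; exact: unit_ball_closed_ball.
Unshelve. all: end_near. Qed.

(** Invariance of dimension, for C^1 maps: a left inverse of F at one point and
    a right inverse at another bound the dimensions by each other. *)
Lemma ballchart_dim p : M° p -> D = d.
Proof.
move=> Mp; apply/eqP; rewrite eqn_leq (dim_le Mp) /=.
have [x Bx Mx] := interior_ball Mp.
have [_ Acov _] := HA; have [//|c Ac cx] := Acov (G x).
have FG : \forall y \near x, F (G y) = y.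
  by apply: filterS (near_unit_ball Bx) => y /ltW; exact: ballchart_FK.
have [J [J' [_ _ /mulmx1_min]]] :=
  right_inverse_derivatives AC Ac cx (ballchart_F_C1 Mx) (ballchart_G_C1 Bx) FG.
exact.
Qed.

End BallChart.

(** * The interior of M in equal dimensions *)

Lemma local_max_deriv0 (R : realType) (p : nat) (g : 'rV[R]_p -> R) a A :
  strict_deriv (fun y => (g y)%:M : 'rV_1) a A ->
  (\forall y \near a, g y <= g a) -> A = 0.
Proof.
move=> gA /nearP[s s0 sP]; apply: small_mulmx0 => e e0.
have [r r0 rP] := strict_deriv_ray gA e0.
exists (Num.min r s) => [|v]; first by rewrite lt_min r0.
rewrite lt_min => /andP[vr vs].
have main (w : 'rV[R]_p) : `|w| < r -> `|w| < s -> (w *m A) 0 0 <= e * `|w|.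
  move=> wr ws; have := rP (w + a); have := sP (w + a).
  rewrite addrK => /(_ ws) gle /(_ wr) /(le_trans (rV_entry_le _ 0)).
  move: (w *m A) => z; rewrite !entryB !mxE /= !mulr1n => /ler_normlP[h _].
  lra.
have := main v vr vs; have := main (- v); rewrite normrN mulNmx => /(_ vr vs).
rewrite norm_rV1; move: (v *m _) => z; rewrite mxE ler_norml => h1 h2.
by apply/andP; split; lra.
Qed.

Section SameDimension.
Context (R : realType) (U : metricType R) (d : nat) (A : set (chart R U d))
  (M : set U) (F : U -> 'rV[R]_d) (G : 'rV[R]_d -> U).
Local Notation E := (euclidean_atlas R d).
Local Notation B := (unit_ball R d).
Context (HA : C1_atlas A) (HF : C1_diffeo A E M (closed_unit_ball R d) F G).

Let AC : charts A := atlas_charts HA.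
Let EC : charts E := @euclidean_charts R d.

(** Otherwise the squared norm of F, which is at most 1 on M, would have a
    local maximum at p, contradicting the invertibility of the derivative. *)
Lemma ballchart_F_in p : M° p -> B (F p).
Proof.
move=> Mp; have Fp1 := ballchart_F_le1 HF (interior_subset Mp).
rewrite /unit_ball /= lt_neqAle Fp1 andbT; apply/eqP => F1.
have [g [gC1 _ _ gF]] := ballchart_extension HA HF Mp.
have [_ Acov _] := HA; have [//|c Ac cp] := Acov p.
have [J [J' [FJ _ JJ']]] :=
  left_inverse_derivatives AC Ac cp (ballchart_F_C1 HA HF Mp) gC1 gF.
have cK := chart_invK (AC Ac) cp.
have sqJ : strict_deriv (fun y => (sqnorm ((F \o cinv c) y))%:M : 'rV_1)
    (cmap c p) (J *m (2 *: (F p)^T)).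
  have sq : strict_deriv (fun x : 'rV_d => (sqnorm x)%:M : 'rV_1)
      ((F \o cinv c) (cmap c p)) (2 *: (F p)^T).
    by rewrite /= cK; exact: strict_deriv_sqnorm.
  exact: (strict_deriv_comp FJ sq).
have J0 : J *m (2 *: (F p)^T) = 0.
  apply: (local_max_deriv0 sqJ); rewrite /= cK F1.
  apply: filterS (near_chart (AC Ac) cp (near_interior Mp)) => x [Mx _ _].
  by rewrite /=; apply: (ballchart_F_le1 HF); exact: interior_subset Mx.
have Fp0 : (2 *: (F p)^T) = 0.
  by rewrite -[LHS]mul1mx -(mulmx1C JJ') -mulmxA J0 mulmx0.
have : F p = 0.
  move: Fp0 => /(congr1 trmx); rewrite linearZ /= trmxK trmx0 => /eqP.
  by rewrite scaler_eq0 pnatr_eq0 /= => /eqP.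
by move=> Fp00; move/eqP: F1; rewrite Fp00 -(scale0r 0) sqnormZ expr0n mul0r eq_sym oner_eq0.
Qed.

(** The inverse function theorem at x, in a chart around G x. *)
Lemma ballchart_G_in_int x : B x -> M° (G x).
Proof.
move=> Bx; have x1 : sqnorm x <= 1 := ltW Bx.
have MGx := ballchart_G_in HF x1.
case: (HF) => _ _ /(_ _ MGx)[f fC1 Ff] _.
have [_ Acov _] := HA; have [//|c Ac cx] := Acov (G x).
have GC1 := ballchart_G_C1 HF Bx; have [Gc Gch] := GC1.
have Ff' : \forall y \near x, M (G y) -> F (G y) = f (G y) by exact: Gc Ff.
have fG : \forall y \near x, f (G y) = y.
  apply: filterS2 Ff' (near_unit_ball Bx) => y Ffy /ltW y1.
  by rewrite -Ffy ?(ballchart_FK HF) //; exact: (ballchart_G_in HF).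
have [J [J' [_ GJ J'J]]] := right_inverse_derivatives AC Ac cx fC1 GC1 fG.
have uJ' : J' \in unitmx by have [] := mulmx1_unit J'J.
have Gd : \forall y \near x, strict_diff (cmap c \o G) y.
  by apply/C1_nearP; exact: (Gch _ c erefl Ac I cx).
have cG : \forall y \near x, cdom c (G y).
  apply: Gc; apply: open_nbhs_nbhs; split=> //.
  by have []   := AC Ac.
have /nearP[r r0 rP] : \forall y \near x, B y /\ cdom c (G y).
  by apply: filterI => //; exact: near_unit_ball.
have [s s0 sP] := local_surjectivity Gd GJ uJ' r0.
have cc : {for G x, continuous (cmap c)} := chart_continuous (AC Ac) cx.
have near_s : \forall y \near (cmap c \o G) x, `|y - (cmap c \o G) x| < s.
  by apply/nearP; exists s.
have near_q : \forall q \near G x, `|cmap c q - cmap c (G x)| < s.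
  exact: cc near_s.
have cq : \forall q \near G x, cdom c q.
  by apply: open_nbhs_nbhs; split=> //; have []   := AC Ac.
apply: filterS2 near_q cq => q /sP[y /rP[By cGy] /=] Gyq cq.
have -> : q = G y.
  by rewrite -(chart_invK (AC Ac) cq) -Gyq (chart_invK (AC Ac) cGy).
by apply: (ballchart_G_in HF); exact: ltW.
Qed.

(** The conjugate of sigma by G, extended by the identity to U.  Being the
    identity off a compact part of the interior of M, it raises no question of
    differentiability at the boundary. *)
Lemma ballchart_diff1 sigma : cdiffeo B sigma ->
  exists f f' : U -> U, C1_diffeo A A M M f f' /\
    forall p, M° p -> f p = G (sigma (F p)).
Proof.
move=> sd; have [sigma' [sK s'K sd']] := cdiffeo_inverse sd.
pose tr s p := if pselect (M° p) then G (s (F p)) else p.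
have trE s p : M° p -> tr s p = G (s (F p)).
  by move=> Mp; rewrite /tr; case: pselect.
have trO s p : ~ M° p -> tr s p = p.
  by move=> nM; rewrite /tr; case: pselect.
have tr_int s p : cdiffeo B s -> M° p -> M° (tr s p).
  move=> sB Mp; rewrite trE //; apply: ballchart_G_in_int.
  exact: cdiffeo_in sB (ballchart_F_in Mp).
have trK s1 s2 : cdiffeo B s1 -> cancel s1 s2 -> cancel (tr s1) (tr s2).
  move=> s1d s12 p; have [Mp|nMp] := pselect (M° p); last by rewrite !trO.
  have Bp := cdiffeo_in s1d (ballchart_F_in Mp).
  rewrite trE; last exact: tr_int.
  rewrite trE // (ballchart_FK HF) ?s12 ?(ballchart_GK HF) //.
    exact: interior_subset.
  exact: ltW.
have tr_M s p : cdiffeo B s -> M p -> M (tr s p).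
  move=> sB Mp; have [Mp'|nMp] := pselect (M° p); last by rewrite trO.
  by apply: interior_subset; exact: tr_int.
have tr_C1 s p : cdiffeo B s -> C1_at A A (tr s) p.
  move=> sB; have [Mp|nMp] := pselect (M° p).
    apply: (@C1_at_near _ _ _ _ _ _ _ (G \o (s \o F))) => //.
      by apply: filterS (near_interior Mp) => q Mq; rewrite trE.
    have Ecov := @euclidean_covering R d.
    apply: (C1_at_comp (A2 := E)) => //; last first.
      apply: (ballchart_G_C1 HF).
      exact: cdiffeo_in sB (ballchart_F_in Mp).
    apply: (C1_at_comp (A2 := E)) => //; first exact: (ballchart_F_C1 HA HF).
    apply/C1_atE/nearP; exists 1 => // y _; exact: cdiffeo_strict_diff sB.
  have [_ [_ _ _ _ [K [cK KB Ks]]]] := sB.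
  have cGK : compact (G @` K).
    apply: continuous_compact => //; apply: continuous_in_subspaceT => x /set_mem Kx.
    by have [] := ballchart_G_C1 HF (KB x Kx).
  have oGK : open (~` (G @` K)).
    by apply: closed_openC; apply: compact_closed => //; exact: metric_hausdorff.
  apply: (@C1_at_near _ _ _ _ _ _ _ id) => //; last first.
    by apply: (C1_at_id _ HA).
  have : \forall q \near p, ~ (G @` K) q.
    apply: open_nbhs_nbhs; split=> // -[x Kx Gxp]; apply: nMp.
    by rewrite -Gxp; apply: ballchart_G_in_int; exact: KB.
  apply: filterS => q nq; have [Mq|nMq] := pselect (M° q); last by rewrite trO.
  rewrite trE // Ks ?(ballchart_GK HF) //; first exact: interior_subset.
  move=> KF; apply: nq; exists (F q) => //.
  by rewrite (ballchart_GK HF) //; exact: interior_subset.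
exists (tr sigma), (tr sigma'); split; last by move=> p; exact: trE.
split.
- apply/seteqP; split=> [_ [p Mp <-]|p Mp]; first exact: tr_M.
  by exists (tr sigma' p); [exact: tr_M|exact: trK].
- by move=> p _; exact: trK.
- by move=> p _; exists (tr sigma); [exact: tr_C1|exact: nearW].
- by move=> p _; exists (tr sigma'); [exact: tr_C1|exact: nearW].
Qed.

End SameDimension.

(** * Orientation *)

Lemma det_continuous (R : realType) (d : nat) :
  continuous (fun M : 'M[R]_d => \det M).
Proof.
move=> M; rewrite /continuous_at /determinant.
have FM : Filter (nbhs M) by exact: nbhs_filter.
apply: (@cvg_big _ _ +%R 0) => [|s _]; first exact: add_continuous.
apply: cvgM; first exact: cvg_cst.
apply: (@cvg_big (R : topologicalType) _ (@GRing.mul R) 1) => [|i _].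
  exact: mul_continuous.
exact: coord_continuous.
Qed.

Lemma strict_diff_jacobian (R : realType) (p q : nat)
    (f : 'rV[R]_p -> 'rV[R]_q) a : strict_diff f a -> strict_deriv f a ('J f a).
Proof.
move=> [A fA].
suff [_ ->] : differentiable f a /\ 'J f a = A by [].
by apply: differentiableP_ray => e e0; exact: strict_deriv_ray fA e0.
Qed.

Section OrientedBall.
Context (R : realType) (U : metricType R) (d : nat) (A O : set (chart R U d))
  (M : set U) (F : U -> 'rV[R]_d) (G : 'rV[R]_d -> U).
Local Notation E := (euclidean_atlas R d).
Local Notation B := (unit_ball R d).
Context (HA : C1_atlas A) (HF : C1_diffeo A E M (closed_unit_ball R d) F G)
  (HO : orientation A O).

Let AC : charts A := atlas_charts HA.
Let EC : charts E := @euclidean_charts R d.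
Let AO : C1_atlas (A `|` O). Proof. by case: HO. Qed.
Let OC : charts O.
Proof. by move=> c Oc; apply: (atlas_charts AO); right. Qed.
Let Ocov : covering O setT. Proof. by case: HO. Qed.
Let Acov : covering A setT. Proof. by case: HA. Qed.

Let GO x : B x -> C1_at E O G x.
Proof.
move=> Bx; apply: (C1_at_comp (A2 := A) (f := G) (g := id)) => //.
  exact: (ballchart_G_C1 HF).
by apply: (C1_at_id _ AO) => c; [left|right].
Qed.

Let OF p : M° p -> C1_at O E F p.
Proof.
move=> Mp; apply: (C1_at_comp (A2 := A) (f := id) (g := F)) => //.
  by apply: (C1_at_id _ AO) => c; [right|left].
exact: (ballchart_F_C1 HA HF).
Qed.

Let GC1_near x c : B x -> O c -> cdom c (G x) -> C1_near (cmap c \o G) x.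
Proof. by move=> Bx Oc cx; have [_ h] := GO Bx; exact: (h _ c erefl Oc I cx). Qed.

(** Its sign tells whether G preserves the orientation at x. *)
Let sgn c x : R := \det ('J (cmap c \o G) x).

Let deriv x c : B x -> O c -> cdom c (G x) ->
  strict_deriv (cmap c \o G) x ('J (cmap c \o G) x).
Proof. by move=> *; apply/strict_diff_jacobian/C1_near_diff/GC1_near. Qed.

Let sgn_neq0 c x : B x -> O c -> cdom c (G x) -> sgn c x != 0.
Proof.
move=> Bx Oc cx.
have FG : \forall y \near x, F (G y) = y.
  by apply: filterS (near_unit_ball Bx) => y /ltW; exact: (ballchart_FK HF).
have [J [J' [_ GJ J'J]]] := right_inverse_derivatives OC Oc cx
  (OF (ballchart_G_in_int HA HF Bx)) (GO Bx) FG.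
rewrite /sgn (strict_deriv_unique (deriv Bx Oc cx) GJ).
by have [] := mulmx1_unit J'J; rewrite unitmxE unitfE.
Qed.

(** The sign does not depend on the chart of the oriented atlas. *)
Let sgn_transition c c' x : B x -> O c -> O c' -> cdom c (G x) ->
  cdom c' (G x) -> 0 < sgn c x * sgn c' x.
Proof.
move=> Bx Oc Oc' cx c'x.
have tC1 : C1_near (cmap c' \o cinv c) (cmap c (G x)).
  have [_ _] := AO; apply => //; by right.
have tJ := strict_diff_jacobian (C1_near_diff tC1).
have cx' : \forall q \near G x, cdom c q /\ cdom c' q.
  by apply: open_nbhs_nbhs; split=> //; apply: openI; [case: (OC Oc)|case: (OC Oc')].
have dt : 0 < \det ('J (cmap c' \o cinv c) (cmap c (G x))).
  have [_ _] := HO; apply => //; rewrite /interior /=.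
  apply: filterS (near_chart (OC Oc) cx cx') => y [[_ c'y] cy yE].
  by exists (cinv c y).
have e := strict_deriv_comp (deriv Bx Oc cx) tJ.
have e' : strict_deriv (cmap c' \o G) x ('J (cmap c \o G) x *m
    'J (cmap c' \o cinv c) (cmap c (G x))).
  apply: near_strict_deriv e.
  have [Gc _] := GO Bx.
  have : \forall y \near x, cdom c (G y) /\ cdom c' (G y) by exact: Gc cx'.
  by apply: filterS => y [cy _] /=; rewrite (chart_invK (OC Oc) cy).
rewrite /sgn (strict_deriv_unique (deriv Bx Oc' c'x) e') det_mulmx mulrA.
by apply: mulr_gt0 dt; rewrite -expr2 lt0r sqr_ge0 andbT sqrf_eq0 sgn_neq0.
Qed.

Let mul_gt0_trans (a b c : R) : 0 < a * b -> 0 < b * c -> 0 < a * c.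
Proof.
move=> ab bc; have b2 : 0 < b ^+ 2.
  rewrite lt0r sqr_ge0 andbT sqrf_eq0; apply: contraTneq ab => ->.
  by rewrite mulr0 ltxx.
have : 0 < b ^+ 2 * (a * c).
  have -> : b ^+ 2 * (a * c) = (a * b) * (b * c) by ring.
  exact: mulr_gt0.
by rewrite pmulr_rgt0.
Qed.

Let pos_quotient (a b c e : R) :
  a * b = c * e -> 0 < e -> 0 < b * c -> b != 0 -> 0 < a.
Proof.
move=> abce e0 bc b0.
have b2 : 0 < b ^+ 2 by rewrite lt0r sqr_ge0 andbT sqrf_eq0.
have : 0 < b ^+ 2 * a.
  have -> : b ^+ 2 * a = (b * c) * e by rewrite -mulrA -abce; ring.
  exact: mulr_gt0.
by rewrite pmulr_rgt0.
Qed.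

Let sgn_local c x : B x -> O c -> cdom c (G x) ->
  \forall y \near x, [/\ B y, cdom c (G y) & 0 < sgn c x * sgn c y].
Proof.
move=> Bx Oc cx; have [_ Jc] := nbhs_singleton (GC1_near Bx Oc cx).
have sc : {for x, continuous (sgn c)}.
  apply: continuous_comp; [exact: Jc|exact: det_continuous].
have [Gc _] := GO Bx.
have cG : \forall y \near x, cdom c (G y).
  by apply: Gc; apply: open_nbhs_nbhs; split=> //; case: (OC Oc).
have s2 : 0 < sgn c x * sgn c x.
  by rewrite -expr2 lt0r sqr_ge0 andbT sqrf_eq0 sgn_neq0.
have pos : \forall y \near x, 0 < sgn c x * sgn c y.
  have : {for x, continuous (fun y => sgn c x * sgn c y)}.
    have Fx : Filter (nbhs x) by exact: nbhs_filter.
    by apply: cvgM; [exact: cvg_cst|exact: sc].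
  have pos0 : nbhs (sgn c x * sgn c x) [set t : R | 0 < t].
    by apply: open_nbhs_nbhs; split=> //; exact: open_gt.
  by move=> /(_ _ pos0).
near=> y; split; near: y => //.
exact: near_unit_ball.
Unshelve. all: end_near. Qed.

(** The sign does not depend on the point either, since the ball is
    connected. *)
Let sgn_constant c c' x y : B x -> B y -> O c -> O c' -> cdom c (G x) ->
  cdom c' (G y) -> 0 < sgn c x * sgn c' y.
Proof.
move=> Bx By Oc Oc' cx c'y.
pose z (t : R) := (1 - t) *: x + t *: y.
have Bz t : 0 <= t <= 1 -> B (z t) by move=> t01; exact: unit_ball_convex.
pose e s t := [/\ 0 <= s <= 1, 0 <= t <= 1 & exists c c', [/\ O c, O c',
  cdom c (G (z s)), cdom c' (G (z t)) & 0 < sgn c (z s) * sgn c' (z t)]].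
have [_ _ [a [b [Oa Ob]]]] : e 0 1.
  apply: segment_chain => [s t|s t u|t t01].
  - move=> [s01 t01 [a [b [Oa Ob aS bT ab]]]]; split=> //; exists b, a.
    by split; [exact: Ob|exact: Oa|exact: bT|exact: aS|rewrite mulrC].
  - move=> [s01 t01 [a [b [Oa Ob aS bT ab]]]] [_ u01 [a' [b' [Oa' Ob' aT bU ab']]]].
    split=> //; exists a, b'.
    split; [exact: Oa|exact: Ob'|exact: aS|exact: bU|].
    apply: mul_gt0_trans ab'; apply: mul_gt0_trans ab _.
    exact: (sgn_transition (Bz t t01)).
  - have [a Oa aT] := @Ocov (G (z t)) I.
    have /nearP[r r0 rP] := sgn_local (Bz t t01) Oa aT.
    have n0 : 0 < 1 + `|y - x| by rewrite ltr_wpDr.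
    exists (r / (1 + `|y - x|)) => [|s s01]; first by rewrite divr_gt0.
    rewrite ltr_pdivlMr // => st.
    have close : `|z s - z t| < r.
      have -> : z s - z t = (s - t) *: (y - x).
        by rewrite /z; apply/rowP => j; rewrite !mxE; ring.
      by rewrite normrZ; apply: le_lt_trans st; rewrite ler_wpM2l // lerDr.
    have [_ aS ats] := rP (z s) close.
    split=> //; exists a, a.
    by split; [exact: Oa|exact: Oa|exact: aT|exact: aS|exact: ats].
have z0 : z 0 = x by rewrite /z subr0 scale1r scale0r addr0.
have z1 : z 1 = y by rewrite /z subrr scale1r scale0r add0r.
rewrite z0 z1 => aX bY ab.
apply: (mul_gt0_trans (b := sgn a x)); first exact: sgn_transition.
by apply: mul_gt0_trans ab _; exact: sgn_transition.
Qed.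

(** G may reverse the orientation, but then it does so both at x and at the image
    of x, so that the conjugate of f by G has positive determinant in any
    case. *)
Lemma oriented_ball_map (f : U -> U) x : orientation_preserving O f ->
  C1_at A A f (G x) -> B x -> M° (f (G x)) ->
  exists2 J, strict_deriv (F \o f \o G) x J & 0 < \det J.
Proof.
move=> fO fC1 Bx Mfx.
have [c Oc cx] := @Ocov (G x) I; have [c' Oc' c'fx] := @Ocov (f (G x)) I.
set psi := F \o f \o G; have Bpsi : B (psi x) := ballchart_F_in HA HF Mfx.
have psiE y : psi y = F (f (G y)) by [].
have Gpsi : G (psi x) = f (G x).
  by rewrite /psi /= (ballchart_GK HF) //; exact: interior_subset.
have fO1 : C1_at O O f (G x).
  apply: (C1_at_comp (A2 := A) (f := f) (g := id)) => //; last first.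
    by apply: (C1_at_id _ AO) => b; [left|right].
  apply: (C1_at_comp (A2 := A) (f := id) (g := f)) => //.
  by apply: (C1_at_id _ AO) => b; [right|left].
have fG1 : C1_at E O (f \o G) x by apply: (C1_at_comp (A2 := O)) => //; exact: GO.
have psi1 : C1_at E E psi x.
  by apply: (C1_at_comp (A2 := O) (f := f \o G) (g := F)) => //; exact: OF.
clearbody psi.
have psiJ := strict_diff_jacobian (nbhs_singleton ((C1_atE _ _).1 psi1)).
exists ('J psi x) => //.
have c'psi : cdom c' (G (psi x)) by rewrite Gpsi.
(* the derivative of f o G, read in the chart c', computed in two ways *)
have e1 := strict_deriv_comp psiJ (deriv Bpsi Oc' c'psi).
have fch : C1_near (cmap c' \o f \o cinv c) (cmap c (G x)) by have [_ h] := fO1; exact: h.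
have fJ := strict_diff_jacobian (C1_near_diff fch).
have e2 := strict_deriv_comp (deriv Bx Oc cx) fJ.
have e3 : strict_deriv ((cmap c' \o G) \o psi) x
    ('J (cmap c \o G) x *m 'J (cmap c' \o f \o cinv c) (cmap c (G x))).
  apply: near_strict_deriv e2.
  have [Gc _] := GO Bx; have [fGc _] := fG1.
  have n1 : \forall y \near x, cdom c (G y).
    by apply: Gc; apply: open_nbhs_nbhs; split=> //; case: (OC Oc).
  have n2 : \forall y \near x, M° (f (G y)) by apply: fGc; exact: near_interior.
  apply: filterS2 n1 n2 => y cy My /=.
  rewrite (chart_invK (OC Oc) cy) psiE (ballchart_GK HF) //; exact: interior_subset.
have dE : \det ('J psi x) * \det ('J (cmap c' \o G) (psi x)) =
    \det ('J (cmap c \o G) x) *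
    \det ('J (cmap c' \o f \o cinv c) (cmap c (G x))).
  have u := strict_deriv_unique e1 e3.
  exact: (etrans (esym (det_mulmx _ _))
    (etrans (congr1 determinant u) (det_mulmx _ _))).
have dJ := fO c c' Oc Oc' (G x) cx c'fx.
have s1 := sgn_constant Bpsi Bx Oc' Oc c'psi cx.
exact: (pos_quotient dE dJ s1 (sgn_neq0 Bpsi Oc' c'psi)).
Qed.

End OrientedBall.

(** * The function system read in the ball *)

Section System.
Context (R : realType) (U : metricType R) (d n : nat) (A O : set (chart R U d))
  (M C : set U) (F : U -> 'rV[R]_d) (G : 'rV[R]_d -> U)
  (phi : 'I_n.+1 -> U -> U).
Local Notation E := (euclidean_atlas R d).
Local Notation B := (unit_ball R d).
Context (HA : C1_atlas A) (HF : C1_diffeo A E M (closed_unit_ball R d) F G)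
  (HO : orientation A O) (phi_or : forall j, orientation_preserving O (phi j))
  (phi_C1 : forall j p, C1_at A A (phi j) p)
  (phi_inj : forall j x y, phi j x = phi j y -> x = y)
  (phi_int : forall j x, M x -> M° (phi j x))
  (phi_disj : forall i j x y, M x -> M y -> phi i x = phi j y -> i = j)
  (CphiC : attractor phi M C).

Definition ball_system j := F \o phi j \o G.

Let G_int x : B x -> M° (G x) := @ballchart_G_in_int _ _ _ _ _ _ _ HA HF x.
Let F_in p : M° p -> B (F p) := @ballchart_F_in _ _ _ _ _ _ _ HA HF p.
Let GK p : M° p -> G (F p) = p.
Proof. by move=> /interior_subset; exact: (ballchart_GK HF). Qed.
Let FK x : B x -> F (G x) = x.
Proof. by move=> /ltW; exact: (ballchart_FK HF). Qed.
Let GM x : B x -> M (G x).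
Proof. by move=> /G_int/interior_subset. Qed.

Lemma phi_disjoint_system : disjoint_system phi M.
Proof.
split; [|by move=> i x y _ _; exact: phi_inj|exact: phi_disj].
by move=> i x /(phi_int i)/interior_subset.
Qed.

Lemma ball_system_disjoint : disjoint_system ball_system B.
Proof.
have Fi x y : M° x -> M° y -> F x = F y -> x = y.
  by move=> Mx My e; rewrite -(GK Mx) e GK.
split=> [i x Bx|i x y Bx By|i j x y Bx By].
- by apply: F_in; apply: phi_int; exact: GM.
- move=> /Fi e; have /phi_inj {}e := e (phi_int i (GM Bx)) (phi_int i (GM By)).
  by rewrite -(FK Bx) e FK.
- move=> /Fi e; have {}e := e (phi_int i (GM Bx)) (phi_int j (GM By)).
  exact: phi_disj (GM Bx) (GM By) e.
Qed.

(** The chart F conjugates the two systems on the interior of M. *)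
Lemma ball_system_word w p :
  M° p -> F (word_map phi w p) = word_map ball_system w (F p).
Proof.
move=> Mp; have Mw u : M° (word_map phi u p).
  apply: word_map_stable Mp => i x /interior_subset; exact: phi_int.
by elim: w => //= i w <-; rewrite /ball_system /= GK.
Qed.

Lemma ball_system_deriv w x : B x ->
  exists2 J, strict_deriv (word_map ball_system w) x J & 0 < \det J.
Proof.
move=> Bx; elim: w => [|i w [J wJ dJ]] /=.
  by exists 1%:M; [exact: strict_deriv_id|rewrite det1].
have [stab _ _] := ball_system_disjoint.
have Bw := word_map_stable w stab Bx.
have [J' J'd dJ'] := oriented_ball_map HA HF HO (@phi_or i)
  (@phi_C1 i _) Bw (phi_int i (GM Bw)).
exists (J *m J'); last by rewrite det_mulmx mulr_gt0.
exact: (strict_deriv_comp wJ J'd).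
Qed.

Lemma word_ball_family N (w : 'I_N -> seq 'I_n.+1) : cylinder_partition w ->
  ball_family (fun i => word_map ball_system (w i)).
Proof.
move=> wpart; have [stab _ _] := ball_system_disjoint; split.
- by move=> i x y Bx By; exact: word_map_inj ball_system_disjoint Bx By.
- by move=> i x; exact: ball_system_deriv.
- by move=> i x Bx; exact: word_map_stable stab Bx.
- move=> i j x y Bx By.
  exact: (cylinder_partition_word_map _ ball_system_disjoint wpart Bx By).
Qed.

Lemma attractor_interior y : C y -> M° y.
Proof.
case: CphiC => _ _ CM CE; rewrite {1}CE => -[i _ [x Cx <-]].
by apply: phi_int; exact: CM.
Qed.

(** Both families of pieces of M, read in the ball, are families of embedded
    balls; the compact set to be respected is the image of C. *)
Lemma word_exchange N (w w' : 'I_N -> seq 'I_n.+1) T :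
  cylinder_partition w -> cylinder_partition w' -> cdiffeo B T ->
  translates T (fun i => word_map ball_system (w i) 0)
               (fun i => word_map ball_system (w' i) 0) ->
  exists f f' : U -> U, C1_diffeo A A M M f f' /\
    forall i y, C y -> f (word_map phi (w i) y) = word_map phi (w' i) y.
Proof.
move=> wpart wpart' Td Tt.
have cC : compact C by case: CphiC.
have cK : compact (F @` C).
  apply: continuous_compact => //; apply: continuous_in_subspaceT => x.
  by move=> /set_mem/attractor_interior/(ballchart_F_C1 HA HF)[].
have KB : F @` C `<=` B.
  by move=> _ [y /attractor_interior My <-]; exact: F_in.
have [S Sd SE] := match_balls (word_ball_family wpart) (word_ball_family wpart')
  cK KB Td Tt.
have [f [f' [fd fE]]] := ballchart_diff1 HA HF Sd.
exists f, f'; split=> // i y Cy; have My := attractor_interior Cy.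
have stab j p : M° p -> M° (phi j p) by move=> /interior_subset; exact: phi_int.
rewrite fE; last exact: word_map_stable stab My.
rewrite ball_system_word // SE; last by exists y.
by rewrite -ball_system_word // GK //; exact: word_map_stable stab My.
Qed.

End System.

(** * The order on the line *)

Lemma sort_keys (R : realType) (m : nat) (q : 'I_m -> R) : injective q ->
  exists s : 'I_m -> 'I_m, bijective s /\
    forall a b : 'I_m, (a < b)%N -> q (s a) < q (s b).
Proof.
move=> qinj; case: m q qinj => [|m] q qinj.
  by exists id; split=> [|[]//]; exists id.
pose leq := relpre q (fun x y => x <= y).
pose l := sort leq (enum 'I_m.+1).
have sz : size l = m.+1 by rewrite size_sort size_enum_ord.
have ul : uniq l by rewrite sort_uniq enum_uniq.
have sl : sorted leq l by apply: sort_sorted => x y; exact: le_total.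
pose s (a : 'I_m.+1) := nth ord0 l a.
have sinj : injective s.
  by move=> a b /eqP; rewrite nth_uniq ?sz // => /eqP/val_inj.
exists s; split; first exact: injF_bij.
move=> a b ab; rewrite lt_neqAle; apply/andP; split.
  by apply: contraTneq ab => /qinj/sinj ->; rewrite ltnn.
have tr : transitive leq by move=> x y z; exact: le_trans.
have rf : reflexive leq by move=> x; exact: lexx.
have al : val a \in [pred k | (k < size l)%N] by rewrite inE sz ltn_ord.
have bl : val b \in [pred k | (k < size l)%N] by rewrite inE sz ltn_ord.
exact: (sorted_leq_nth tr rf ord0 sl _ _ al bl (ltnW ab)).
Qed.

Definition precedes (R : realType) (x y : 'rV[R]_1) : bool := x 0 0 < y 0 0.

(** The mean value theorem; in dimension 1 the determinant is the
    derivative. *)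
Lemma positive_derivative_increasing (R : realType) (f : 'rV[R]_1 -> 'rV[R]_1) :
  (forall x, unit_ball R 1 x -> exists2 J, strict_deriv f x J & 0 < \det J) ->
  forall x y, unit_ball R 1 x -> unit_ball R 1 y ->
  precedes x y -> precedes (f x) (f y).
Proof.
move=> fd x y Bx By xy.
pose z (t : R) := (1 - t) *: x + t *: y.
have Bz (t : R) : 0 <= t <= 1 -> unit_ball R 1 (z t) by move=> h; exact: unit_ball_convex.
pose g (t : R) : R := f (z t) 0 0.
pose dg (t : R) : R := ((y - x) *m 'J f (z t)) 0 0.
have zE s t : z (s + t) - z t = s *: (y - x).
  by rewrite /z; apply/rowP => j; rewrite !mxE; ring.
have gd (t : R) : 0 <= t <= 1 -> is_derive t 1 g (dg t).
  move=> t01; have [J fJ _] := fd _ (Bz t t01).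
  have {}fJ : strict_deriv f (z t) ('J f (z t)).
    by apply: strict_diff_jacobian; exists J.
  apply: is_derive_eps => e e0.
  have n0 : 0 < 1 + `|y - x| by rewrite ltr_wpDr.
  have [r r0 rP] := strict_deriv_ray fJ (divr_gt0 e0 n0).
  exists (r / (1 + `|y - x|)) => [|h hr]; first by rewrite divr_gt0.
  have := rP (z (h + t)); rewrite zE normrZ.
  have -> : `|h| * `|y - x| < r.
    rewrite ltr_pdivlMr // in hr; apply: le_lt_trans hr.
    by rewrite ler_wpM2l // lerDr.
  move=> /(_ isT) /(le_trans (rV_entry_le _ 0)).
  rewrite -scalemxAl !entryB entryZ -/(g _) -/(g _) -/(dg t) => /le_trans; apply.
  rewrite mulrA mulrAC ler_wpM2r //.
  by rewrite mulrAC ler_pdivrMr // ler_pM2l // lerDr.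
have [c c01] : exists2 c, c \in `[0, 1] & g 1 - g 0 = dg c * (1 - 0).
  apply: MVT_segment => //.
    by move=> t; rewrite in_itv /= => /andP[t0 t1]; apply: gd; rewrite !ltW.
  apply: derivable_within_continuous => t; rewrite in_itv /= => t01.
  by have [] := gd t t01.
rewrite in_itv /= in c01.
rewrite subr0 mulr1 => gE.
have dgc : 0 < dg c.
  have [J fJ dJ] := fd _ (Bz c c01).
  have {}fJ := strict_deriv_unique fJ (strict_diff_jacobian (ex_intro _ J fJ)).
  rewrite det_mx11 in dJ; rewrite /dg -fJ.
  rewrite mxE big_ord1 !mxE mulr_gt0 // subr_gt0; exact: xy.
have z0 : z 0 = x by rewrite /z subr0 scale1r scale0r addr0.
have z1 : z 1 = y by rewrite /z subrr scale1r scale0r add0r.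
by move: gE dgc; rewrite /precedes /g z0 z1 => <-; rewrite subr_gt0.
Qed.

(** The images are intervals, so that comparing one point of each compares
    them. *)
Lemma disjoint_images_ordered (R : realType) (f g : 'rV[R]_1 -> 'rV[R]_1) :
  (forall x, unit_ball R 1 x -> {for x, continuous f}) ->
  (forall x, unit_ball R 1 x -> {for x, continuous g}) ->
  (forall x y, unit_ball R 1 x -> unit_ball R 1 y -> f x <> g y) ->
  precedes (f 0) (g 0) ->
  forall x y, unit_ball R 1 x -> unit_ball R 1 y -> precedes (f x) (g y).
Proof.
move=> fc gc fg fg0 x y Bx By; rewrite /precedes ltNge; apply/negP => gf.
pose k (t : R) := g (t *: y) 0 0 - f (t *: x) 0 0.
have Bt (t : R) z : unit_ball R 1 z -> 0 <= t <= 1 -> unit_ball R 1 (t *: z).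
  move=> Bz t01; have := unit_ball_convex t01 (@unit_ball0 R 1) Bz.
  by rewrite scaler0 add0r.
have kc (h : 'rV[R]_1 -> 'rV[R]_1) z : unit_ball R 1 z ->
    (forall x, unit_ball R 1 x -> {for x, continuous h}) ->
    {in `[0, 1]%classic, continuous (fun t : R => h (t *: z) 0 0)}.
  move=> Bz hc t /set_mem; rewrite /= in_itv /= => t01.
  have h1 : {for t, continuous (fun s : R => h (s *: z))}.
    apply: (@continuous_comp _ _ _ (fun s : R => s *: z) h).
      exact: scalel_continuous.
    exact: hc (Bt _ _ Bz t01).
  apply: (@continuous_comp _ _ _ (fun s : R => h (s *: z)) (fun w : 'rV[R]_1 => w 0 0)) => //.
  exact: coord_continuous.
have [t] : exists2 t, t \in `[0, 1] & k t = 0.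
  apply: IVT => //.
    apply: continuous_in_subspaceT => t t01.
    by apply: continuousB; [exact: kc t01|exact: kc t01].
  rewrite ge_min le_max; apply/andP; split; apply/orP; [right|left].
    by rewrite /k !scale1r subr_le0.
  by rewrite /k !scale0r subr_ge0 ltW.
rewrite in_itv /= => t01 kt; apply: (fg (t *: x) (t *: y)); try exact: Bt.
by apply/rowP => j; rewrite ord1; move/eqP: kt; rewrite subr_eq0 => /eqP.
Qed.

Lemma lex_total (m : nat) (s t : nat -> 'I_m) :
  s <> t -> lex_lt s t \/ lex_lt t s.
Proof.
move=> st; have ex : exists k, s k != t k.
  apply: contrapT => nex; apply: st; apply/funext => k.
  by apply: contrapT => /eqP h; apply: nex; exists k.
case: (ex_minnP ex) => k sk kmin.
have eq i : (i < k)%N -> s i = t i.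
  by move=> ik; apply/eqP; apply: contraTT ik => /kmin; rewrite leqNgt.
have [lt|lt|e] := ltngtP (s k) (t k).
- by left; exists k.
- by right; exists k => // i /eq.
- by move: sk; rewrite (val_inj e) eqxx.
Qed.

(** Remove the common prefix with the increasing maps; the first difference
    decides. *)
Lemma lex_word_map (R : realType) (m : nat) (psi : 'I_m -> 'rV[R]_1 -> 'rV[R]_1)
    w w' s t x y :
  (forall i x, unit_ball R 1 x -> unit_ball R 1 (psi i x)) ->
  (forall i x y, unit_ball R 1 x -> unit_ball R 1 y -> precedes x y ->
    precedes (psi i x) (psi i y)) ->
  (forall (a b : 'I_m) x y, (a < b)%N -> unit_ball R 1 x -> unit_ball R 1 y ->
    precedes (psi a x) (psi b y)) ->
  unit_ball R 1 x -> unit_ball R 1 y ->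
  (forall v, w' <> w ++ v) -> (forall v, w <> w' ++ v) ->
  lex_lt (prepend w s) (prepend w' t) ->
  precedes (word_map psi w x) (word_map psi w' y).
Proof.
move=> stab incr sep Bx By.
elim: w w' => [|a w IH] [|b w'] ww' w'w.
- by case: (ww' [::]).
- by case: (ww' (b :: w')).
- by case: (w'w (a :: w)).
move=> [[|k] below at_k].
  by apply: sep => //; exact: word_map_stable.
have ab : a = b by exact: (below 0%N).
rewrite /= -ab; apply: incr; [exact: word_map_stable|exact: word_map_stable|].
apply: IH => [v e|v e|].
- by apply: (ww' v); rewrite /= -ab e.
- by apply: (w'w v); rewrite /= -ab e.
- by exists k => [i ik|]; [exact: (below i.+1)|exact: at_k].
Qed.

(** * Copies of the Thompson groups *)

Lemma contractive_ratio (R : realType) (U : metricType R) (n : nat)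
    (phi : 'I_n.+1 -> U -> U) : contractive phi ->
  exists l : R, [/\ 0 <= l, l < 1 &
    forall j x y, mdist (phi j x) (phi j y) <= l * mdist x y].
Proof.
move=> phiC.
have ratio j : exists2 r : R, 0 < r & r <= 1 /\
    forall x y, mdist (phi j x) (phi j y) <= (1 - r) * mdist x y.
  have lip x y : x != y ->
      ((mdist (phi j x) (phi j y) / mdist x y)%:E <= lipschitz_constant (phi j))%E.
    by move=> xy; apply: ereal_sup_ubound; exists (x, y).
  have diag r x y : x = y -> mdist (phi j x) (phi j y) <= (1 - r) * mdist x y.
    by move=> ->; rewrite !mdistxx mulr0.
  have := phiC j; case: lipschitz_constant lip => [l| |] //= lip l1.
    rewrite lte_fin in l1; exists (1 - Num.max 0 l).
      by rewrite subr_gt0 gt_max l1 ltr01.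
    split=> [|x y]; first by rewrite lerBlDr lerDl le_max lexx.
    have [/diag//|xy] := eqVneq x y.
    have := lip _ _ xy; rewrite lee_fin ler_pdivrMr ?mdist_gt0 //.
    move=> /le_trans; apply; rewrite ler_wpM2r ?mdist_ge0 // subKr le_max.
    by rewrite lexx orbT.
  exists 1 => //; split=> // x y; have [/diag//|/lip] := eqVneq x y.
  by rewrite leNgt ltNyr.
have [r r0 rP] := @uniform_radius R n.+1
  (fun j r => r <= 1 /\ forall x y, mdist (phi j x) (phi j y) <= (1 - r) * mdist x y)
  (fun j r s _ sr rP => conj (le_trans sr rP.1) (fun x y => le_trans (rP.2 x y)
    (ler_wpM2r (mdist_ge0 x y) (lerB (lexx 1) sr)))) ratio.
exists (1 - r); split=> [||j x y]; last by case: (rP j).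
  by rewrite subr_ge0; case: (rP ord0).
by rewrite ltrBlDr ltrDl.
Qed.

Section Realization.
Context (R : realType) (U : metricType R) (d n : nat) (A O : set (chart R U d))
  (M C : set U) (F : U -> 'rV[R]_d) (G : 'rV[R]_d -> U)
  (phi : 'I_n.+1 -> U -> U) (lambda : R).
Local Notation E := (euclidean_atlas R d).
Context (HA : C1_atlas A) (HF : C1_diffeo A E M (closed_unit_ball R d) F G)
  (HO : orientation A O) (phi_or : forall j, orientation_preserving O (phi j))
  (phi_C1 : forall j p, C1_at A A (phi j) p)
  (phi_inj : forall j x y, phi j x = phi j y -> x = y)
  (phi_int : forall j x, M x -> M° (phi j x))
  (phi_disj : forall i j x y, M x -> M y -> phi i x = phi j y -> i = j)
  (l0 : 0 <= lambda) (l1 : lambda < 1)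
  (contr : forall i x y, mdist (phi i x) (phi i y) <= lambda * mdist x y)
  (CphiC : attractor phi M C).

Let psi := ball_system F G phi.

(** What is left to check for a group of word exchanges: the centres of the
    balls of the first family can be carried to those of the second. *)
Lemma contains_copy_of_movable (H : set ((nat -> 'I_n.+1) -> (nat -> 'I_n.+1))) :
  (forall h N (w w' : 'I_N -> seq 'I_n.+1), H h ->
    cylinder_partition w -> cylinder_partition w' ->
    (forall i s, h (prepend (w i) s) = prepend (w' i) s) ->
    exists2 T, cdiffeo (unit_ball R d) T &
      translates T (fun i => word_map psi (w i) 0) (fun i => word_map psi (w' i) 0)) ->
  H `<=` thompson_V n.+1 ->
  contains_copy_of (diff1 A M C) H.
Proof.
move=> Hmove HV.
have phiM := phi_disjoint_system phi_inj phi_int phi_disj.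
apply: (contains_copy_itinerary phiM l1 contr CphiC) => h g Hh hg.
have [N [w [w' [wpart wpart' hw]]]] := HV _ Hh.
have [T Td Tt] := Hmove h N w w' Hh wpart wpart' hw.
have [f [f' [fd fE]]] := word_exchange HA HF HO phi_or phi_C1 phi_inj phi_int
  phi_disj CphiC wpart wpart' Td Tt.
have [f_itin fC] := word_exchange_itinerary l0 l1 contr CphiC wpart wpart' hw fE.
exists f, f'; split=> // x.
have [s sx] := itinerary_ex CphiC (set_valP x).
have e := itinerary_unique l0 l1 contr CphiC (f_itin _ _ sx) (hg _ _ sx).
exact: e.
Qed.

Let centre_in N (w : 'I_N -> seq 'I_n.+1) i :
  unit_ball R d (word_map psi (w i) 0).
Proof.
have [stab _ _] := ball_system_disjoint HA HF phi_inj phi_int phi_disj.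
exact: word_map_stable stab (@unit_ball0 R d).
Qed.

Let centre_inj N (w : 'I_N -> seq 'I_n.+1) : cylinder_partition w ->
  injective (fun i => word_map psi (w i) 0).
Proof.
move=> wpart i j e.
have B0 := @unit_ball0 R d.
exact: (cylinder_partition_word_map _
  (ball_system_disjoint HA HF phi_inj phi_int phi_disj) wpart B0 B0 e).
Qed.

Lemma contains_copy_of_V : (2 <= d)%N ->
  contains_copy_of (diff1 A M C) (thompson_V n.+1).
Proof.
move=> d2; apply: contains_copy_of_movable => // h N w w' _ wpart wpart' _.
by apply: move_points_dim2 => //; [exact: centre_inj|exact: centre_inj].
Qed.

End Realization.

Section RealizationDim1.
Context (R : realType) (U : metricType R) (n : nat) (A O : set (chart R U 1))
  (M C : set U) (F : U -> 'rV[R]_1) (G : 'rV[R]_1 -> U)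
  (phi : 'I_n.+1 -> U -> U) (lambda : R).
Local Notation E := (euclidean_atlas R 1).
Context (HA : C1_atlas A) (HF : C1_diffeo A E M (closed_unit_ball R 1) F G)
  (HO : orientation A O) (phi_or : forall j, orientation_preserving O (phi j))
  (phi_C1 : forall j p, C1_at A A (phi j) p)
  (phi_inj : forall j x y, phi j x = phi j y -> x = y)
  (phi_int : forall j x, M x -> M° (phi j x))
  (phi_disj : forall i j x y, M x -> M y -> phi i x = phi j y -> i = j)
  (l0 : 0 <= lambda) (l1 : lambda < 1)
  (contr : forall i x y, mdist (phi i x) (phi i y) <= lambda * mdist x y)
  (CphiC : attractor phi M C).

Let psi := ball_system F G phi.
Let psiB : disjoint_system psi (unit_ball R 1) :=
  ball_system_disjoint HA HF phi_inj phi_int phi_disj.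
Let B0 := @unit_ball0 R 1.

Let psi_deriv j x : unit_ball R 1 x -> exists2 J, strict_deriv (psi j) x J & 0 < \det J.
Proof.
exact: (ball_system_deriv HA HF HO phi_or phi_C1 phi_inj phi_int phi_disj [:: j]).
Qed.

(** An element that respects the lexicographic order matches balls that come in
    the same order on the line. *)
Lemma contains_copy_of_F_sorted :
  (forall a b : 'I_n.+1, (a < b)%N -> precedes (psi a 0) (psi b 0)) ->
  contains_copy_of (diff1 A M C) (thompson_F n.+1).
Proof.
move=> psi_sorted.
have [stab psiinj psidisj] := psiB.
have cont j x : unit_ball R 1 x -> {for x, continuous (psi j)}.
  by move=> /(psi_deriv j)[J /strict_deriv_continuous].
have sep (a b : 'I_n.+1) x y : (a < b)%N -> unit_ball R 1 x -> unit_ball R 1 y ->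
    precedes (psi a x) (psi b y).
  move=> ab; apply: disjoint_images_ordered; [exact: cont|exact: cont| |exact: psi_sorted].
  by move=> x' y' Bx By /(psidisj _ _ _ _ Bx By) e; rewrite e ltnn in ab.
have incr i x y : unit_ball R 1 x -> unit_ball R 1 y -> precedes x y ->
    precedes (psi i x) (psi i y).
  by apply: positive_derivative_increasing; exact: psi_deriv.
apply: (contains_copy_of_movable HA HF HO phi_or phi_C1 phi_inj phi_int phi_disj
  l0 l1 contr CphiC); last by move=> h [].
move=> h N w w' [_ h_lex] wpart wpart' hw.
have incomparable (u : 'I_N -> seq 'I_n.+1) i j v :
    cylinder_partition u -> i != j -> u j <> u i ++ v.
  move=> upart ij e; pose s : nat -> 'I_n.+1 := fun=> ord0.
  have [k [_ ks]] := upart (prepend (u j) s).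
  have kj : k = j by apply: ks; exists s.
  have ki : k = i by apply: ks; exists (prepend v s); rewrite // e prepend_cat.
  by move: ij; rewrite -ki -kj eqxx.
have ordered (u : 'I_N -> seq 'I_n.+1) s t i j : cylinder_partition u -> i != j ->
    lex_lt (prepend (u i) s) (prepend (u j) t) ->
    precedes (word_map psi (u i) 0) (word_map psi (u j) 0).
  move=> upart ij; apply: lex_word_map => // v; apply: incomparable => //.
  by rewrite eq_sym.
pose s : nat -> 'I_n.+1 := fun=> ord0.
have cinj (u : 'I_N -> seq 'I_n.+1) : cylinder_partition u ->
    injective (fun i => word_map psi (u i) 0).
  move=> upart i j e; exact: (cylinder_partition_word_map _ psiB upart B0 B0 e).
apply: move_points_dim1.
- exact: cinj.
- move=> i j pij; have ij : i != j.
    by apply: contraTneq pij => ->; rewrite ltxx.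
  have neq : prepend (w i) s <> prepend (w j) s.
    move=> e; have [k [_ ks]] := wpart (prepend (w i) s).
    have ki : k = i by apply: ks; exists s.
    have kj : k = j by apply: ks; exists s.
    by move: ij; rewrite -ki -kj eqxx.
  have [lt|lt] := lex_total neq.
    by apply: (ordered w' s s) => //; rewrite -!hw; exact: h_lex.
  have := ordered w s s j i wpart; rewrite eq_sym => /(_ ij lt).
  by rewrite /precedes ltNge ltW.
- by move=> i; exact: word_map_stable stab B0.
- by move=> i; exact: word_map_stable stab B0.
Qed.

End RealizationDim1.

Theorem theorem5 (R : realType) (D : nat) (U : metricType R)
    (A : set (chart R U D)) (n d : nat) (phi : 'I_n.+1 -> U -> U)
    (M C : set U) :
  @second_countable U ->
  C1_atlas A ->
  (1 <= n)%N ->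
  C1_invertible_IFS A phi M ->
  contractive phi ->
  diffeomorphic_to_ball A d M ->
  attractor phi M C ->
  (d = 1%N -> contains_copy_of (diff1 A M C) (thompson_F n.+1)) /\
  ((2 <= d)%N -> contains_copy_of (diff1 A M C) (thompson_V n.+1)).
Proof.
move=> _ HA _ [ [Or HO phi_or] phi_diffeo [cM _ phi_int' phi_disj']] phi_contr.
move=> [F [G HF]] CphiC.
have phi_int j x : M x -> M° (phi j x) by move=> Mx; apply: (phi_int' j); exists x.
have phi_disj i j x y : M x -> M y -> phi i x = phi j y -> i = j.
  move=> Mx My e; apply: contrapT => /eqP/phi_disj'/seteqP[sub _].
  by apply: (sub (phi i x)); split; [exists x|exists y].
have phi_inj j x y : phi j x = phi j y -> x = y.
  have [g [_ gK _ _]] := phi_diffeo j.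
  by move=> /(congr1 g); rewrite !gK.
have phi_C1 j p : C1_at A A (phi j) p.
  have [g [_ _ phiC1 _]] := phi_diffeo j.
  by apply: (C1_on_open (atlas_charts HA) _ phiC1); exact: nearW.
have [l [l0 l1 contr]] := contractive_ratio phi_contr.
have [c Cc] : C !=set0 by case: CphiC.
have CM : C `<=` M by case: CphiC.
have Dd : D = d := ballchart_dim HA HF (phi_int ord0 c (CM c Cc)).
subst D; split=> [d1|]; last first.
  exact: (contains_copy_of_V HA HF HO phi_or phi_C1 phi_inj phi_int phi_disj
    l0 l1 contr CphiC).
subst d.
(* The images of the maps may come in any order on the line: for the action
   of the Thompson group F to preserve the order, letters are first renamed from left to right. *)
pose q j := ball_system F G phi j 0 0 0.
have [_ _ psi_disj] := ball_system_disjoint HA HF phi_inj phi_int phi_disj.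
have B0 := @unit_ball0 R 1.
have q_inj : injective q.
  move=> i j e; apply: (psi_disj i j 0 0 B0 B0); apply/rowP => k; rewrite ord1; exact: e.
have [s [s_bij s_sorted]] := sort_keys q_inj.
have CphiC' : attractor (fun j => phi (s j)) M C.
  case: CphiC => C0 cC _ CE; split=> //; rewrite {1}CE.
  have [s' sK s'K] := s_bij.
  apply/seteqP; split=> x [j _ [y Cy <-]]; last by exists (s j) => //; exists y.
  by exists (s' j) => //; exists y; rewrite ?s'K.
apply: (contains_copy_of_F_sorted (phi := fun j => phi (s j)) HA HF HO
  _ _ _ _ _ l0 l1 _ CphiC').
- by move=> j; exact: phi_or.
- by move=> j p; exact: phi_C1.
- by move=> j x y; exact: phi_inj.
- by move=> j x; exact: phi_int.
- by move=> i j x y Mx My /(phi_disj _ _ _ _ Mx My)/(bij_inj s_bij).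
- by move=> j x y; exact: contr.
- by move=> a b ab; exact: s_sorted ab.
Qed.
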